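(* Let $(X,d,\ll,\leq,\tau)$ be a locally strictly timelike geodesically connected Lorentzian pre-length space and let $K\in\mathbb{R}$. Then $X$ has timelike curvature bounded below (respectively above) by $K$ if and only if it satisfies timelike $K$-monotonicity comparison from below (respectively above).
   Context: A causal space is a set $X$ with two transitive relations $\ll,\leq$ such that $\leq$ is reflexive and $p\ll q$ implies $p\leq q$. A Lorentzian pre-length space $(X,d,\ll,\leq,\tau)$ is a causal space with a metric $d$ and a map $\tau\colon X\times X\to[0,\infty]$ that is lower semicontinuous with respect to $d$, satisfies $\tau(p,r)\geq\tau(p,q)+\tau(q,r)$ for $p\leq q\leq r$, and $\tau(p,q)>0\Leftrightarrow p\ll q$. A non-constant locally Lipschitz curve $\gamma\colon I\to X$ is future directed causal (timelike) if $\gamma(t_1)\leq\gamma(t_2)$ ($\gamma(t_1)\ll\gamma(t_2)$) for all $t_1<t_2$; past directed with relations reversed. $L_\tau(\gamma)$ is the infimum of $\sum_i\tau(\gamma(t_i),\gamma(t_{i+1}))$ over partitions. A distance realizer (maximal geodesic) from $p$ to $q$ is a future directed causal curve from $p$ to $q$ with $L_\tau(\gamma)=\tau(p,q)$ (a past directed curve is a distance realizer if its reversal is). An open set $U$ is strictly timelike geodesically connected if for all $x\ll y$ in $U$ there is a future directed maximal geodesic in $U$ from $x$ to $y$, and any such maximal geodesic in $U$ is timelike. $X$ is locally strictly timelike geodesically connected if it is covered by such sets. Model spaces: $\mathbb{R}^n_m$ is $\mathbb{R}^n$ with $b(v,w)=-\sum_{i\leq m}v_iw_i+\sum_{i>m}v_iw_i$.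 $\mathbb{L}^2(K)$ is the universal cover of $\{v\in\mathbb{R}^3_1:b(v,v)=1/K\}$ for $K>0$, of $\{v\in\mathbb{R}^3_2:b(v,v)=-1/|K|\}$ for $K<0$, and $\mathbb{R}^2_1$ for $K=0$ (constant curvature $K$), with time separation $\bar\tau$. $D_K=\pi/\sqrt{-K}$ for $K<0$, $D_K=\infty$ for $K\geq0$. A triangle satisfies timelike size bounds for $K$ if its longest side-length is $<D_K$. A timelike triangle consists of $p_1\ll p_2\ll p_3$ with finite mutual time separations and future directed causal distance realizers (sides) from $p_i$ to $p_j$, $i<j$. A comparison triangle in $\mathbb{L}^2(K)$ is a triple of points with the same causal order and time separations (exists under size bounds, unique up to isometry); a point $q$ on the side from $p_i$ to $p_j$ corresponds to $\bar q$ on the side from $\bar p_i$ to $\bar p_j$ with $\bar\tau(\bar p_i,\bar q)=\tau(p_i,q)$. $X$ has timelike curvature bounded below (above) by $K$ if it is covered by open sets $U$ such that (1) $\tau$ is finite and continuous on $U\times U$; (2) $U$ is strictly timelike geodesically connected; (3) for every timelike triangle in $U$ satisfying timelike size bounds for $K$, all $q_1,q_2$ on its sides and corresponding points $\bar q_1,\bar q_2$ on a comparison triangle in $\mathbb{L}^2(K)$, $\tau(q_1,q_2)\leq\bar\tau(\bar q_1,\bar q_2)$ (respectively $\geq$). $K$-comparison angle: if $x,y,z$ are pairwise causally related with finite time separations (satisfying timelike size bounds for $K$), and $y,z$ are timelike related to $x$ (in either direction), then $\tilde\measuredangle^K_x(y,z)=\operatorname{arcosh}|\langle u,v\rangle|$,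 where $u,v$ are the unit timelike initial velocities at $\bar x$ of the geodesics from $\bar x$ to $\bar y$ and $\bar z$ in a comparison triangle in $\mathbb{L}^2(K)$. The signed angle is $\tilde\measuredangle^{K,\mathrm S}_x(y,z)=\sigma\tilde\measuredangle^K_x(y,z)$, with $\sigma=-1$ if $x$ is the past or future endpoint of the triangle (i.e. $y,z$ both in the future or both in the past of $x$) and $\sigma=1$ otherwise. $X$ satisfies timelike $K$-monotonicity comparison from below (above) if every point has a neighborhood $U$ such that (i) $\tau|_{U\times U}$ is finite and continuous; (ii) whenever $x,y\in U$ with $x\ll y$, there is a future directed maximal timelike geodesic in $U$ from $x$ to $y$; (iii) whenever $\alpha\colon[0,a]\to U$, $\beta\colon[0,b]\to U$ are timelike distance realizers (each future or past directed) with $x:=\alpha(0)=\beta(0)$, the function $\theta(s,t):=\tilde\measuredangle_x^{K,\mathrm S}(\alpha(s),\beta(t))$, defined for those $(s,t)\in(0,a]\times(0,b]$ such that $\alpha(s),\beta(t)$ are causally related (and the $K$-comparison angle is defined), is monotonically increasing (respectively decreasing) in $s$ and in $t$. *)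

(* Defs.v *)
From HB Require Import structures.
From mathcomp Require Import all_boot all_order all_algebra.
From mathcomp Require Import all_classical all_reals all_analysis.
From mathcomp Require Import ring.

Set Implicit Arguments.
Unset Strict Implicit.
Unset Printing Implicit Defensive.

Import Order.TTheory GRing.Theory Num.Theory.
Import numFieldNormedType.Exports.

Local Open Scope classical_set_scope.
Local Open Scope ring_scope.

Record lorentzian_pre_length (R : realType) (X : metricType R) := LPLS {
  chron : X -> X -> Prop; (* p << q *)
  caus : X -> X -> Prop;  (* p <= q *)
  tau : X -> X -> \bar R;
  chron_trans : forall p q r, chron p q -> chron q r -> chron p r;
  caus_trans : forall p q r, caus p q -> caus q r -> caus p r;
  caus_refl : forall p, caus p p;
  chron_caus : forall p q, chron p q -> caus p q;
  tau_ge0 : forall p q, (0 <= tau p q)%E;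
  tau_lsc : lower_semicontinuous (fun x : X * X => tau x.1 x.2);
  tau_triangle : forall p q r, caus p q -> caus q r ->
    (tau p q + tau q r <= tau p r)%E;
  tau_gt0 : forall p q, (0 < tau p q)%E <-> chron p q }.

(** A curve is a map on [lo, hi]; the values of [crv] outside [lo, hi] are
    never used. *)
Record curve (R : realType) (X : Type) := Curve {
  crv :> R -> X;
  lo : R;
  hi : R }.

Section Curves.
Variables (R : realType) (X : metricType R) (L : lorentzian_pre_length X).
Implicit Types (g : curve R X) (U : set X).

Definition cdom g : set R := `[lo g, hi g]%classic.

Definition in_set g U := forall t, cdom g t -> U (g t).

Definition non_constant g :=
  exists s t, [/\ cdom g s, cdom g t & g s <> g t].

Definition locally_lipschitz g := forall t, cdom g t ->
  exists e C : R, 0 < e /\ forall s s', cdom g s -> cdom g s' ->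
    `|s - t| < e -> `|s' - t| < e -> mdist (g s) (g s') <= C * `|s - s'|.

Definition future_curve (rel : X -> X -> Prop) g :=
  [/\ non_constant g, locally_lipschitz g &
      forall s t, cdom g s -> cdom g t -> s < t -> rel (g s) (g t)].

Definition future_causal g := future_curve (caus L) g.
Definition future_timelike g := future_curve (chron L) g.

Definition tau_sum g (s : seq R) : \bar R :=
  let G := g \o nth (hi g) (lo g :: s) in
  (\sum_(0 <= i < size s) tau L (G i) (G i.+1))%E.

Definition tau_length g : \bar R :=
  ereal_inf [set tau_sum g s | s in itv_partition (lo g) (hi g)].

Definition realizer g p q :=
  [/\ future_causal g, g (lo g) = p, g (hi g) = q & tau_length g = tau L p q].

Definition reverse g : curve R X :=
  Curve (fun t => g (lo g + hi g - t)) (lo g) (hi g).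

(** Future or past directed: a past directed curve is timelike, respectively a
    distance realizer, when its reversal is. *)
Definition timelike_realizer g :=
  (future_timelike g /\ realizer g (g (lo g)) (g (hi g))) \/
  (future_timelike (reverse g) /\
   realizer (reverse g) (g (hi g)) (g (lo g))).

Definition strictly_timelike_geodesically_connected U :=
  forall x y, U x -> U y -> chron L x y ->
    (exists g, in_set g U /\ realizer g x y) /\
    (forall g, in_set g U -> realizer g x y -> future_timelike g).

Definition locally_strictly_timelike_geodesically_connected :=
  forall p : X, exists U,
    open_nbhs p U /\ strictly_timelike_geodesically_connected U.

Definition tau_finite_continuous U :=
  (forall x y, U x -> U y -> (tau L x y < +oo)%E) /\
  {within U `*` U, continuous (fun x : X * X => tau L x.1 x.2)}.

End Curves.

Definition cosh (R : realType) (x : R) : R := (expR x + expR (- x)) / 2.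
Definition sinh (R : realType) (x : R) : R := (expR x - expR (- x)) / 2.

(** Only used for [1 <= x]. *)
Definition arcosh (R : realType) (x : R) : R := ln (x + Num.sqrt (x ^+ 2 - 1)).

(** The bilinear form of R^n_m: the first [m] coordinates are the negative
    ones. *)
Definition bform (R : realType) (n m : nat) (v w : 'rV[R]_n) : R :=
  \sum_(i < n) (if (i < m)%N then -1 else 1) * (v ord0 i * w ord0 i).

Section Model.
Variables (R : realType) (K : R).

(** L^2(K) is carried by its universal covering chart [R * R] together with the
    covering map [emb] onto the hyperquadric
    { v in R^3_1 | b(v,v) = 1/K } for K > 0,
    { v in R^3_2 | b(v,v) = 1/K } for K < 0 (note -1/|K| = 1/K);
    for K = 0, [emb] identifies [R * R] with R^2_1.
    In all cases the first chart coordinate is timelike and increases towards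
    the future. *)
Definition model := (R * R)%type.

Definition model_dim : nat := if K == 0 then 2 else 3.
Definition model_index : nat := if K < 0 then 2 else 1.

Definition radius : R := (Num.sqrt `|K|)^-1.

Definition emb_coords (p : model) : seq R :=
  let: (t, x) := p in
  if 0 < K then
    [:: radius * sinh t; radius * (cosh t * cos x); radius * (cosh t * sin x)]
  else if K < 0 then
    [:: radius * (cosh x * cos t); radius * (cosh x * sin t); radius * sinh x]
  else [:: t; x].

Definition emb (p : model) : 'rV[R]_model_dim :=
  \row_(i < model_dim) nth 0 (emb_coords p) i.

Definition b (v w : 'rV[R]_model_dim) : R := bform model_index v w.

Definition velocity (c : R -> model) : R -> 'rV[R]_model_dim :=
  derive1 (emb \o c).

(** A C^1 future directed causal curve on [r, s] (given as the restriction of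
    a C^1 map on the real line). *)
Definition C1_future_causal (c : R -> model) (r s : R) :=
  [/\ r < s,
      forall t, derivable c t 1,
      continuous (derive1 c) &
      forall t, r <= t <= s ->
        0 < (derive1 c t).1 /\ b (velocity c t) (velocity c t) <= 0].

Definition lorentzian_length (c : R -> model) (r s : R) : R :=
  \int[lebesgue_measure]_(t in `[r, s])
    Num.sqrt (- b (velocity c t) (velocity c t)).

(** [causal_path p q l]: there is a piecewise C^1 future directed causal curve
    of length [l] from [p] to [q], i.e. a finite concatenation of C^1 ones. *)
Inductive causal_path : model -> model -> R -> Prop :=
| CausalC1 c r s : C1_future_causal c r s ->
    causal_path (c r) (c s) (lorentzian_length c r s)
| CausalCat p q r l l' :
    causal_path p q l -> causal_path q r l' -> causal_path p r (l + l').

Definition model_caus (p q : model) := p = q \/ exists l, causal_path p q l.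

(** With the convention that [model_tau p q = 0] if [p] is not causally before
    [q]. *)
Definition model_tau (p q : model) : \bar R :=
  ereal_sup ([set 0%E] `|` [set l%:E | l in causal_path p q]).

Definition tangent (p : model) : set 'rV[R]_model_dim :=
  [set w | K != 0 -> b (emb p) w = 0].

(** Unit speed timelike geodesics of the (geodesically complete) space L^2(K):
    the acceleration in the ambient space R^n_m is normal to the surface. *)
Definition timelike_geodesic (c : R -> model) :=
  [/\ continuous c,
      forall s, derivable (emb \o c) s 1,
      forall s, derivable (velocity c) s 1,
      forall s, b (velocity c s) (velocity c s) = -1 &
      forall s w, tangent (c s) w -> b (derive1 (velocity c) s) w = 0].

(** It may be future or past directed. *)
Definition geodesic_from_to (c : R -> model) (l : R) (x y : model) :=
  [/\ timelike_geodesic c, 0 < l, c 0 = x & c l = y].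

Definition on_model_side (x y q : model) :=
  exists c l s, [/\ geodesic_from_to c l x y, 0 <= s <= l & q = c s].

Definition model_diameter : \bar R :=
  if K < 0 then (pi / Num.sqrt (- K))%:E else +oo%E.

End Model.

Section Comparison.
Variables (R : realType) (X : metricType R) (L : lorentzian_pre_length X).
Variable K : R.
Implicit Types (U : set X) (p : 'I_3 -> X).

Definition finite_separations p := forall i j, (tau L (p i) (p j) < +oo)%E.

Definition size_bounds p := forall i j, (tau L (p i) (p j) < model_diameter K)%E.

(** Agreement of the relation << is implied by the equality of the time
    separations.  For <= only an implication is required: if y <= z with
    tau y z = 0 and tau x y = tau x z, then y and z have the same comparison
    point even though z <= y may fail. *)
Definition comparison_triangle p (pb : 'I_3 -> model R) :=
  forall i j, (caus L (p i) (p j) -> model_caus K (pb i) (pb j)) /\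
              model_tau K (pb i) (pb j) = tau L (p i) (p j).

Definition timelike_triangle p (side : 'I_3 -> 'I_3 -> curve R X) :=
  [/\ forall i j : 'I_3, (i < j)%N -> chron L (p i) (p j),
      finite_separations p &
      forall i j : 'I_3, (i < j)%N -> realizer L (side i j) (p i) (p j)].

Definition corresponds (x q : X) (xb yb qb : model R) :=
  on_model_side K xb yb qb /\ model_tau K xb qb = tau L x q.

Definition triangle_comparison (cmp : rel (\bar R)) U :=
  forall p (side : 'I_3 -> 'I_3 -> curve R X) (pb : 'I_3 -> model R),
    timelike_triangle p side ->
    (forall i j : 'I_3, (i < j)%N -> in_set (side i j) U) ->
    size_bounds p ->
    comparison_triangle p pb ->
  forall (i j k l : 'I_3) (s t : R) (q1b q2b : model R),
    (i < j)%N -> (k < l)%N ->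
    cdom (side i j) s -> cdom (side k l) t ->
    corresponds (p i) (side i j s) (pb i) (pb j) q1b ->
    corresponds (p k) (side k l t) (pb k) (pb l) q2b ->
  cmp (tau L (side i j s) (side k l t)) (model_tau K q1b q2b).

Definition curvature_bounded (cmp : rel (\bar R)) :=
  forall p : X, exists U,
    [/\ open_nbhs p U, tau_finite_continuous L U,
        strictly_timelike_geodesically_connected L U &
        triangle_comparison cmp U].

Definition timelike_curvature_bounded_below :=
  curvature_bounded (fun x y => (x <= y)%E).
Definition timelike_curvature_bounded_above :=
  curvature_bounded (fun x y => (x >= y)%E).

Definition causally_related (x y : X) := caus L x y \/ caus L y x.
Definition timelike_related (x y : X) := chron L x y \/ chron L y x.

Definition triple (x y z : X) : 'I_3 -> X := tnth [tuple x; y; z].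

Definition angle_defined (x y z : X) :=
  [/\ forall i j, causally_related (triple x y z i) (triple x y z j),
      finite_separations (triple x y z), size_bounds (triple x y z),
      timelike_related x y & timelike_related x z].

Definition is_comparison_angle (x y z : X) (a : R) :=
  exists xb yb zb (c1 c2 : R -> model R) (l1 l2 : R),
    [/\ comparison_triangle (triple x y z) (tnth [tuple xb; yb; zb]),
        geodesic_from_to K c1 l1 xb yb,
        geodesic_from_to K c2 l2 xb zb &
        a = arcosh `| b (velocity K c1 0) (velocity K c2 0) |].

(** Under [angle_defined] there is a unique [a] as above; the default value 0
    is only attained outside of that domain. *)
Definition comparison_angle (x y z : X) : R :=
  xget 0 [set a | is_comparison_angle x y z a].

Definition angle_sign (x y z : X) : R :=
  if `[< (chron L x y /\ chron L x z) \/ (chron L y x /\ chron L z x) >]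
  then -1 else 1.

Definition signed_angle (x y z : X) : R :=
  angle_sign x y z * comparison_angle x y z.

Definition angle_monotone (cmp : rel R) (al be : curve R X) :=
  let x := al 0 in
  let dom s t := [/\ 0 < s <= hi al, 0 < t <= hi be &
                     angle_defined x (al s) (be t)] in
  let theta s t := signed_angle x (al s) (be t) in
  (forall s s' t, s <= s' -> dom s t -> dom s' t ->
     cmp (theta s t) (theta s' t)) /\
  (forall s t t', t <= t' -> dom s t -> dom s t' ->
     cmp (theta s t) (theta s t')).

Definition monotonicity_comparison (cmp : rel R) :=
  forall p : X, exists U,
    [/\ open_nbhs p U,
        tau_finite_continuous L U,
        forall x y, U x -> U y -> chron L x y ->
          exists g, [/\ in_set g U, realizer L g x y & future_timelike L g] &
        forall al be : curve R X,
          lo al = 0 -> lo be = 0 -> in_set al U -> in_set be U ->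
          timelike_realizer L al -> timelike_realizer L be ->
          al 0 = be 0 -> angle_monotone cmp al be].

Definition monotonicity_comparison_below :=
  monotonicity_comparison (fun x y => x <= y).
Definition monotonicity_comparison_above :=
  monotonicity_comparison (fun x y => x >= y).

End Comparison.

Lemma cosh2_sinh2 (R : realType) (x : R) : cosh x ^+ 2 - sinh x ^+ 2 = 1.
Proof.
by rewrite /cosh /sinh expRN; field; rewrite ?gt_eqF ?expR_gt0.
Qed.

Lemma emb_quadric (R : realType) (K : R) (p : model R) : K != 0 ->
  b (emb K p) (emb K p) = K^-1.
Proof.
case: p => t x K0.
have n3 : model_dim K = 3 by rewrite /model_dim (negbTE K0).
have rE : radius K ^+ 2 = `|K|^-1 by rewrite /radius exprVn sqr_sqrtr.
rewrite /b /bform /emb /emb_coords /model_index.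
under eq_bigr do rewrite !mxE.
rewrite n3 !big_ord_recl big_ord0 /=.
have [K0p|K0n|K00] := ltgtP 0 K; last by rewrite -K00 eqxx in K0.
  have cs := cos2Dsin2 x; have ch := cosh2_sinh2 t.
  move: rE; rewrite gtr0_norm// => <- /=.
  transitivity (radius K ^+ 2 * (cosh t ^+ 2 * (cos x ^+ 2 + sin x ^+ 2)
    - sinh t ^+ 2)); first by ring.
  by rewrite cs mulr1 ch mulr1.
have cs := cos2Dsin2 t; have ch := cosh2_sinh2 x.
move: rE; rewrite ltr0_norm// invrN => rE /=.
transitivity (- radius K ^+ 2 * (cosh x ^+ 2 * (cos t ^+ 2 + sin t ^+ 2)
    - sinh x ^+ 2)); first by ring.
by rewrite cs mulr1 ch mulr1 rE opprK.
Qed.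

(* Main.v *)
Require Import Defs.
From mathcomp Require Import all_boot all_order all_algebra.
From mathcomp Require Import all_classical all_reals all_analysis.
From mathcomp Require Import ring lra.

(** In L^2(K), the function [world p q = - b (p - q, p - q) / 2] of the embedded points equals
    [ph K (tau p q)] when [p <= q] and [tau p q < D_K], where [ph K] is increasing with
    [(ph K)'' = 1 + K * ph K].  Along two geodesics that issue from a common point, it is an
    increasing affine function of the scalar product [B] of their initial velocities, and the
    signed angle is the signed arcosh of [B].  Hence the monotonicity of [theta] between
    [(s, t)] and [(s', t)] says exactly how [tau (alpha s) (beta t)] compares with the time
    separation of the corresponding points in the comparison triangle of [x], [alpha s'] and
    [beta t].  That this is an instance of triangle comparison is clear when [alpha s'] and
    [beta t] are timelike related, and the null case follows by continuity of [tau].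
    Conversely, two sides of a triangle share a vertex, and passing from [(s, t)] to the
    corner [(a, b)] through [(s, b)] or [(a, t)] gives the comparison of causally related
    points; for points that are not causally related a continuity argument remains.  The
    strictness required of the neighbourhoods comes from the local hypothesis by
    connectedness of intervals. *)

Set Implicit Arguments.
Unset Strict Implicit.
Unset Printing Implicit Defensive.

Import Order.TTheory GRing.Theory Num.Theory.
Import numFieldNormedType.Exports.

Local Open Scope classical_set_scope.
Local Open Scope ring_scope.

(** * Derivatives *)

(** As [model_tau] is a supremum over piecewise C^1 curves of a chart, its relation to [world] has
    to be proved. In null coordinates [world p] factors into two sines and conformal factors and
    satisfies an eikonal equation ([fab]); so [phinv] of it grows along a future curve at least as
    fast as the length, by (x + y)^2 >= 4 x y, and explicit geodesics attain the bound. The obstacle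
    is K < 0: far apart, these factors change sign even for causally ordered points, and the time
    separation is no longer a function of [world]. The relation [rng] describes where this does not
    happen; a causal curve that leaves it reaches separation at least D_K, so the size bounds keep
    every triangle inside.

    Since [world] is symmetric, the time order of two points is recovered separately: from the null
    coordinates in the model and from the reverse triangle inequality in X. One boolean covers both
    bounds, but they are not mirror images: [tau] vanishes on unrelated points, so the bound from
    below is trivial for points unrelated in X, the bound from above for points unrelated in the
    model. *)

Section Derivation.
Variable R : realType.
Implicit Types (f g : R -> R) (x a b : R).

Lemma is1_id x : is_derive x (1 : R) (fun t : R => t) 1.
Proof. exact: is_derive_id. Qed.

Lemma is1_cst (c x : R) : is_derive x (1 : R) (fun _ : R => c) 0.
Proof. exact: is_derive_cst. Qed.

Lemma is1_add f g x a b : is_derive x (1 : R) f a -> is_derive x (1 : R) g b ->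
  is_derive x (1 : R) (fun t => f t + g t) (a + b).
Proof. by move=> hf hg; exact: is_deriveD. Qed.

Lemma is1_opp f x a : is_derive x (1 : R) f a ->
  is_derive x (1 : R) (fun t => - f t) (- a).
Proof. by move=> hf; exact: is_deriveN. Qed.

Lemma is1_mul f g x a b : is_derive x (1 : R) f a -> is_derive x (1 : R) g b ->
  is_derive x (1 : R) (fun t => f t * g t) (f x * b + g x * a).
Proof.
by move=> hf hg; exact: is_deriveM.
Qed.

Lemma is1_exp f x a n : is_derive x (1 : R) f a ->
  is_derive x (1 : R) (fun t => f t ^+ n.+1) (n.+1%:R * f x ^+ n * a).
Proof.
move=> hf.
suff -> : (fun t => f t ^+ n.+1) = (f ^+ n.+1) :> (R -> R).
  by apply: is_derive_eq; rewrite /GRing.scale /= -mulr_natl.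
by apply/funext => t; rewrite fctE.
Qed.

Lemma is1_inv f x a : is_derive x (1 : R) f a -> f x != 0 ->
  is_derive x (1 : R) (fun t => (f t)^-1) (- (f x) ^- 2 * a).
Proof. by move=> hf f0; exact: is_deriveV. Qed.

Lemma is1_comp f g x a b : is_derive (g x) (1 : R) f a ->
  is_derive x (1 : R) g b -> is_derive x (1 : R) (fun t => f (g t)) (a * b).
Proof. by move=> hf hg; exact: is_derive1_comp. Qed.

Lemma is1_continuous f x a : is_derive x (1 : R) f a -> {for x, continuous f}.
Proof.
by move=> [+ _] => /derivable1_diffP /differentiable_continuous.
Qed.

Lemma is1_derive1 f x a : is_derive x (1 : R) f a -> derive1 f x = a.
Proof. by move=> hf; rewrite derive1E derive_val. Qed.

End Derivation.

Lemma is1_eq (R : realType) (f : R -> R) (x a b : R) :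
  is_derive x (1 : R) f a -> a = b -> is_derive x (1 : R) f b.
Proof. by move=> ? <-. Qed.

(** Extension point for the next tactic, redefined as soon as further functions have derivative
    rules. *)
Ltac dv_hook := fail.

(** Differentiation directed by the syntax of eta-expanded functions. An unknown function is looked
    up among the hypotheses, and nonvanishing conditions are left as goals; [notypeclasses refine]
    keeps instance search from choosing another form of the derivative. *)
Ltac dv :=
  lazymatch goal with
  | |- is_derive ?x _ (fun t => t) _ => notypeclasses refine (is1_id _)
  | |- is_derive ?x _ (fun _ => ?c) _ => notypeclasses refine (is1_cst _ _)
  | |- is_derive ?x _ (fun t => @?f t + @?g t) _ =>
      notypeclasses refine (@is1_add _ f g _ _ _ _ _); dv
  | |- is_derive ?x _ (fun t => - @?f t) _ =>
      notypeclasses refine (@is1_opp _ f _ _ _); dv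
  | |- is_derive ?x _ (fun t => (@?f t) * (@?g t)) _ =>
      notypeclasses refine (@is1_mul _ f g _ _ _ _ _); dv
  | |- is_derive ?x _ (fun t => (@?f t) ^+ (S ?n)) _ =>
      notypeclasses refine (@is1_exp _ f _ _ n _); dv
  | |- is_derive ?x _ (fun t => (@?f t)^-1) _ =>
      notypeclasses refine (@is1_inv _ f _ _ _ _); [dv|]
  | |- is_derive ?x _ (fun t => expR (@?f t)) _ =>
      notypeclasses refine (@is1_comp _ (@expR _) f _ _ _ _ _);
      [exact (is_derive_expR _)|dv]
  | |- is_derive ?x _ (fun t => sin (@?f t)) _ =>
      notypeclasses refine (@is1_comp _ (@sin _) f _ _ _ _ _);
      [exact (is_derive_sin _)|dv]
  | |- is_derive ?x _ (fun t => cos (@?f t)) _ =>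
      notypeclasses refine (@is1_comp _ (@cos _) f _ _ _ _ _);
      [exact (is_derive_cos _)|dv]
  | |- is_derive ?x _ (fun t => atan (@?f t)) _ =>
      notypeclasses refine (@is1_comp _ (@atan _) f _ _ _ _ _);
      [exact (is_derive1_atan _)|dv]
  | |- is_derive ?x _ (fun t => ln (@?f t)) _ =>
      notypeclasses refine (@is1_comp _ (@ln _) f _ _ _ _ _);
      [notypeclasses refine (is_derive1_ln _)|dv]
  | |- is_derive ?x _ (fun t => Num.sqrt (@?f t)) _ =>
      notypeclasses refine (@is1_comp _ (@Num.sqrt _) f _ _ _ _ _);
      [notypeclasses refine (is_derive1_sqrt _)|dv]
  | |- is_derive _ _ _ _ => first [eassumption | dv_hook | idtac]
  end.

(** The value computed by [dv] need only equal the announced one; that equation is left to [ring] or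
    [field]. *)
Ltac dvE := notypeclasses refine (is1_eq _ _); [dv|]; cbv beta.

(** * Hyperbolic functions *)

Section Hyperbolic.
Variable R : realType.
Implicit Types x y : R.

Lemma cosh0 : cosh 0 = 1 :> R.
Proof. by rewrite /cosh oppr0 expR0; field. Qed.

Lemma sinh0 : sinh 0 = 0 :> R.
Proof. by rewrite /sinh oppr0 expR0 subrr mul0r. Qed.

Lemma coshN x : cosh (- x) = cosh x.
Proof. by rewrite /cosh opprK addrC. Qed.

Lemma sinhN x : sinh (- x) = - sinh x.
Proof. by rewrite /sinh opprK; field. Qed.

Lemma coshD x y : cosh (x + y) = cosh x * cosh y + sinh x * sinh y.
Proof. by rewrite /cosh /sinh opprD !expRD; field. Qed.

Lemma cosh_gt0 x : 0 < cosh x.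
Proof. by rewrite /cosh divr_gt0 // addr_gt0 ?expR_gt0. Qed.

Lemma cosh_neq0 x : cosh x != 0.
Proof. by rewrite gt_eqF ?cosh_gt0. Qed.

Lemma sinh_gt0 x : 0 < x -> 0 < sinh x.
Proof.
by move=> x0; rewrite /sinh divr_gt0 // subr_gt0 ltr_expR; lra.
Qed.

Lemma is1_cosh x : is_derive x (1 : R) (@cosh R) (sinh x).
Proof.
rewrite /cosh; dvE.
by rewrite /sinh; field.
Qed.

Lemma is1_sinh x : is_derive x (1 : R) (@sinh R) (cosh x).
Proof.
rewrite /sinh; dvE.
by rewrite /cosh; field.
Qed.

End Hyperbolic.

Ltac dv_hook ::=
  lazymatch goal with
  | |- is_derive ?x _ (fun t => cosh (@?f t)) _ =>
      notypeclasses refine (@is1_comp _ (@cosh _) f _ _ _ _ _);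
      [exact (is1_cosh _)|dv]
  | |- is_derive ?x _ (fun t => sinh (@?f t)) _ =>
      notypeclasses refine (@is1_comp _ (@sinh _) f _ _ _ _ _);
      [exact (is1_sinh _)|dv]
  end.

(** * Generalized trigonometric functions *)

Section ModelFunctions.
Variables (R : realType) (K : R).
Implicit Types x y s f : R.

Definition curv_root : R := Num.sqrt `|K|.
Local Notation k := curv_root.

(** [cs] and [sn] are the solutions of f'' = K f with initial data (1, 0) and (0, 1), and [ph] is
    the antiderivative of [sn] that vanishes at 0. Along timelike directions positive curvature
    gives the hyperbolic functions. *)
Definition cs s : R :=
  if 0 < K then cosh (k * s) else if K < 0 then cos (k * s) else 1.
Definition sn s : R :=
  if 0 < K then sinh (k * s) / k else if K < 0 then sin (k * s) / k else s.
Definition ph s : R := if K == 0 then s ^+ 2 / 2 else (cs s - 1) / K.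

Definition below_diameter s := (s%:E < model_diameter K)%E.

Lemma curv_root_gt0 : K != 0 -> 0 < k.
Proof. by move=> K0; rewrite sqrtr_gt0 normr_gt0. Qed.

Lemma curv_rootE : k ^+ 2 = `|K|.
Proof. by rewrite sqr_sqrtr. Qed.

Variant curv_spec : bool -> bool -> bool -> Prop :=
| CurvPos of 0 < K & 0 < k & K = k ^+ 2 : curv_spec true false false
| CurvNeg of K < 0 & 0 < k & K = - k ^+ 2 : curv_spec false true false
| CurvZero of K = 0 : curv_spec false false true.

Lemma curvP : curv_spec (0 < K) (K < 0) (K == 0).
Proof.
have := curv_rootE; have := curv_root_gt0.
case: (ltrgtP K 0) => K0 //= k0 kE.
- by constructor=> //; [exact: k0|rewrite kE ltr0_norm // opprK].
- by constructor=> //; [exact: k0|rewrite kE gtr0_norm].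
- by constructor.
Qed.

Lemma csE s : cs s = 1 + K * ph s.
Proof.
rewrite /ph /cs; case: curvP => [K0 _ _|K0 _ _|->]; last by rewrite mul0r addr0.
- by field; rewrite gt_eqF.
- by field; rewrite lt_eqF.
Qed.

Lemma cs_sn s : cs s ^+ 2 - K * sn s ^+ 2 = 1.
Proof.
rewrite /sn /cs; case: curvP => [K0 k0 KE|K0 k0 KE|->].
- by rewrite -(cosh2_sinh2 (k * s)) KE; field; rewrite gt_eqF.
- by rewrite -(cos2Dsin2 (k * s)) KE; field; rewrite gt_eqF.
- by rewrite mul0r subr0 expr1n.
Qed.

Lemma csD x y : cs (x + y) = cs x * cs y + K * sn x * sn y.
Proof.
rewrite /sn /cs; case: curvP => [K0 k0 KE|K0 k0 KE|->].
- by rewrite mulrDr coshD KE; field; rewrite gt_eqF.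
- by rewrite mulrDr cosD KE; field; rewrite gt_eqF.
- by rewrite !mul0r addr0 mulr1.
Qed.

Lemma csN x : cs (- x) = cs x.
Proof. by rewrite /cs mulrN coshN cosN. Qed.

Lemma snN x : sn (- x) = - sn x.
Proof. by rewrite /sn mulrN sinhN sinN !mulNr; case: ifP => // _; case: ifP. Qed.

Lemma phN x : ph (- x) = ph x.
Proof. by rewrite /ph csN sqrrN. Qed.

Lemma cs0 : cs 0 = 1.
Proof. by rewrite /cs mulr0 cosh0 cos0; case: ifP => // _; case: ifP. Qed.

Lemma sn0 : sn 0 = 0.
Proof. by rewrite /sn mulr0 sinh0 sin0 !mul0r; case: ifP => // _; case: ifP. Qed.

Lemma ph0 : ph 0 = 0.
Proof. by rewrite /ph cs0 subrr mul0r expr0n /= mul0r; case: ifP. Qed.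

(** For K nonzero this is the addition formula of [cs], with 1 + K [ph] in place of [cs] and the
    factor K cancelled. *)
Lemma phD x y : ph (x + y) = ph x + ph y + K * ph x * ph y + sn x * sn y.
Proof.
have [K0|K0] := eqVneq K 0.
  by rewrite /ph /sn K0 eqxx ltxx; field.
apply: (mulfI K0); apply: (addrI 1); rewrite -csE csD !csE; ring.
Qed.

Lemma sn2E s : sn s ^+ 2 = ph s * (2 + K * ph s).
Proof.
have := phD s (- s); rewrite subrr ph0 phN snN => h.
lra.
Qed.

Lemma is1_cs s : is_derive s (1 : R) cs (K * sn s).
Proof.
rewrite /cs /sn; case: curvP => [K0 k0 KE|K0 k0 KE|K0].
- dvE.
  by rewrite KE; field; rewrite gt_eqF.
- dvE.
  by rewrite KE; field; rewrite gt_eqF.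
- by dvE; rewrite K0 ?mul0r.
Qed.

Lemma is1_sn s : is_derive s (1 : R) sn (cs s).
Proof.
rewrite /cs /sn; case: curvP => [K0 k0 KE|K0 k0 KE|K0].
- dvE.
  by field; rewrite gt_eqF.
- dvE.
  by field; rewrite gt_eqF.
- by dvE.
Qed.

Lemma is1_ph s : is_derive s (1 : R) ph (sn s).
Proof.
have [K0|K0] := eqVneq K 0.
  rewrite /ph /sn K0 eqxx ltxx; dvE.
  by field.
have h := is1_cs s.
rewrite /ph (negbTE K0); dvE.
by field.
Qed.

Lemma below_diameter_le x y : x <= y -> below_diameter y -> below_diameter x.
Proof. by move=> xy; apply: le_lt_trans; rewrite lee_fin. Qed.

Lemma below_diameterE s :
  below_diameter s = (K < 0) ==> (k * s < pi).
Proof.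
rewrite /below_diameter /model_diameter.
case: curvP => [K0 k0 KE|K0 k0 KE|K0]; rewrite ?ltry //=.
have kE : Num.sqrt (- K) = k by rewrite /curv_root ltr0_norm.
by rewrite lte_fin kE ltr_pdivlMr 1?mulrC.
Qed.

Lemma sn_gt0 s : 0 < s -> below_diameter s -> 0 < sn s.
Proof.
move=> s0; rewrite below_diameterE /sn; case: curvP => //= K0 k0 KE lts.
- by rewrite divr_gt0 // sinh_gt0 // mulr_gt0.
- by rewrite divr_gt0 // sin_gt0_pi // mulr_gt0.
Qed.

(** By [phD] at the midpoint, [ph y - ph x] is twice the product of [sn] at (x + y) / 2 and at (y -
    x) / 2, both of which lie strictly between 0 and D_K. *)
Lemma ph_lt x y : 0 <= x -> x < y -> below_diameter y -> ph x < ph y.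
Proof.
move=> x0 xy yD.
have hx : x = (x + y) / 2 + - ((y - x) / 2) by field.
have hy : y = (x + y) / 2 + (y - x) / 2 by field.
have h1 : 0 < sn ((x + y) / 2).
  by apply: sn_gt0; [lra|apply: below_diameter_le yD; lra].
have h2 : 0 < sn ((y - x) / 2).
  by apply: sn_gt0; [lra|apply: below_diameter_le yD; lra].
have := mulr_gt0 h1 h2.
by rewrite [in ph x]hx [in ph y]hy !phD phN snN; lra.
Qed.

Lemma ph_le x y : 0 <= x -> x <= y -> below_diameter y -> ph x <= ph y.
Proof.
move=> x0; rewrite le_eqVlt => /predU1P[->//|xy] yD.
exact/ltW/ph_lt.
Qed.

Lemma ph_ltE x y : 0 <= x -> 0 <= y -> below_diameter x -> below_diameter y ->
  (ph x < ph y) = (x < y).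
Proof.
move=> x0 y0 xD yD; case: (ltP x y) => [xy|yx]; first by rewrite ph_lt.
by apply/negbTE; rewrite -leNgt ph_le.
Qed.

Lemma ph_leE x y : 0 <= x -> 0 <= y -> below_diameter x -> below_diameter y ->
  (ph x <= ph y) = (x <= y).
Proof. by move=> *; rewrite !leNgt ph_ltE. Qed.

Lemma ph_inj x y : 0 <= x -> 0 <= y -> below_diameter x -> below_diameter y ->
  ph x = ph y -> x = y.
Proof.
move=> x0 y0 xD yD e; apply/eqP; rewrite eq_le.
by rewrite -(ph_leE x0 y0 xD yD) -(ph_leE y0 x0 yD xD) e lexx.
Qed.

Lemma ph_ge0 s : 0 <= s -> below_diameter s -> 0 <= ph s.
Proof. by move=> s0 sD; rewrite -ph0 ph_le. Qed.

Lemma ph_gt0 s : 0 < s -> below_diameter s -> 0 < ph s.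
Proof. by move=> s0 sD; rewrite -ph0 ph_lt. Qed.

(** The expression is 1 + [cs s]; for K < 0 its first zero is at D_K, where the argument of the
    cosine reaches pi. *)
Lemma ph_room s : 0 <= s -> below_diameter s -> 0 < 2 + K * ph s.
Proof.
move=> s0 sD; have -> : 2 + K * ph s = 1 + cs s by rewrite csE; ring.
rewrite /cs; move: sD; rewrite below_diameterE.
case: curvP => //= K0 k0 KE sD; first by rewrite addr_gt0 ?cosh_gt0.
suff : cos pi < cos (k * s) by rewrite cospi; lra.
rewrite ltr_cos ?in_itv /= ?pi_ge0 ?lexx //.
by rewrite mulr_ge0 ?(ltW k0) // ltW.
Qed.

(* The inverse of [sn / cs]; [phinv] comes from [(sn / cs)^2 = f / (2 + K * f)] at half the length. *)
Definition atn y : R :=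
  if 0 < K then ln ((1 + k * y) / (1 - k * y)) / (2 * k)
  else if K < 0 then atan (k * y) / k else y.

Lemma room_pos y : 0 <= y -> K * y ^+ 2 < 1 -> 0 < K ->
  0 < 1 + k * y /\ 0 < 1 - k * y.
Proof.
move=> y0 h; case: curvP => // K0 k0 KE _.
have ky0 : 0 <= k * y by rewrite mulr_ge0 // ltW.
have h1 : (k * y) ^+ 2 < 1 by rewrite exprMn -KE.
have h2 : k * y < 1.
  by rewrite -(@ltr_pXn2r _ 2) ?nnegrE // expr1n.
by split; lra.
Qed.

Lemma is1_atn y : 0 <= y -> K * y ^+ 2 < 1 ->
  is_derive y (1 : R) atn (1 - K * y ^+ 2)^-1.
Proof.
move=> y0 h; have := room_pos y0 h; rewrite /atn.
case: curvP => [K0 k0 KE|K0 k0 KE|K0] h1.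
- have [ha hb] := h1 isT.
  dvE; rewrite ?divr_gt0 ?gt_eqF //.
  rewrite KE.
  have -> : 1 - k ^+ 2 * y ^+ 2 = (1 + k * y) * (1 - k * y) by ring.
  by field; rewrite !gt_eqF.
- have p0 : 0 < 1 + (k * y) ^+ 2 by rewrite ltr_pwDl // sqr_ge0.
  dvE; rewrite KE mulNr opprK -exprMn; field.
  rewrite ?exprMn in p0 *.
  by rewrite !gt_eqF.
- by dvE; rewrite K0 mul0r subr0 invr1.
Qed.

Lemma atn_ge0 y : 0 <= y -> K * y ^+ 2 < 1 -> 0 <= atn y.
Proof.
move=> y0 h; have := room_pos y0 h; rewrite /atn.
case: curvP => [K0 k0 KE|K0 k0 KE|K0] h1 //.
- have [ha hb] := h1 isT.
  rewrite divr_ge0 ?mulr_ge0 ?(ltW k0) // ln_ge0 // ler_pdivlMr // mul1r.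
  have : 0 <= k * y by rewrite mulr_ge0 // ltW.
  lra.
- rewrite divr_ge0 ?(ltW k0) // -(@atan0 R) le_atan // mulr_ge0 // ltW //.
Qed.

Lemma atn_below y : below_diameter (2 * atn y).
Proof.
rewrite below_diameterE /atn; case: curvP => //= K0 k0 KE.
have -> : k * (2 * (atan (k * y) / k)) = 2 * atan (k * y) by field; rewrite gt_eqF.
by have := atan_ltpi2 (k * y); lra.
Qed.

Lemma ph_double s : ph (2 * s) = 2 * sn s ^+ 2.
Proof.
have -> : 2 * s = s + s by ring.
by rewrite phD; have := sn2E s; lra.
Qed.

(** The half-angle substitution: [atn] inverts sn / cs, and cs^2 - K sn^2 = 1 turns y = sn / cs into
    sn^2 = y^2 / (1 - K y^2). *)
Lemma ph_atn y : 0 <= y -> K * y ^+ 2 < 1 ->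
  ph (2 * atn y) = 2 * y ^+ 2 / (1 - K * y ^+ 2).
Proof.
move=> y0 h; rewrite ph_double; have := room_pos y0 h; rewrite /atn /sn.
case: curvP => [K0 k0 KE|K0 k0 KE|K0] h1.
- have [ha hb] := h1 isT.
  (* [q] is the exponential of twice artanh (k y), so the square of the [sinh] below is (q + 1/q -
     2) / 4. *)
  set q := (1 + k * y) / (1 - k * y).
  have q0 : 0 < q by rewrite divr_gt0.
  have e1 : k * (ln q / (2 * k)) = ln q / 2 by field; rewrite gt_eqF.
  have e2 : expR (ln q / 2) ^+ 2 = q.
    by rewrite expr2 -expRD -splitr lnK ?posrE.
  have e3 : expR (- (ln q / 2)) ^+ 2 = q^-1 by rewrite expRN exprVn e2.
  have e4 : expR (ln q / 2) * expR (- (ln q / 2)) = 1 by rewrite expRxMexpNx_1.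
  rewrite e1 /sinh.
  have -> : ((expR (ln q / 2) - expR (- (ln q / 2))) / 2 / k) ^+ 2 =
      (expR (ln q / 2) ^+ 2 + expR (- (ln q / 2)) ^+ 2
       - 2 * (expR (ln q / 2) * expR (- (ln q / 2)))) / (4 * k ^+ 2).
    by field; rewrite gt_eqF.
  rewrite e2 e3 e4 KE /q.
  have -> : 1 - k ^+ 2 * y ^+ 2 = (1 + k * y) * (1 - k * y) by ring.
  by field; rewrite !gt_eqF.
- have e1 : k * (atan (k * y) / k) = atan (k * y) by field; rewrite gt_eqF.
  have p0 : 0 < 1 + (k * y) ^+ 2 by rewrite ltr_pwDl // sqr_ge0.
  have -> : (sin (k * (atan (k * y) / k)) / k) ^+ 2 =
      sin (atan (k * y)) ^+ 2 / k ^+ 2 by rewrite e1 expr_div_n.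
  rewrite sin2cos2 cos_atan exprVn sqr_sqrtr ?(ltW p0) // KE.
  have -> : 1 - - k ^+ 2 * y ^+ 2 = 1 + (k * y) ^+ 2 by ring.
  by field; rewrite !gt_eqF.
- by rewrite K0 mul0r subr0 divr1.
Qed.

Definition phinv f : R := 2 * atn (Num.sqrt (f / (2 + K * f))).

Section Phinv.
Variable f : R.
Hypotheses (f0 : 0 <= f) (hf : 0 < 2 + K * f).

Let sq : Num.sqrt (f / (2 + K * f)) ^+ 2 = f / (2 + K * f).
Proof. by rewrite sqr_sqrtr // divr_ge0 // ltW. Qed.

Let Ksq : K * Num.sqrt (f / (2 + K * f)) ^+ 2 < 1.
Proof. by rewrite sq mulrA ltr_pdivrMr // mul1r; lra. Qed.

Lemma phinv_ge0 : 0 <= phinv f.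
Proof. by rewrite /phinv mulr_ge0 // atn_ge0 // sqrtr_ge0. Qed.

Lemma phinv_below : below_diameter (phinv f).
Proof. exact: atn_below. Qed.

Lemma phinvK : ph (phinv f) = f.
Proof.
rewrite /phinv ph_atn ?sqrtr_ge0 // sq.
have -> : 1 - K * (f / (2 + K * f)) = 2 / (2 + K * f) by field; rewrite gt_eqF.
by field; rewrite gt_eqF.
Qed.

(** An inverse of [ph] has derivative 1 / sn, and sn^2 = ph (2 + K ph) by [sn2E]. *)
Lemma is1_phinv : 0 < f ->
  is_derive f (1 : R) phinv (Num.sqrt (f * (2 + K * f)))^-1.
Proof.
move=> fp; rewrite /phinv.
set y := Num.sqrt (f / (2 + K * f)).
have d1 := is1_atn (sqrtr_ge0 _) Ksq.
have h : is_derive f (1 : R) (fun f => f / (2 + K * f)) (2 / (2 + K * f) ^+ 2).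
  by dvE; rewrite ?gt_eqF //; field; rewrite gt_eqF.
have q0 : 0 < f / (2 + K * f) by rewrite divr_gt0.
have d2 : is_derive f (1 : R) (fun f => Num.sqrt (f / (2 + K * f)))
    ((2 * Num.sqrt (f / (2 + K * f)))^-1 * (2 / (2 + K * f) ^+ 2)).
  by apply: (is1_comp _ h); exact: is_derive1_sqrt.
have d3 := is1_comp (g := fun f => Num.sqrt (f / (2 + K * f))) d1 d2.
dvE.
rewrite sq -/y mulr0 addr0.
have y0 : 0 < y by rewrite sqrtr_gt0.
have -> : f * (2 + K * f) = (y * (2 + K * f)) ^+ 2.
  by rewrite exprMn sq; field; rewrite gt_eqF.
rewrite sqrtr_sqr gtr0_norm ?mulr_gt0 //.
have -> : 1 - K * (f / (2 + K * f)) = 2 / (2 + K * f) by field; rewrite gt_eqF.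
by field; rewrite !gt_eqF.
Qed.

End Phinv.

End ModelFunctions.

Ltac dv_hook ::=
  lazymatch goal with
  | |- is_derive ?x _ (fun t => cosh (@?f t)) _ =>
      notypeclasses refine (@is1_comp _ (@cosh _) f _ _ _ _ _);
      [exact (is1_cosh _)|dv]
  | |- is_derive ?x _ (fun t => sinh (@?f t)) _ =>
      notypeclasses refine (@is1_comp _ (@sinh _) f _ _ _ _ _);
      [exact (is1_sinh _)|dv]
  | |- is_derive ?x _ (fun t => cs ?K (@?f t)) _ =>
      notypeclasses refine (@is1_comp _ (cs K) f _ _ _ _ _);
      [exact (is1_cs _ _)|dv]
  | |- is_derive ?x _ (fun t => sn ?K (@?f t)) _ =>
      notypeclasses refine (@is1_comp _ (sn K) f _ _ _ _ _);
      [exact (is1_sn _ _)|dv]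
  | |- is_derive ?x _ (fun t => ph ?K (@?f t)) _ =>
      notypeclasses refine (@is1_comp _ (ph K) f _ _ _ _ _);
      [exact (is1_ph _ _)|dv]
  end.

(** * The model space in null coordinates *)

Section Coordinates.
Variable R : realType.
Implicit Types (s : R) (c : R -> R * R).

Lemma is1_fst c s : derivable c s 1 ->
  is_derive s (1 : R) (fun t => (c t).1) (derive1 c s).1.
Proof.
move=> dc; have H : (fun h : R => h^-1 *: ((c \o shift s) (h *: 1) - c s)) @ 0^'
    --> derive1 c s by rewrite derive1E; exact: dc.
have H1 : (fun h : R => h^-1 *: (((fun t => (c t).1) \o shift s) (h *: 1) - (c s).1))
    @ 0^' --> (derive1 c s).1.
  exact: (cvg_comp _ _ H (@cvg_fst _ _ _ _ _)).
by apply: DeriveDef; [apply/cvg_ex; exists (derive1 c s).1|exact/cvg_lim].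
Qed.

Lemma is1_snd c s : derivable c s 1 ->
  is_derive s (1 : R) (fun t => (c t).2) (derive1 c s).2.
Proof.
move=> dc; have H : (fun h : R => h^-1 *: ((c \o shift s) (h *: 1) - c s)) @ 0^'
    --> derive1 c s by rewrite derive1E; exact: dc.
have H1 : (fun h : R => h^-1 *: (((fun t => (c t).2) \o shift s) (h *: 1) - (c s).2))
    @ 0^' --> (derive1 c s).2.
  exact: (cvg_comp _ _ H (@cvg_snd _ _ _ _ _)).
by apply: DeriveDef; [apply/cvg_ex; exists (derive1 c s).2|exact/cvg_lim].
Qed.

Lemma is1_pair (f g : R -> R) s a b : is_derive s (1 : R) f a ->
  is_derive s (1 : R) g b ->
  derivable (fun t => (f t, g t)) s 1 /\ derive1 (fun t => (f t, g t)) s = (a, b).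
Proof.
move=> [df <-] [dg <-].
have H : (fun h : R => h^-1 *: (((fun t => (f t, g t)) \o shift s) (h *: 1)
    - (f s, g s))) @ 0^' --> ('D_1 f s, 'D_1 g s).
  exact: (cvg_pair df dg).
split; first by apply/cvg_ex; exists ('D_1 f s, 'D_1 g s).
by rewrite derive1E; exact/cvg_lim.
Qed.

(** Coordinates with natural indices, extended by zero: the dimension [model_dim K] depends on K,
    and this avoids transporting ordinals between the cases. The form [b] becomes one sum of three
    terms for all K. *)
Definition crd n (v : 'rV[R]_n) (i : nat) : R :=
  if insub i is Some j then v ord0 j else 0.

Arguments crd n v i%_N.

Lemma crd_ord n (v : 'rV[R]_n) (j : 'I_n) : crd v j = v ord0 j.
Proof. by rewrite /crd insubT //= => h; congr (v _ _); exact: val_inj. Qed.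

Lemma crd_eq n (v w : 'rV[R]_n) : (forall i, (i < n)%N -> crd v i = crd w i) ->
  v = w.
Proof.
by move=> h; apply/rowP => j; have := h j (ltn_ord j); rewrite !crd_ord.
Qed.

Lemma crdD n (v w : 'rV[R]_n) i : crd (v + w) i = crd v i + crd w i.
Proof. by rewrite /crd; case: insubP => [j _ _|_]; rewrite ?mxE ?addr0. Qed.

Lemma crdN n (v : 'rV[R]_n) i : crd (- v) i = - crd v i.
Proof. by rewrite /crd; case: insubP => [j _ _|_]; rewrite ?mxE ?oppr0. Qed.

Lemma crdZ n a (v : 'rV[R]_n) i : crd (a *: v) i = a * crd v i.
Proof. by rewrite /crd; case: insubP => [j _ _|_]; rewrite ?mxE ?mulr0. Qed.

Lemma is1_crd n (F : R -> 'rV[R]_n) s i : derivable F s 1 ->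
  is_derive s (1 : R) (fun t => crd (F t) i) (crd (derive1 F s) i).
Proof.
move=> dF; rewrite /crd; case: insubP => [j _ _|_]; last exact: is1_cst.
rewrite derive1E derive_mx // mxE; apply: derivableP.
exact: (derivable_mxP _ _ _).1.
Qed.

Lemma derivable_crd n (F : R -> 'rV[R]_n) s (d : nat -> R) :
  (forall i, (i < n)%N -> is_derive s (1 : R) (fun t => crd (F t) i) (d i)) ->
  derivable F s 1 /\ forall i, (i < n)%N -> crd (derive1 F s) i = d i.
Proof.
move=> h; have dF : derivable F s 1.
  apply/derivable_mxP => i j; rewrite (ord1 i).
  have [] := h j (ltn_ord j); set f := (X in derivable X).
  suff -> : f = fun x => F x ord0 j by [].
  by apply/funext => x; rewrite /f crd_ord.
split=> // i lti; have d1 := is1_crd i dF; have d2 := h i lti.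
by rewrite -(is1_derive1 d1) (is1_derive1 d2).
Qed.

Lemma bform_crd n m (v w : 'rV[R]_n) : (n <= 3)%N ->
  bform m v w = \sum_(i < 3) (if (i < m)%N then -1 else 1) * (crd v i * crd w i).
Proof.
move=> n3; rewrite /bform.
under eq_bigr => i _ do rewrite -!crd_ord.
rewrite (big_ord_widen_cond 3 xpredT
  (fun i : nat => (if (i < m)%N then -1 else 1) * (crd v i * crd w i))) //.
rewrite big_mkcond /=; apply: eq_bigr => i _; case: ifPn => // h.
by rewrite /crd insubF ?mul0r ?mulr0 //; exact/negbTE.
Qed.

End Coordinates.

Section Ambient.
Variables (R : realType) (K : R).
Local Notation N := (model_dim K).

Definition sig1 : R := if K < 0 then -1 else 1.

Lemma model_dim_le3 : (N <= 3)%N.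
Proof. by rewrite /model_dim; case: ifP. Qed.

Lemma model_indexE : model_index K = if K < 0 then 2%N else 1%N.
Proof. by rewrite /model_index; case: (K < 0). Qed.

Lemma bE (v w : 'rV[R]_N) : b v w =
  - (crd v 0%N * crd w 0%N) + sig1 * (crd v 1%N * crd w 1%N) + crd v 2%N * crd w 2%N.
Proof.
rewrite /b bform_crd ?model_dim_le3 // !big_ord_recl big_ord0 /=.
by rewrite model_indexE /sig1 /bump; case: (K < 0) => /=; ring.
Qed.

Lemma crd_emb p i : crd (emb K p) i = nth 0 (emb_coords K p) i.
Proof.
rewrite /crd; case: insubP => [j _ ji|].
  by rewrite mxE ji.
rewrite -leqNgt => h; rewrite nth_default //; apply: leq_trans h.
rewrite /emb_coords /model_dim; case: p => t x.
by case: (curvP K).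
Qed.

Lemma bC (v w : 'rV[R]_N) : b v w = b w v.
Proof. rewrite !bE; ring. Qed.

Lemma bDl (u v w : 'rV[R]_N) : b (u + v) w = b u w + b v w.
Proof. rewrite !bE !crdD; ring. Qed.

Lemma bZl a (v w : 'rV[R]_N) : b (a *: v) w = a * b v w.
Proof. rewrite !bE !crdZ; ring. Qed.

Lemma bNl (v w : 'rV[R]_N) : b (- v) w = - b v w.
Proof. rewrite !bE !crdN; ring. Qed.

Lemma bDr (u v w : 'rV[R]_N) : b w (u + v) = b w u + b w v.
Proof. by rewrite bC bDl !(bC w). Qed.

Lemma bZr a (v w : 'rV[R]_N) : b w (a *: v) = a * b w v.
Proof. by rewrite bC bZl (bC w). Qed.

Lemma bNr (v w : 'rV[R]_N) : b w (- v) = - b w v.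
Proof. by rewrite bC bNl (bC w). Qed.

Lemma emb_norm p : K != 0 -> K * b (emb K p) (emb K p) = 1.
Proof. by move=> K0; rewrite emb_quadric // divff. Qed.

(* For causally related points at separation [s < D_K] the value is [ph K s]; see [mtau_world]. *)
Definition world (p q : model R) : R :=
  - b (emb K p - emb K q) (emb K p - emb K q) / 2.

Lemma worldC p q : world p q = world q p.
Proof. by rewrite /world -(opprB (emb K q)) bNl bNr opprK. Qed.

Lemma worldE p q : K != 0 -> K * b (emb K p) (emb K q) = 1 + K * world p q.
Proof.
move=> K0; rewrite /world !(bDl, bDr, bNl, bNr) (bC (emb K q) (emb K p)).
have := emb_norm p K0; have := emb_norm q K0; lra.
Qed.

End Ambient.

(** * The Gudermannian function *)

Section Gudermann.
Variable R : realType.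
Implicit Types x y h : R.

Definition gd x : R := atan (sinh x).

Lemma one_sinh2 h : 1 + sinh h ^+ 2 = cosh h ^+ 2.
Proof. by have := cosh2_sinh2 h; lra. Qed.

Lemma cos_gd h : cos (gd h) * cosh h = 1.
Proof.
rewrite /gd cos_atan one_sinh2 sqrtr_sqr gtr0_norm ?cosh_gt0 //.
by rewrite mulVf ?cosh_neq0.
Qed.

Lemma sin_gd h : sin (gd h) * cosh h = sinh h.
Proof.
have c0 : cos (gd h) != 0 by apply/eqP => e; have := cos_gd h; rewrite e; lra.
have : tan (gd h) = sinh h by rewrite /gd atanK.
rewrite /tan => <-; have := cos_gd h => e.
by rewrite -{2}[sin _]mulr1 -e; field.
Qed.

Lemma gd_gt h : - (pi / 2) < gd h. Proof. exact: atan_gtNpi2. Qed.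
Lemma gd_lt h : gd h < pi / 2. Proof. exact: atan_ltpi2. Qed.

Lemma is1_gd h : is_derive h (1 : R) gd (cosh h)^-1.
Proof.
rewrite /gd; dvE; rewrite one_sinh2; field.
by rewrite cosh_neq0.
Qed.

Lemma two_sin_sin x y : 2 * (sin x * sin y) = cos (x - y) - cos (x + y).
Proof. rewrite cosB cosD; ring. Qed.

End Gudermann.

Section NullCoordinates.
Variables (R : realType) (K : R).
Local Notation k := (curv_root K).
Implicit Types p q : model R.

(* The Gudermannian [gd] makes the chart conformally flat; [na], [nb] are half null
   coordinates, and the metric is [- 4 * cf ^ 2 * dna * dnb]. *)
Definition ct p : R := if 0 < K then gd p.1 else p.1.
Definition cx p : R := if K < 0 then gd p.2 else p.2.
Definition na p : R := (ct p - cx p) / 2.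
Definition nb p : R := (ct p + cx p) / 2.
Definition cf p : R :=
  if 0 < K then cosh p.1 / k else if K < 0 then cosh p.2 / k else 1.
Definition nsin (x : R) : R := if K == 0 then x else sin x.

Lemma radiusE : Defs.radius K = k^-1. Proof. by []. Qed.

Lemma cf_gt0 p : 0 < cf p.
Proof.
by rewrite /cf; case: (curvP K) => [K0 k0 _|K0 k0 _|_] //;
  rewrite divr_gt0 // cosh_gt0.
Qed.

Lemma crd_out n (v : 'rV[R]_n) i : (n <= i)%N -> crd v i = 0.
Proof. by move=> h; rewrite /crd insubF // ltnNge h. Qed.

Lemma model_dim0 : K = 0 -> model_dim K = 2%N.
Proof. by move=> ->; rewrite /model_dim eqxx. Qed.

(** Twice the product of two sines is a difference of two cosines. For K nonzero, one is the cosine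
    of an angle of the chart and the other that of a difference of Gudermannians; as [cosh] is the
    reciprocal of cos of [gd], the conformal factors turn this difference into 1 minus a scalar
    product, up to scale. So the sign of [world] is read off the two null differences. *)
Lemma world_null p q :
  world K p q = 2 * cf p * cf q * (nsin (na q - na p) * nsin (nb q - nb p)).
Proof.
rewrite /world bE !(crdD, crdN, crd_emb) /emb_coords /sig1.
case: p q => [t x] [t' x']; rewrite /cf /nsin /na /nb /ct /cx radiusE.
case: (curvP K) => [K0 k0 KE|K0 k0 KE|K0] /=.
- have := two_sin_sin ((gd t' - x') / 2 - (gd t - x) / 2)
                      ((gd t' + x') / 2 - (gd t + x) / 2).
  have -> : (gd t' - x') / 2 - (gd t - x) / 2 - ((gd t' + x') / 2 - (gd t + x) / 2)
     = x - x' by field.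
  have -> : (gd t' - x') / 2 - (gd t - x) / 2 + ((gd t' + x') / 2 - (gd t + x) / 2)
     = gd t - - (gd t' - gd t - gd t) by field.
  have -> : gd t - - (gd t' - gd t - gd t) = gd t' - gd t by ring.
  set S := sin _ * sin _; rewrite cosB cosB => e.
  have h1 := cos_gd t; have h2 := cos_gd t'.
  have h3 := sin_gd t; have h4 := sin_gd t'.
  have h5 := cosh2_sinh2 t; have h6 := cosh2_sinh2 t'.
  have h7 := cos2Dsin2 x; have h8 := cos2Dsin2 x'.
  have -> : 2 * (cosh t / k) * (cosh t' / k) * S =
      ((cosh t * cosh t') * (2 * S)) / k ^+ 2 by field; rewrite gt_eqF.
  rewrite e.
  have -> : cosh t * cosh t' * (cos x * cos x' + sin x * sin x' -
     (cos (gd t') * cos (gd t) + sin (gd t') * sin (gd t))) =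
    cosh t * cosh t' * (cos x * cos x' + sin x * sin x') -
    (1 + sinh t * sinh t').
    transitivity (cosh t * cosh t' * (cos x * cos x' + sin x * sin x') -
      (cos (gd t) * cosh t * (cos (gd t') * cosh t') +
       sin (gd t) * cosh t * (sin (gd t') * cosh t'))); first by ring.
    by rewrite h1 h2 h3 h4 mulr1.
  apply: (@mulIf _ (2 * k ^+ 2)); first by rewrite mulf_neq0 ?expf_neq0 ?gt_eqF.
  rewrite -[RHS]mulrA (mulrA (k ^+ 2)^-1).
  have -> : - (- ((k^-1 * sinh t - k^-1 * sinh t') *
          (k^-1 * sinh t - k^-1 * sinh t')) +
      1 * ((k^-1 * (cosh t * cos x) - k^-1 * (cosh t' * cos x')) *
       (k^-1 * (cosh t * cos x) - k^-1 * (cosh t' * cos x'))) +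
      (k^-1 * (cosh t * sin x) - k^-1 * (cosh t' * sin x')) *
      (k^-1 * (cosh t * sin x) - k^-1 * (cosh t' * sin x'))) / 2 *
     (2 * k ^+ 2) =
   (sinh t - sinh t') ^+ 2 - (cosh t ^+ 2 * (cos x ^+ 2 + sin x ^+ 2)
    + cosh t' ^+ 2 * (cos x' ^+ 2 + sin x' ^+ 2) -
     2 * cosh t * cosh t' * (cos x * cos x' + sin x * sin x')).
    by field; rewrite gt_eqF.
  rewrite h7 h8 !mulr1.
  have -> : (k ^+ 2)^-1 * 2 * k ^+ 2 = 2 by field; rewrite gt_eqF.
  lra.
- have := two_sin_sin ((t' - gd x') / 2 - (t - gd x) / 2)
                      ((t' + gd x') / 2 - (t + gd x) / 2).
  have -> : (t' - gd x') / 2 - (t - gd x) / 2 - ((t' + gd x') / 2 - (t + gd x) / 2)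
     = gd x - gd x' by field.
  have -> : (t' - gd x') / 2 - (t - gd x) / 2 + ((t' + gd x') / 2 - (t + gd x) / 2)
     = t' - t by field.
  set S := sin _ * sin _; rewrite cosB cosB => e.
  have h1 := cos_gd x; have h2 := cos_gd x'.
  have h3 := sin_gd x; have h4 := sin_gd x'.
  have h5 := cosh2_sinh2 x; have h6 := cosh2_sinh2 x'.
  have h7 := cos2Dsin2 t; have h8 := cos2Dsin2 t'.
  have -> : 2 * (cosh x / k) * (cosh x' / k) * S =
      ((cosh x * cosh x') * (2 * S)) / k ^+ 2 by field; rewrite gt_eqF.
  rewrite e.
  have -> : cosh x * cosh x' * (cos (gd x) * cos (gd x') + sin (gd x) * sin (gd x') -
     (cos t' * cos t + sin t' * sin t)) =
    (1 + sinh x * sinh x') - cosh x * cosh x' * (cos t' * cos t + sin t' * sin t).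
    transitivity ((cos (gd x) * cosh x * (cos (gd x') * cosh x') +
       sin (gd x) * cosh x * (sin (gd x') * cosh x')) -
       cosh x * cosh x' * (cos t' * cos t + sin t' * sin t)); first by ring.
    by rewrite h1 h2 h3 h4 mulr1.
  apply: (@mulIf _ (2 * k ^+ 2)); first by rewrite mulf_neq0 ?expf_neq0 ?gt_eqF.
  rewrite -[RHS]mulrA (mulrA (k ^+ 2)^-1).
  have -> : - (- ((k^-1 * (cosh x * cos t) - k^-1 * (cosh x' * cos t')) *
          (k^-1 * (cosh x * cos t) - k^-1 * (cosh x' * cos t'))) +
      -1 * ((k^-1 * (cosh x * sin t) - k^-1 * (cosh x' * sin t')) *
       (k^-1 * (cosh x * sin t) - k^-1 * (cosh x' * sin t'))) +
      (k^-1 * sinh x - k^-1 * sinh x') * (k^-1 * sinh x - k^-1 * sinh x')) / 2 *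
     (2 * k ^+ 2) =
   (cosh x ^+ 2 * (cos t ^+ 2 + sin t ^+ 2)
    + cosh x' ^+ 2 * (cos t' ^+ 2 + sin t' ^+ 2) -
     2 * cosh x * cosh x' * (cos t' * cos t + sin t' * sin t)) -
     (sinh x - sinh x') ^+ 2.
    by field; rewrite gt_eqF.
  rewrite h7 h8 !mulr1.
  have -> : (k ^+ 2)^-1 * 2 * k ^+ 2 = 2 by field; rewrite gt_eqF.
  lra.
- by field.
Qed.

(** [dct], [dcx], [dna] and [dnb] are the differentials at [p] of [ct], [cx], [na] and [nb], applied
    to a vector of the chart. *)
Definition dct p (v : R * R) : R := if 0 < K then v.1 / cosh p.1 else v.1.
Definition dcx p (v : R * R) : R := if K < 0 then v.2 / cosh p.2 else v.2.
Definition dna p v : R := (dct p v - dcx p v) / 2.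
Definition dnb p v : R := (dct p v + dcx p v) / 2.

Section Along.
Variables (c : R -> model R) (s : R).
Hypothesis dc : derivable c s 1.
Local Notation v := (derive1 c s).

Lemma is1_ct : is_derive s (1 : R) (fun t => ct (c t)) (dct (c s) v).
Proof.
have h := is1_fst dc; rewrite /ct /dct; case: ifP => _ //.
by have := is1_comp (g := fun t => (c t).1) (is1_gd _) h; rewrite mulrC.
Qed.

Lemma is1_cx : is_derive s (1 : R) (fun t => cx (c t)) (dcx (c s) v).
Proof.
have h := is1_snd dc; rewrite /cx /dcx; case: ifP => _ //.
by have := is1_comp (g := fun t => (c t).2) (is1_gd _) h; rewrite mulrC.
Qed.

Lemma is1_na : is_derive s (1 : R) (fun t => na (c t)) (dna (c s) v).
Proof.
by have h1 := is1_ct; have h2 := is1_cx; rewrite /na /dna; dvE; field.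
Qed.

Lemma is1_nb : is_derive s (1 : R) (fun t => nb (c t)) (dnb (c s) v).
Proof.
by have h1 := is1_ct; have h2 := is1_cx; rewrite /nb /dnb; dvE; field.
Qed.

(** The differential of [emb] at [p], in ambient coordinates. *)
Definition demb (p : model R) (w : R * R) : seq R :=
  let: (t, x) := p in
  if 0 < K then
    [:: cosh t * w.1 / k; (sinh t * cos x * w.1 - cosh t * sin x * w.2) / k;
        (sinh t * sin x * w.1 + cosh t * cos x * w.2) / k]
  else if K < 0 then
    [:: (sinh x * cos t * w.2 - cosh x * sin t * w.1) / k;
        (sinh x * sin t * w.2 + cosh x * cos t * w.1) / k; cosh x * w.2 / k]
  else [:: w.1; w.2].

Lemma velocity_crd : derivable (emb K \o c) s 1 /\
  forall i, (i < model_dim K)%N -> crd (velocity K c s) i = nth 0 (demb (c s) v) i.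
Proof.
apply: derivable_crd => i hi; under eq_fun => t do rewrite crd_emb.
have h1 := is1_fst dc; have h2 := is1_snd dc.
have E t : c t = ((c t).1, (c t).2) by case: (c t).
rewrite /demb E; under eq_fun => t do rewrite /emb_coords E radiusE.
have := hi; rewrite /model_dim; case: (curvP K) => [K0 k0 KE|K0 k0 KE|K0];
  case: i hi => [|[|[|i]]] //= _ _; by dvE; rewrite /=; ring.
Qed.

Lemma velocity_norm : b (velocity K c s) (velocity K c s) =
  - (4 * cf (c s) ^+ 2 * (dna (c s) v * dnb (c s) v)).
Proof.
have [_ h] := velocity_crd.
rewrite bE; move: (h 0%N) (h 1%N) (h 2%N) (@crd_out _ (velocity K c s)) => {h}.
move: (crd (velocity K c s)) => u.
have dimE : model_dim K = if K == 0 then 2%N else 3%N by [].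
rewrite dimE /demb /cf /dna /dnb /dct /dcx /sig1.
case: (c s) => t x; case: (curvP K) => [K0 k0 KE|K0 k0 KE|K0].
- move=> -> // -> // -> // _ /=.
  transitivity ((- (cosh t * v.1) ^+ 2 + (sinh t * v.1) ^+ 2 *
    (cos x ^+ 2 + sin x ^+ 2) + (cosh t * v.2) ^+ 2 *
    (cos x ^+ 2 + sin x ^+ 2)) / k ^+ 2).
    by field; rewrite gt_eqF.
  rewrite cos2Dsin2 !mulr1.
  transitivity ((cosh t ^+ 2 * v.2 ^+ 2 - v.1 ^+ 2 * (cosh t ^+ 2 - sinh t ^+ 2))
     / k ^+ 2); first by field; rewrite gt_eqF.
  by rewrite cosh2_sinh2; field; rewrite cosh_neq0 gt_eqF.
- move=> -> // -> // -> // _ /=.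
  transitivity (((cosh x * v.2) ^+ 2 - (sinh x * v.2) ^+ 2 *
    (cos t ^+ 2 + sin t ^+ 2) - (cosh x * v.1) ^+ 2 *
    (cos t ^+ 2 + sin t ^+ 2)) / k ^+ 2).
    by field; rewrite gt_eqF.
  rewrite cos2Dsin2 !mulr1.
  transitivity ((v.2 ^+ 2 * (cosh x ^+ 2 - sinh x ^+ 2) - cosh x ^+ 2 * v.1 ^+ 2)
     / k ^+ 2); first by field; rewrite gt_eqF.
  by rewrite cosh2_sinh2; field; rewrite cosh_neq0 gt_eqF.
- by move=> -> // -> // _ -> //=; field.
Qed.

End Along.

(** Two numbers with positive sum and nonnegative product are both nonnegative. *)
Lemma causal_vector p (v : R * R) : 0 < v.1 ->
  - (4 * cf p ^+ 2 * (dna p v * dnb p v)) <= 0 ->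
  [/\ 0 <= dna p v, 0 <= dnb p v & 0 < dna p v + dnb p v].
Proof.
move=> v0; rewrite oppr_le0 pmulr_rge0 ?mulr_gt0 ?exprn_gt0 ?cf_gt0 // => h.
have s0 : 0 < dna p v + dnb p v.
  rewrite /dna /dnb /dct; case: ifP => _; last by lra.
  suff : 0 < v.1 / cosh p.1 by lra.
  by rewrite divr_gt0 // cosh_gt0.
by split=> //; nra.
Qed.

End NullCoordinates.

(** * Antiderivatives and consequences of the mean value theorem *)

Section Antiderivative.
Variable R : realType.
Implicit Types (f F : R -> R) (r s t : R).
Local Notation mu := (@lebesgue_measure R).

Lemma segment_integrable f r s : continuous f ->
  mu.-integrable `[r, s] (EFin \o f).
Proof.
move=> cf; apply: continuous_compact_integrable; first exact: segment_compact.
exact: continuous_subspaceT.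
Qed.

Lemma Rint_cat f r s t : continuous f -> r <= s -> s <= t ->
  \int[mu]_(x in `[r, t]) f x =
  \int[mu]_(x in `[r, s]) f x + \int[mu]_(x in `[s, t]) f x.
Proof.
move=> cf rs st; apply/eqP; rewrite addrC -subr_eq; apply/eqP.
rewrite Rintegral_itvB ?bnd_simp //; last exact: segment_integrable.
rewrite Rintegral_itv_obnd_cbnd //.
apply: (integrableS _ _ _ (segment_integrable s t cf)) => //.
by apply: subset_itvr; rewrite bnd_simp.
Qed.

(** The integral from [- N], normalized to vanish at 0, does not depend on [N] as long as [- N]
    stays to the left of [t]. Near a given point a single [N] serves, so the fundamental theorem on
    a segment applies. *)
Lemma antiderivative f : continuous f ->
  exists F, forall t, is_derive t (1 : R) F (f t).
Proof.
move=> cf.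
pose G N t := \int[mu]_(x in `[- N, t]) f x - \int[mu]_(x in `[- N, 0]) f x.
have GE N M t : 0 <= N -> N <= M -> - N <= t -> G M t = G N t.
  move=> N0 NM Nt; rewrite /G (@Rint_cat f (- M) (- N) t) ?lerN2 //.
  rewrite (@Rint_cat f (- M) (- N) 0) ?lerN2 ?oppr_le0 //; ring.
exists (fun t => G (`|t| + 1) t) => t.
have dG : is_derive t (1 : R) (G (`|t| + 2)) (f t).
  have tlt : - (`|t| + 2) < t by have := lerNnormlW (lexx `|t|); lra.
  have ti : t < t + 1 by lra.
  have [d1 d2] := continuous_FTC1_closed ti (segment_integrable (- (`|t| + 2)) (t + 1) cf) tlt (cf t).
  have d3 : is_derive t (1 : R)
      (fun x => \int[mu]_(u in `[(- (`|t| + 2)), x]) f u) (f t).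
    by apply: DeriveDef; [exact: d1|rewrite -derive1E; exact: d2].
  by rewrite /G; dvE; ring.
apply: near_eq_is_derive dG; apply/nbhs_ballP; exists 1 => //= u.
rewrite /ball /= => tu.
have h : `|u| <= `|t| + 1.
  have -> : u = t - (t - u) by ring.
  by apply: le_trans (ler_normB _ _) _; lra.
have h2 := lerNnormlW (lexx `|u|); have h3 := normr_ge0 u.
by apply: GE; lra.
Qed.

Lemma Rint_FTC f F r s : continuous f -> (forall t, is_derive t (1 : R) F (f t)) ->
  r < s -> \int[mu]_(x in `[r, s]) f x = F s - F r.
Proof.
move=> cf dF rs; rewrite /Rintegral (@continuous_FTC2 _ f F) //.
- exact: continuous_subspaceT.
- split=> [t _|//|//]; first by have [] := dF t.
    by apply: cvg_at_right_filter; exact: (is1_continuous (dF r)).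
  by apply: cvg_at_left_filter; exact: (is1_continuous (dF s)).
- by move=> t _; exact: is1_derive1.
Qed.

Lemma le_of_derive_ge0 (G g : R -> R) r s : r <= s ->
  (forall t, r <= t <= s -> is_derive t (1 : R) G (g t)) ->
  (forall t, r <= t <= s -> 0 <= g t) -> G r <= G s.
Proof.
move=> rs dG g0; have [||t trs e] := @MVT_segment R G g r s rs.
- by move=> t; rewrite in_itv /= => /andP[h1 h2]; apply: dG; rewrite !ltW.
- apply: derivable_within_continuous => t; rewrite in_itv /= => h.
  by have [] := dG _ h.
by rewrite -subr_ge0 e mulr_ge0 ?subr_ge0 // g0 //; rewrite in_itv in trs.
Qed.

Lemma lt_of_derive_gt0 (G g : R -> R) r s : r < s ->
  (forall t, r <= t <= s -> is_derive t (1 : R) G (g t)) ->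
  (forall t, r <= t <= s -> 0 < g t) -> G r < G s.
Proof.
move=> rs dG g0; have [||t trs e] := @MVT_segment R G g r s (ltW rs).
- by move=> t; rewrite in_itv /= => /andP[h1 h2]; apply: dG; rewrite !ltW.
- apply: derivable_within_continuous => t; rewrite in_itv /= => h.
  by have [] := dG _ h.
by rewrite -subr_gt0 e mulr_gt0 ?subr_gt0 // g0 //; rewrite in_itv in trs.
Qed.

Lemma IVT_le f r s v : r <= s -> (forall t, r <= t <= s -> {for t, continuous f}) ->
  f r <= v -> v <= f s -> exists2 t, r <= t <= s & f t = v.
Proof.
move=> rs cf h1 h2; have [||t] := @IVT R f r s v rs.
- by apply: continuous_in_subspaceT => t; rewrite inE /= in_itv => /cf.
- by rewrite ge_min le_max h1 h2 orbT.
by rewrite in_itv => h e; exists t.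
Qed.

End Antiderivative.

Section Continuity.
Variable R : realType.
Implicit Types (f g : R -> R) (x : R).

Lemma ct_id x : {for x, continuous (fun t : R => t)}.
Proof. exact: cvg_id. Qed.
Lemma ct_cst (c x : R) : {for x, continuous (fun _ : R => c)}.
Proof. exact: cvg_cst. Qed.
Lemma ct_add f g x : {for x, continuous f} -> {for x, continuous g} ->
  {for x, continuous (fun t => f t + g t)}.
Proof. by move=> hf hg; exact: continuousD. Qed.
Lemma ct_opp f x : {for x, continuous f} -> {for x, continuous (fun t => - f t)}.
Proof. by move=> hf; exact: continuousN. Qed.
Lemma ct_mul f g x : {for x, continuous f} -> {for x, continuous g} ->
  {for x, continuous (fun t => f t * g t)}.
Proof. by move=> hf hg; exact: continuousM. Qed.
Lemma ct_inv f x : f x != 0 -> {for x, continuous f} ->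
  {for x, continuous (fun t => (f t)^-1)}.
Proof. by move=> h hf; exact: continuousV. Qed.
Lemma ct_exp f n x : {for x, continuous f} -> {for x, continuous (fun t => f t ^+ n)}.
Proof.
move=> hf; elim: n => [|n IH].
  have -> : (fun t => f t ^+ 0) = (fun _ => 1) :> (R -> R) by apply/funext.
  exact: ct_cst.
have -> : (fun t => f t ^+ n.+1) = (fun t => f t * f t ^+ n) :> (R -> R).
  by apply/funext => t; rewrite exprS.
exact: ct_mul.
Qed.
Lemma ct_comp f g x : {for g x, continuous f} -> {for x, continuous g} ->
  {for x, continuous (fun t => f (g t))}.
Proof. by move=> hf hg; exact: (@continuous_comp _ _ _ g f). Qed.

Lemma pos_near f x : {for x, continuous f} -> 0 < f x ->
  exists2 e : R, 0 < e & forall y, `|x - y| < e -> 0 < f y.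
Proof.
move=> cf fx; have /cvgrPdist_lt /(_ _ fx) /nbhs_ballP[e /= e0 he] := cf.
exists e => // y hy; have := he y hy; rewrite ltr_distlC => /andP[h1 _].
by move: h1; rewrite subrr.
Qed.

End Continuity.

(** The analogue of [dv] for continuity at a point. *)
Ltac cv_hook := fail.
Ltac cv :=
  lazymatch goal with
  | |- {for ?x, continuous (fun t => t)} => exact (@ct_id _ _)
  | |- {for ?x, continuous (fun _ => ?c)} => exact (@ct_cst _ _ _)
  | |- {for ?x, continuous (fun t => @?f t + @?g t)} =>
      refine (@ct_add _ f g _ _ _); cv
  | |- {for ?x, continuous (fun t => - @?f t)} => refine (@ct_opp _ f _ _); cv
  | |- {for ?x, continuous (fun t => (@?f t) * (@?g t))} =>
      refine (@ct_mul _ f g _ _ _); cv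
  | |- {for ?x, continuous (fun t => (@?f t) ^+ ?n)} =>
      refine (@ct_exp _ f n _ _); cv
  | |- {for ?x, continuous (fun t => (@?f t)^-1)} =>
      refine (@ct_inv _ f _ _ _); [|cv]
  | |- {for ?x, continuous (fun t => sin (@?f t))} =>
      refine (@ct_comp _ (@sin _) f _ _ _); [exact: continuous_sin|cv]
  | |- {for ?x, continuous (fun t => cos (@?f t))} =>
      refine (@ct_comp _ (@cos _) f _ _ _); [exact: continuous_cos|cv]
  | |- {for ?x, continuous (fun t => cosh (@?f t))} =>
      refine (@ct_comp _ (@cosh _) f _ _ _);
      [exact (is1_continuous (is1_cosh _))|cv]
  | |- {for ?x, continuous (fun t => sinh (@?f t))} =>
      refine (@ct_comp _ (@sinh _) f _ _ _);
      [exact (is1_continuous (is1_sinh _))|cv]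
  | |- {for ?x, continuous (fun t => Num.sqrt (@?f t))} =>
      refine (@ct_comp _ (@Num.sqrt _) f _ _ _); [exact: sqrt_continuous|cv]
  | |- {for ?x, continuous (fun t => ph ?K (@?f t))} =>
      refine (@ct_comp _ (ph K) f _ _ _); [exact (is1_continuous (is1_ph _ _))|cv]
  | |- {for ?x, continuous (fun t => sn ?K (@?f t))} =>
      refine (@ct_comp _ (sn K) f _ _ _); [exact (is1_continuous (is1_sn _ _))|cv]
  | |- {for ?x, continuous (fun t => cs ?K (@?f t))} =>
      refine (@ct_comp _ (cs K) f _ _ _); [exact (is1_continuous (is1_cs _ _))|cv]
  | |- {for ?x, continuous _} => first [assumption | cv_hook | idtac]
  end.

(** * The range in which the world function controls causality *)

Section Range.
Variables (R : realType) (K : R).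
Local Notation k := (curv_root K).
Implicit Types p q : model R.

(** The sign is chosen so that [nb p + sna p] is the coordinate produced by [gd], time for K > 0 and
    space for K < 0, which is bounded by pi / 2. *)
Definition sna p : R := if K < 0 then - na K p else na K p.

(* Positivity of the two cosines in [room_cos], which keeps [K * world K p q] above [-2]; no
   condition when [K = 0]. *)
Definition rng p q : Prop := K != 0 ->
  `|nb K q + sna p| < pi / 2 /\ `|nb K p + sna q| < pi / 2.

Lemma rngC p q : rng p q -> rng q p.
Proof. by move=> h K0; have [h1 h2] := h K0. Qed.

Definition eta p : R := nb K p + sna p.

Lemma etaE p : eta p = if K < 0 then cx K p else ct K p.
Proof. by rewrite /eta /sna /na /nb; case: ifP => _; field. Qed.

Lemma eta_lt p : K != 0 -> `|eta p| < pi / 2.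
Proof.
move=> K0; rewrite etaE /ct /cx ltr_norml.
by move: K0; case: (curvP K) => // *; rewrite gd_gt gd_lt.
Qed.

Lemma rng_refl p : rng p p.
Proof. by move=> K0; rewrite -/(eta p) eta_lt. Qed.

Lemma cos_eta p : K != 0 -> cos (eta p) * (k * cf K p) = 1.
Proof.
rewrite etaE /ct /cx /cf; case: (curvP K) => // [K0 k0 _|K0 k0 _] _.
- by rewrite -[RHS](cos_gd p.1); field; rewrite gt_eqF.
- by rewrite -[RHS](cos_gd p.2); field; rewrite gt_eqF.
Qed.

(** The counterpart of [world_null] with one point replaced by its antipode in the ambient space: 2
    + K [world] is 1 + K b(p, q), and cosines take the place of the sines. *)
Lemma room_cos p q : K != 0 -> 2 + K * world K p q =
  2 * (k * cf K p) * (k * cf K q) * (cos (nb K q + sna p) * cos (nb K p + sna q)).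
Proof.
move=> K0; rewrite world_null /nsin (negbTE K0).
have h1 := cos_eta p K0; have h2 := cos_eta q K0.
set X := 2 * _ * _ * _.
have -> : 2 + K * X = 2 * ((cos (eta p) * (k * cf K p)) *
    (cos (eta q) * (k * cf K q))) + K * X by rewrite h1 h2; ring.
rewrite /eta /sna; move: K0; case: (curvP K) => // [K0 k0 KE|K0 k0 KE] _.
- have -> : K * X = k ^+ 2 * X by congr (_ * _).
  by rewrite /X !(cosD, cosB, sinB, sinD); ring.
- have -> : K * X = - k ^+ 2 * X by congr (_ * _).
  by rewrite /X !(cosD, cosN, sinN, sinB, sinD); ring.
Qed.

Lemma cos_gt0_norm (x : R) : `|x| < pi / 2 -> 0 < cos x.
Proof. by rewrite ltr_norml => h; exact: cos_gt0_pihalf. Qed.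

Lemma rng_room p q : rng p q -> 0 < 2 + K * world K p q.
Proof.
have [K0|K0] := eqVneq K 0; first by rewrite K0 mul0r addr0.
move=> /(_ K0)[h1 h2]; rewrite room_cos //.
have k0 := curv_root_gt0 K0.
by rewrite !mulr_gt0 ?cf_gt0 // cos_gt0_norm.
Qed.

(** Subtract [eta p], which lies in the same open interval of length pi. Within these bounds a sine
    has the sign of its argument. *)
Lemma rng_gap p q : K != 0 -> rng p q ->
  `|na K q - na K p| < pi /\ `|nb K q - nb K p| < pi.
Proof.
move=> K0 /(_ K0)[+ +]; have := eta_lt p K0; rewrite /eta /sna !ltr_norml.
by case: ifP => _ h1 h2 h3; split; lra.
Qed.

Lemma nsin_gt0 p q : rng p q ->
  (0 < nsin K (na K q - na K p)) = (na K p < na K q) /\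
  (0 < nsin K (nb K q - nb K p)) = (nb K p < nb K q).
Proof.
have S x : `|x| < pi -> (0 < sin x) = (0 < x) :> bool.
  rewrite ltr_norml => /andP[h1 h2]; case: (ltrgtP x 0) => h3.
  - apply/negbTE; rewrite -leNgt -oppr_ge0 -sinN; apply: sin_ge0_pi; lra.
  - by apply: sin_gt0_pi; rewrite h3.
  - by rewrite h3 sin0 ltxx.
rewrite /nsin -(subr_gt0 (na K p)) -(subr_gt0 (nb K p)).
have [//|K0] := eqVneq K 0.
by move=> /(rng_gap K0)[h1 h2]; rewrite !S.
Qed.

Lemma nsin0 p q : rng p q ->
  (nsin K (na K q - na K p) == 0) = (na K p == na K q) /\
  (nsin K (nb K q - nb K p) == 0) = (nb K p == nb K q).
Proof.
have S x : `|x| < pi -> (sin x == 0) = (x == 0) :> bool.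
  rewrite ltr_norml => /andP[h1 h2]; case: (ltrgtP x 0) => h3.
  - by apply/negbTE; rewrite lt_eqF // -oppr_gt0 -sinN sin_gt0_pi //; lra.
  - by apply/negbTE; rewrite gt_eqF // sin_gt0_pi // h3.
  - by rewrite h3 sin0 eqxx.
rewrite ![_ K p == _]eq_sym -(subr_eq0 _ (na K p)) -(subr_eq0 _ (nb K p)) /nsin.
have [//|K0] := eqVneq K 0.
by move=> /(rng_gap K0)[h1 h2]; rewrite !S.
Qed.

Definition nle p q := na K p <= na K q /\ nb K p <= nb K q.
Definition nlt p q := na K p < na K q /\ nb K p < nb K q.

Lemma nltW p q : nlt p q -> nle p q. Proof. by case=> *; split; exact: ltW. Qed.

Lemma world_gt0 p q : rng p q -> nlt p q -> 0 < world K p q.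
Proof.
move=> h [h1 h2]; have [e1 e2] := nsin_gt0 h.
by rewrite world_null !mulr_gt0 ?cf_gt0 ?e1 ?e2.
Qed.

Lemma world_ge0 p q : rng p q -> nle p q -> 0 <= world K p q.
Proof.
move=> h [h1 h2]; have [e1 e2] := nsin_gt0 h; have [e3 e4] := nsin0 h.
rewrite world_null mulr_ge0 ?mulr_ge0 ?(ltW (cf_gt0 _ _)) // le_eqVlt.
  by rewrite eq_sym e3 e1 -le_eqVlt.
by rewrite eq_sym e4 e2 -le_eqVlt.
Qed.

Lemma world_order p q : rng p q -> 0 < world K p q -> nlt p q \/ nlt q p.
Proof.
move=> h; have [e1 e2] := nsin_gt0 h; have [e3 e4] := nsin0 h.
rewrite world_null; set M := 2 * _ * _.
have M0 : 0 < M by rewrite !mulr_gt0 ?cf_gt0.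
rewrite (pmulr_rgt0 _ M0) => h0.
have a0 : nsin K (na K q - na K p) != 0.
  by apply/eqP => e; move: h0; rewrite e mul0r ltxx.
case: (ltrgtP (na K p) (na K q)) (e1) (e3) => h1 /idP g1 g3; last 1 first.
- by rewrite g3 in a0.
- by left; split=> //; rewrite -e2; move: h0; rewrite pmulr_rgt0.
right; split=> //.
have n0 : nsin K (na K q - na K p) < 0 by rewrite lt_neqAle a0 leNgt; apply/negP.
have := h0; rewrite nmulr_rgt0 // => n1.
by case: (ltrgtP (nb K p) (nb K q)) e2 e4 => // _; lra.
Qed.

(* The partial derivatives of [world K p] at [q] in the null coordinates. *)
Definition fa p q : R := if K == 0 then 2 * (nb K q - nb K p) else
  2 * cf K p * k * cf K q ^+ 2 * (sin (nb K q - nb K p) * cos (nb K q + sna p)).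
Definition fb p q : R := if K == 0 then 2 * (na K q - na K p) else
  2 * cf K p * k * cf K q ^+ 2 * (sin (na K q - na K p) * cos (nb K p + sna q)).

Lemma cf0 p : K = 0 -> cf K p = 1.
Proof. by move=> ->; rewrite /cf ltxx. Qed.

(** The eikonal equation. For the metric - 4 cf^2 dna dnb it says that the gradient of [world p] has
    squared norm - w (2 + K w), where w is the value of [world p]; by [is1_phinv] the gradient of
    [phinv] of it then has squared norm -1. *)
Lemma fab p q : fa p q * fb p q =
  cf K q ^+ 2 * (world K p q * (2 + K * world K p q)).
Proof.
have [K0|K0] := eqVneq K 0.
  by rewrite /fa /fb world_null /nsin !cf0 // K0 eqxx; ring.
rewrite room_cos // world_null /fa /fb /nsin (negbTE K0); ring.
Qed.

Lemma fa_ge0 p q : rng p q -> nle p q -> 0 <= fa p q.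
Proof.
move=> h [_ h1]; rewrite /fa; case: eqVneq => K0; first by lra.
have [c1 c2] := h K0; have k0 := curv_root_gt0 K0.
have [_ e2] := nsin_gt0 h; have [_ e4] := nsin0 h.
rewrite !mulr_ge0 ?(ltW (cf_gt0 _ _)) ?(ltW k0) ?sqr_ge0 //.
  by move: e2 e4; rewrite /nsin (negbTE K0) le_eqVlt eq_sym => -> ->; rewrite -le_eqVlt.
exact/ltW/cos_gt0_norm.
Qed.

Lemma fb_ge0 p q : rng p q -> nle p q -> 0 <= fb p q.
Proof.
move=> h [h1 _]; rewrite /fb; case: eqVneq => K0; first by lra.
have [c1 c2] := h K0; have k0 := curv_root_gt0 K0.
have [e2 _] := nsin_gt0 h; have [e4 _] := nsin0 h.
rewrite !mulr_ge0 ?(ltW (cf_gt0 _ _)) ?(ltW k0) ?sqr_ge0 //.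
  by move: e2 e4; rewrite /nsin (negbTE K0) le_eqVlt eq_sym => -> ->; rewrite -le_eqVlt.
exact/ltW/cos_gt0_norm.
Qed.

Lemma snaE p : sna p = sig1 K * na K p.
Proof. by rewrite /sna /sig1; case: ifP => _; rewrite ?mulN1r ?mul1r. Qed.

Lemma is1_world p (c : R -> model R) (s : R) : derivable c s 1 ->
  is_derive s (1 : R) (fun t => world K p (c t))
   (fa p (c s) * dna K (c s) (derive1 c s) + fb p (c s) * dnb K (c s) (derive1 c s)).
Proof.
move=> dc; have ha := is1_na K dc; have hb := is1_nb K dc.
have [K0|K0] := eqVneq K 0.
  have -> : (fun t => world K p (c t)) =
      (fun t => 2 * ((na K (c t) - na K p) * (nb K (c t) - nb K p))).
    by apply/funext => t; rewrite world_null !cf0 // /nsin K0 eqxx !mulr1.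
  by dvE; rewrite /fa /fb K0 eqxx; ring.
have k0 := curv_root_gt0 K0.
have c0 q : cos (eta q) != 0.
  by apply/eqP => e; have := cos_eta q K0; rewrite e mul0r; lra.
(* With the conformal factor written as the inverse of k cos [eta], [world p] becomes a function of
   the null coordinates of its argument alone. *)
have cE q : cf K q = (k * cos (eta q))^-1.
  have := cos_eta q K0 => e; apply: (@mulfI _ (k * cos (eta q))).
    by rewrite mulf_neq0 ?c0 ?gt_eqF.
  by rewrite divff ?mulf_neq0 ?c0 ?gt_eqF // -e; ring.
have -> : (fun t => world K p (c t)) =
    (fun t => 2 * cf K p / k * (sin (na K (c t) - na K p) * sin (nb K (c t) - nb K p)
      / cos (nb K (c t) + sig1 K * na K (c t)))).
  apply/funext => t; rewrite world_null /nsin (negbTE K0) (cE (c t)) /eta snaE.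
  have := c0 (c t); rewrite /eta snaE => c0'.
  by field; rewrite c0' gt_eqF.
have := c0 (c s); rewrite /eta snaE => c0'.
dvE; first by [].
rewrite /fa /fb (negbTE K0) (cE (c s)) /eta !snaE.
have -> : nb K (c s) + sig1 K * na K p =
  nb K (c s) + sig1 K * na K (c s) - sig1 K * (na K (c s) - na K p) by ring.
have -> : nb K p + sig1 K * na K (c s) =
  nb K (c s) + sig1 K * na K (c s) - (nb K (c s) - nb K p) by ring.
move: c0'; set E := nb K (c s) + _; move=> c0'.
rewrite (cosB E (sig1 K * _)) (cosB E (nb K _ - _)) /sig1.
by case: ifP => _; rewrite ?mulN1r ?mul1r ?cosN ?sinN; field; rewrite c0' gt_eqF.
Qed.

End Range.

(** * Causal paths and time separation in the model space *)

Section Paths.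
Variables (R : realType) (K : R).
Local Notation k := (curv_root K).
Implicit Types (p q : model R) (c : R -> model R) (r s t l : R).

Lemma ct_fst c t : {for t, continuous c} -> {for t, continuous (fun x => (c x).1)}.
Proof. by move=> h; exact: (cvg_comp _ _ h (@cvg_fst _ _ _ _ _)). Qed.

Lemma ct_snd c t : {for t, continuous c} -> {for t, continuous (fun x => (c x).2)}.
Proof. by move=> h; exact: (cvg_comp _ _ h (@cvg_snd _ _ _ _ _)). Qed.

Lemma derivable_continuous_model c t : derivable c t 1 -> {for t, continuous c}.
Proof. by move=> /derivable1_diffP /differentiable_continuous. Qed.

Definition speed c t : R := Num.sqrt (- b (velocity K c t) (velocity K c t)).

Lemma speedE c t : derivable c t 1 -> speed c t =
  Num.sqrt (4 * cf K (c t) ^+ 2 * (dna K (c t) (derive1 c t) * dnb K (c t) (derive1 c t))).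
Proof. by move=> dc; rewrite /speed velocity_norm // opprK. Qed.

Lemma speed_continuous c : (forall t, derivable c t 1) -> continuous (derive1 c) ->
  continuous (speed c).
Proof.
move=> dc cc t; rewrite (_ : speed c = fun t => Num.sqrt (4 * cf K (c t) ^+ 2 *
   (dna K (c t) (derive1 c t) * dnb K (c t) (derive1 c t)))); last first.
  by apply/funext => x; rewrite speedE.
have h1 := ct_fst (derivable_continuous_model (dc t)).
have h2 := ct_snd (derivable_continuous_model (dc t)).
have h3 := ct_fst (cc t); have h4 := ct_snd (cc t).
have h5 : {for t, continuous (fun x => cosh (c x).1)} by cv.
have h6 : {for t, continuous (fun x => cosh (c x).2)} by cv.
have h7 : {for t, continuous (fun x => cf K (c x))}.
  by rewrite /cf; case: (0 < K); [cv|case: (K < 0); cv].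
have h8 : {for t, continuous (fun x => dct K (c x) (derive1 c x))}.
  by rewrite /dct; case: (0 < K); [cv; rewrite ?cosh_neq0|cv].
have h9 : {for t, continuous (fun x => dcx K (c x) (derive1 c x))}.
  by rewrite /dcx; case: (K < 0); [cv; rewrite ?cosh_neq0|cv].
rewrite -[continuous_at _ _]/{for t, continuous _}; rewrite /dna /dnb; cv.
Qed.

Lemma nle_trans (q p r : model R) : nle K p q -> nle K q r -> nle K p r.
Proof. by move=> [h1 h2] [h3 h4]; split; [exact: le_trans h3|exact: le_trans h4]. Qed.

Lemma nle_refl p : nle K p p. Proof. by []. Qed.

Lemma nlt_nle_trans (q p r : model R) : nlt K p q -> nle K q r -> nlt K p r.
Proof.
by move=> [h1 h2] [h3 h4]; split; [exact: lt_le_trans h3|exact: lt_le_trans h4].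
Qed.

Section C1.
Variables (c : R -> model R) (r s : R).
Hypothesis H : C1_future_causal K c r s.

Lemma C1_vector t : r <= t <= s ->
  [/\ 0 <= dna K (c t) (derive1 c t), 0 <= dnb K (c t) (derive1 c t) &
      0 < dna K (c t) (derive1 c t) + dnb K (c t) (derive1 c t)].
Proof.
case: H => rs dc cc h /h[h1 h2]; apply: causal_vector => //.
by rewrite -velocity_norm.
Qed.

Lemma C1_nle t t' : r <= t -> t <= t' -> t' <= s -> nle K (c t) (c t').
Proof.
case: (H) => rs dc cc _ rt tt' ts.
have I x : t <= x <= t' -> r <= x <= s.
  by move=> /andP[h1 h2]; rewrite (le_trans rt h1) (le_trans h2 ts).
split.
- apply: (le_of_derive_ge0 (G := fun t => na K (c t)) tt') => x hx; first exact: is1_na.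
  by have [] := C1_vector (I _ hx).
- apply: (le_of_derive_ge0 (G := fun t => nb K (c t)) tt') => x hx; first exact: is1_nb.
  by have [] := C1_vector (I _ hx).
Qed.

Lemma C1_lt : na K (c r) + nb K (c r) < na K (c s) + nb K (c s).
Proof.
case: (H) => rs dc cc _.
apply: (lt_of_derive_gt0 (G := fun t => na K (c t) + nb K (c t)) rs) => x hx.
  by apply: is1_add; [exact: is1_na|exact: is1_nb].
by have [] := C1_vector hx.
Qed.

Lemma length_ge0 : 0 <= lorentzian_length K c r s.
Proof. by apply: Rintegral_ge0 => t _; exact: sqrtr_ge0. Qed.

(** The derivative of [phinv] of [world p] along the curve dominates the speed. By the eikonal
    equation this reduces to 4 x y <= (x + y)^2 for x = [fa] dna and y = [fb] dnb, a reverse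
    Cauchy-Schwarz inequality. The strict order of [p] and [c r] keeps [world] positive, where
    [phinv] is differentiable. *)
Lemma length_bound p : nlt K p (c r) -> (forall t, r <= t <= s -> rng K p (c t)) ->
  lorentzian_length K c r s <= phinv K (world K p (c s)) - phinv K (world K p (c r)).
Proof.
case: (H) => rs dc cc _ hp hrng.
have cs := speed_continuous dc cc.
have [F dF] := antiderivative cs.
have -> : lorentzian_length K c r s = F s - F r by exact: Rint_FTC.
set w := fun t => world K p (c t).
set d := fun t => fa K p (c t) * dna K (c t) (derive1 c t) +
  fb K p (c t) * dnb K (c t) (derive1 c t).
have np t : r <= t <= s -> nlt K p (c t).
  by move=> /andP[h1 h2]; apply: nlt_nle_trans hp _; exact: C1_nle.
have w0 t : r <= t <= s -> 0 < w t.
  by move=> ht; apply: world_gt0; [exact: hrng|exact: np].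
have wr t : r <= t <= s -> 0 < 2 + K * w t by move=> ht; apply/rng_room/hrng.
suff : phinv K (w r) - F r <= phinv K (w s) - F s by rewrite /w; lra.
apply: (le_of_derive_ge0 (G := fun t => phinv K (w t) - F t)
   (g := fun t => (Num.sqrt (w t * (2 + K * w t)))^-1 * d t - speed c t) (ltW rs)) => t ht.
  apply: (@is1_add _ (fun t => phinv K (w t)) (fun t => - F t)).
  apply: (is1_comp (f := phinv K) (g := w)); last exact: is1_world.
  by apply: is1_phinv; rewrite ?wr ?w0 // ltW ?w0.
rewrite subr_ge0 speedE //.
have [v1 v2 v3] := C1_vector ht.
have f1 := fa_ge0 (hrng t ht) (nltW (np t ht)).
have f2 := fb_ge0 (hrng t ht) (nltW (np t ht)).
have q0 : 0 < w t * (2 + K * w t) by rewrite mulr_gt0 ?w0 ?wr.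
have d0 : 0 <= d t by rewrite addr_ge0 // mulr_ge0.
rewrite ler_pdivlMl ?sqrtr_gt0 // mulrC -sqrtrM; last first.
  by apply: mulr_ge0; [rewrite mulr_ge0 ?sqr_ge0|exact: mulr_ge0].
rewrite -[leRHS](ger0_norm d0) -sqrtr_sqr ler_wsqrtr //.
have := fab K p (c t); rewrite -/(w t) => e.
set X := dna _ _ _; set Y := dnb _ _ _.
have -> : 4 * cf K (c t) ^+ 2 * (X * Y) * (w t * (2 + K * w t)) =
   4 * (fa K p (c t) * X) * (fb K p (c t) * Y).
  transitivity (4 * (X * Y) * (cf K (c t) ^+ 2 * (w t * (2 + K * w t)))); first by ring.
  by rewrite -e; ring.
rewrite /d -/X -/Y; have := sqr_ge0 (fa K p (c t) * X - fb K p (c t) * Y); lra.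
Qed.

End C1.

Lemma path_mono p q l : causal_path K p q l ->
  [/\ nle K p q, na K p + nb K p < na K q + nb K q & 0 <= l].
Proof.
elim=> {p q l} [c r s H|p q r l l' _ [h1 h2 h3] _ [h4 h5 h6]].
  have rs : r < s by case: H.
  by split; [apply: (C1_nle H) => //; exact: ltW|exact: (C1_lt H)|exact: length_ge0].
by split; [exact: nle_trans h4|exact: lt_trans h5|exact: addr_ge0].
Qed.

(** The coordinates in [rng] are monotone, so their extreme values over the diamond involve only [p]
    and [P]. For K < 0 these are bounded by the hypothesis, for K > 0 by [eta_lt]. *)
Lemma rng_diamond p P q q' : rng K p P -> nle K p q -> nle K q P ->
  nle K p q' -> nle K q' P -> rng K q q'.
Proof.
move=> h [a1 b1] [a2 b2] [a3 b3] [a4 b4] K0.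
have := eta_lt p K0; have := eta_lt P K0; rewrite /eta.
have [] := h K0; rewrite /sna !ltr_norml; case: ifP => _; lra.
Qed.

Lemma path_bound (q r : model R) l : causal_path K q r l -> forall p, nlt K p q -> rng K p r ->
  l <= phinv K (world K p r) - phinv K (world K p q).
Proof.
elim=> {q r l} [c r s H|q r s l l' P1 IH1 P2 IH2] p hp hr.
  have rs : r < s by case: H.
  apply: length_bound => // t /andP[h1 h2].
  apply: (rng_diamond hr) => //.
  - by apply: nltW; apply: nlt_nle_trans hp _; apply: (C1_nle H) => //; exact: ltW.
  - by apply: nltW; apply: nlt_nle_trans hp _; apply: (C1_nle H) => //; exact: ltW.
  - exact: (C1_nle H).
have [n1 _ _] := path_mono P1; have [n2 _ _] := path_mono P2.
have pr := nlt_nle_trans hp n1.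
have := IH1 p hp; have := IH2 p pr hr => e2 e1.
have : l <= phinv K (world K p r) - phinv K (world K p q).
  apply: e1; apply: (rng_diamond hr) => //; first exact: (nltW (nlt_nle_trans pr n2)).
  exact: nltW.
lra.
Qed.

Lemma limit_ge0 (f : R -> R) x : {for x, continuous f} ->
  (forall e, 0 < e -> exists2 y, `|x - y| < e & 0 <= f y) -> 0 <= f x.
Proof.
move=> cf h; rewrite leNgt; apply/negP => fx.
have c' : {for x, continuous (fun y => - f y)} by exact: ct_opp.
have [|e e0 he] := pos_near c'; first by rewrite oppr_gt0.
by have [y /he + ?] := h e e0; lra.
Qed.

(** Moving the base point into the past makes it strictly smaller than [p], as [path_bound] demands;
    the estimate at [p] itself is a limit. *)
Definition shift_past p d : model R := (p.1 - d, p.2).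

Lemma shift_derivable p d : derivable (shift_past p) d 1.
Proof.
have h1 : is_derive d (1 : R) (fun d => p.1 - d) (0 + - 1) by dv.
have h2 := @is1_cst R p.2 d.
exact: (is1_pair h1 h2).1.
Qed.

Arguments shift_derivable : clear implicits.

Lemma sinh_lt (x y : R) : x < y -> sinh x < sinh y.
Proof.
move=> xy; rewrite /sinh ltr_pM2r ?invr_gt0 //.
have : expR x < expR y by rewrite ltr_expR.
have : expR (- y) < expR (- x) by rewrite ltr_expR; lra.
lra.
Qed.

Lemma gd_lt_mono (x y : R) : x < y -> gd x < gd y.
Proof. by move=> xy; rewrite /gd lt_atan // sinh_lt. Qed.

Lemma shift_nlt p d : 0 < d -> nlt K (shift_past p d) p.
Proof.
move=> d0.
have h : ct K (shift_past p d) < ct K p.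
  by rewrite /ct /=; case: ifP => _; [apply: gd_lt_mono|]; lra.
have e : cx K (shift_past p d) = cx K p by [].
by split; rewrite /na /nb e; lra.
Qed.

Lemma shift0 p : shift_past p 0 = p.
Proof. by case: p => t x; rewrite /shift_past subr0. Qed.

Lemma rng_shift p q : rng K p q ->
  exists2 e, 0 < e & forall d, `|d| < e -> rng K (shift_past p d) q.
Proof.
move=> h; have [K0|K0] := eqVneq K 0; first by exists 1 => // d _; rewrite /rng K0 eqxx.
have [h1 h2] := h K0.
have da := is1_continuous (is1_na K (shift_derivable p 0)).
have db := is1_continuous (is1_nb K (shift_derivable p 0)).
pose f1 d := pi / 2 - (nb K q + sna K (shift_past p d)).
pose f2 d := pi / 2 + (nb K q + sna K (shift_past p d)).
pose f3 d := pi / 2 - (nb K (shift_past p d) + sna K q).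
pose f4 d := pi / 2 + (nb K (shift_past p d) + sna K q).
have ds : {for (0 : R), continuous (fun d => sna K (shift_past p d))}.
  by rewrite /sna; case: (K < 0); cv.
move: h1 h2; rewrite !ltr_norml => /andP[a1 a2] /andP[a3 a4].
have [||e1 e10 g1] := @pos_near R f1 0; first by rewrite /f1; cv.
  by rewrite /f1 shift0; lra.
have [||e2 e20 g2] := @pos_near R f2 0; first by rewrite /f2; cv.
  by rewrite /f2 shift0; lra.
have [||e3 e30 g3] := @pos_near R f3 0; first by rewrite /f3; cv.
  by rewrite /f3 shift0; lra.
have [||e4 e40 g4] := @pos_near R f4 0; first by rewrite /f4; cv.
  by rewrite /f4 shift0; lra.
exists (Num.min (Num.min e1 e2) (Num.min e3 e4)); first by rewrite !lt_min e10 e20 e30.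
move=> d; rewrite !lt_min => /andP[/andP[k1 k2] /andP[k3 k4]] _.
have N : `|0 - d| = `|d| by rewrite sub0r normrN.
have := g1 d; have := g2 d; have := g3 d; have := g4 d.
rewrite N => /(_ k4) + /(_ k3) + /(_ k2) + /(_ k1); rewrite /f1 /f2 /f3 /f4 !ltr_norml.
by move=> *; split; lra.
Qed.

(** The length is below D_K because every value of [phinv] is. The bound on [ph] holds from each
    slightly shifted base point and passes to the limit. *)
Lemma path_upper p q l : causal_path K p q l -> rng K p q ->
  below_diameter K l /\ ph K l <= world K p q.
Proof.
move=> P h; have [npq _ l0] := path_mono P.
have [e e0 he] := rng_shift h.
have B d : 0 < d -> `|d| < e ->
    below_diameter K l /\ ph K l <= world K (shift_past p d) q.
  move=> d0 hd; have hr := he d hd; have n1 := shift_nlt p d0.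
  have n2 := nlt_nle_trans n1 npq.
  have b1 := path_bound P n1 hr.
  have w0 := world_gt0 hr n2; have r0 := rng_room hr.
  have r1 : rng K (shift_past p d) p by apply: (rng_diamond hr) => //; exact: nltW.
  have b2 := phinv_ge0 (ltW (world_gt0 r1 n1)) (rng_room r1).
  have b3 : l <= phinv K (world K (shift_past p d) q) by lra.
  have b4 := @phinv_below R K (world K (shift_past p d) q).
  split; first exact: below_diameter_le b3 b4.
  by rewrite -[leRHS](phinvK (ltW w0) r0) ph_le.
have he2 : `|e / 2| < e by rewrite gtr0_norm; lra.
have [bl _] := B (e / 2) ltac:(lra) he2; split=> //.
rewrite -subr_ge0 -{1}(shift0 p).
pose f d := world K (shift_past p d) q - ph K l.
have cw : {for (0 : R), continuous (fun d => world K (shift_past p d) q)}.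
  have := is1_continuous (is1_world K q (shift_derivable p 0)).
  by rewrite (_ : (fun d => world K q (shift_past p d)) =
     (fun d => world K (shift_past p d) q)) //; apply/funext => d; rewrite worldC.
apply: (@limit_ge0 f 0); first by rewrite /f; cv.
move=> e' e'0; exists (Num.min e e' / 2).
  rewrite sub0r normrN gtr0_norm ?divr_gt0 ?lt_min ?e0 ?e'0 //.
  have : Num.min e e' <= e' by rewrite ge_min lexx orbT.
  lra.
have m0 : 0 < Num.min e e' by rewrite lt_min e0.
have m1 : Num.min e e' <= e by rewrite ge_min lexx.
rewrite subr_ge0; apply: (B _ _ _).2; first lra.
by rewrite gtr0_norm; lra.
Qed.

End Paths.

Section ModelTau.
Variables (R : realType) (K : R).
Implicit Types (p q r : model R) (l : R).
Local Notation mtau := (model_tau K).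
Local Notation mcaus := (model_caus K).

Lemma mtau_ge0 p q : (0 <= mtau p q)%E.
Proof. by apply: ereal_sup_ubound; left. Qed.

Lemma mtau_path p q l : causal_path K p q l -> (l%:E <= mtau p q)%E.
Proof. by move=> h; apply: ereal_sup_ubound; right; exists l. Qed.

Lemma mtau_le p q (M : \bar R) : (0 <= M)%E ->
  (forall l, causal_path K p q l -> (l%:E <= M)%E) -> (mtau p q <= M)%E.
Proof. by move=> M0 h; apply: ge_ereal_sup => x [->//|[l /h ? <-]]. Qed.

Lemma mcaus_trans q p r : mcaus p q -> mcaus q r -> mcaus p r.
Proof.
move=> [->//|[l h]] [<-|[l' h']]; first by right; exists l.
by right; exists (l + l'); exact: CausalCat h h'.
Qed.

Lemma mcaus_nle p q : mcaus p q -> nle K p q.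
Proof. by move=> [->//|[l /path_mono[]]]. Qed.

Lemma no_loop p l : ~ causal_path K p p l.
Proof. by move=> /path_mono[_]; rewrite ltxx. Qed.

Lemma mcaus_anti p q : mcaus p q -> mcaus q p -> p = q.
Proof.
move=> [//|[l h]] [//|[l' h']]; have := CausalCat h h'.
by move=> /no_loop.
Qed.

Lemma mtau_refl p : mtau p p = 0%E.
Proof.
apply/eqP; rewrite eq_le mtau_ge0 andbT; apply: mtau_le => // l.
by move=> /no_loop.
Qed.

Lemma mtau_gt0_path p q : (0 < mtau p q)%E -> exists l, causal_path K p q l /\ 0 < l.
Proof.
move=> h; apply: contrapT => n; move: h; apply/negP; rewrite -leNgt.
apply: mtau_le => // l P; rewrite lee_fin leNgt; apply/negP => l0.
by apply: n; exists l.
Qed.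

Lemma mtau_gt0_caus p q : (0 < mtau p q)%E -> mcaus p q.
Proof. by move=> /mtau_gt0_path[l [h _]]; right; exists l. Qed.

Lemma mtau_triangle p q r : mcaus p q -> mcaus q r ->
  (mtau p q + mtau q r <= mtau p r)%E.
Proof.
move=> [->|[l0 P0]]; first by rewrite mtau_refl add0e.
move=> [<-|[l1 P1]]; first by rewrite mtau_refl adde0.
case E : (mtau p r) => [m| |]; last by have := mtau_ge0 p r; rewrite E.
  have B l l' : causal_path K p q l -> causal_path K q r l' -> l + l' <= m.
    by move=> h h'; rewrite -lee_fin -E; exact: mtau_path (CausalCat h h').
  have Q l : causal_path K p q l -> (mtau q r <= (m - l)%:E)%E.
    move=> h; apply: mtau_le => [|l' h']; rewrite lee_fin; last by have := B _ _ h h'; lra.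
    by have := B _ _ h P1; have [_ _ ?] := path_mono P1; lra.
  have := Q _ P0; have := mtau_ge0 q r.
  case: (mtau q r) Q => [n| |] // Q; rewrite lee_fin => n0 h0.
  rewrite -leeBrDr //; apply: mtau_le => [|l h].
    rewrite lee_fin in h0; have [_ _ ?] := path_mono P0.
    by rewrite -EFinB lee_fin; lra.
  by have := Q _ h; rewrite -EFinB !lee_fin; lra.
by rewrite leey.
Qed.

Lemma mtau_upper p q : rng K p q -> nle K p q ->
  (mtau p q <= (phinv K (world K p q))%:E)%E.
Proof.
move=> h n; have w0 := world_ge0 h n; have r0 := rng_room h.
have i0 := phinv_ge0 w0 r0; apply: mtau_le => [|l P]; rewrite lee_fin //.
have [b1 b2] := path_upper P h; have [_ _ l0] := path_mono P.
by rewrite -(ph_leE l0 i0 b1 (phinv_below _ _)) phinvK.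
Qed.

End ModelTau.

(** * Geodesics of the model space *)

Section GeodesicEquation.
Variables (R : realType) (K : R).
Implicit Types (c : R -> model R) (s t : R).
Local Notation N := (model_dim K).

Lemma b_nondegenerate (v : 'rV[R]_N) : (forall w, b v w = 0) -> v = 0.
Proof.
move=> h; pose w : 'rV[R]_N := \row_j
  ((if (j == 0 :> nat)%N then -1 else if (j == 1 :> nat)%N then sig1 K else 1) * v ord0 j).
have e i : crd w i =
    (if (i == 0)%N then -1 else if (i == 1)%N then sig1 K else 1) * crd v i.
  by rewrite /crd; case: insubP => [j _ <-|_]; rewrite ?mxE ?mulr0.
have s1 : sig1 K * sig1 K = 1 by rewrite /sig1; case: ifP => _; ring.
have := h w; rewrite bE !e /= => h1.
have h2 : crd v 0 ^+ 2 + crd v 1 ^+ 2 + crd v 2 ^+ 2 = 0.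
  rewrite -[RHS]h1.
  transitivity (crd v 0 ^+ 2 + (sig1 K * sig1 K) * crd v 1 ^+ 2 + crd v 2 ^+ 2).
    by rewrite s1 mul1r.
  by ring.
have h3 i : (i < 3)%N -> crd v i = 0.
  have p0 := sqr_ge0 (crd v 0); have p1 := sqr_ge0 (crd v 1); have p2 := sqr_ge0 (crd v 2).
  by case: i => [|[|[|i]]] // _; apply/eqP; rewrite -sqrf_eq0 eq_le ?p0 ?p1 ?p2 andbT; lra.
apply: crd_eq => i hi; rewrite h3 ?(leq_trans hi) ?model_dim_le3 //.
by rewrite /crd; case: insubP => [j _ _|_] //; rewrite mxE.
Qed.

Lemma is1_b (F G : R -> 'rV[R]_N) s : derivable F s 1 -> derivable G s 1 ->
  is_derive s (1 : R) (fun t => b (F t) (G t))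
    (b (derive1 F s) (G s) + b (F s) (derive1 G s)).
Proof.
move=> dF dG.
have f0 := is1_crd 0 dF; have f1 := is1_crd 1 dF; have f2 := is1_crd 2 dF.
have g0 := is1_crd 0 dG; have g1 := is1_crd 1 dG; have g2 := is1_crd 2 dG.
rewrite (_ : (fun t => b (F t) (G t)) = (fun t =>
 - (crd (F t) 0 * crd (G t) 0) + sig1 K * (crd (F t) 1 * crd (G t) 1) +
   crd (F t) 2 * crd (G t) 2)); last by apply/funext => t; rewrite bE.
dvE; rewrite !bE.
move: (crd (F s) 0) (crd (F s) 1) (crd (F s) 2) (crd (G s) 0) (crd (G s) 1)
  (crd (G s) 2) => x0 x1 x2 y0 y1 y2.
move: (crd (derive1 F s) 0) (crd (derive1 F s) 1) (crd (derive1 F s) 2) => u0 u1 u2.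
move: (crd (derive1 G s) 0) (crd (derive1 G s) 1) (crd (derive1 G s) 2) => v0 v1 v2.
ring.
Qed.

Section Geodesic.
Variable c : R -> model R.
Hypothesis hc : timelike_geodesic K c.

Lemma geodesic_derivable s : derivable (emb K \o c) s 1.
Proof. by case: hc. Qed.

Arguments geodesic_derivable : clear implicits.

Lemma geodesic_tangent s : K != 0 -> b (emb K (c s)) (velocity K c s) = 0.
Proof.
move=> K0; have d1 := is1_b (geodesic_derivable s) (geodesic_derivable s).
have e : (fun t => b ((emb K \o c) t) ((emb K \o c) t)) = (fun _ => K^-1).
  by apply/funext => t; exact: emb_quadric.
move: d1; rewrite e => /is1_derive1; rewrite (is1_derive1 (is1_cst _ _)).
by rewrite bC /velocity /=; lra.
Qed.

(** The acceleration is normal to the surface, hence a multiple of the position vector.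
    Differentiating b(c, c') = 0 gives b(c, c'') = - b(c', c') = 1, and b(c, c) = 1 / K makes the
    factor equal to K. For K = 0 every vector is tangent, and the acceleration vanishes. *)
Lemma geodesic_equation s : derive1 (velocity K c) s = K *: emb K (c s).
Proof.
case: (hc) => cc dc dv nv av; apply/eqP; rewrite -subr_eq0; apply/eqP.
apply: b_nondegenerate => w; have [K0|K0] := eqVneq K 0.
  rewrite [X in X *: _]K0 scale0r subr0; apply: av => /=.
  by move=> K1; case/negP: K1; apply/eqP.
have t0 := geodesic_tangent s K0; have n0 := emb_norm (c s) K0.
have a1 : b (emb K (c s)) (derive1 (velocity K c) s) = 1.
  have d1 := is1_b (dc s) (dv s).
  have e : (fun t => b ((emb K \o c) t) (velocity K c t)) = (fun _ => 0).
    by apply/funext => t; exact: geodesic_tangent.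
  move: d1; rewrite e => /is1_derive1; rewrite (is1_derive1 (is1_cst _ _)).
  by rewrite -/(velocity K c s) nv /=; lra.
have ht : tangent (c s) (w - (K * b w (emb K (c s))) *: emb K (c s)).
  move=> _; rewrite bDr bNr bZr (bC w) mulrAC n0 mul1r; ring.
have := av s _ ht.
rewrite bDr bNr bZr (bC (derive1 (velocity K c) s) (emb K (c s))) a1 mulr1 => e.
by rewrite bDl bNl bZl (bC (emb K (c s)) w); lra.
Qed.

(** Each coordinate solves x'' = K x, so its Wronskians with [sn] and [cs] are constant; [cs_sn]
    solves the two resulting equations for x. *)
Lemma geodesicE s : emb K (c s) = cs K s *: emb K (c 0) + sn K s *: velocity K c 0.
Proof.
case: (hc) => cc dc dv nv av.
apply: crd_eq => i _; rewrite crdD !crdZ.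
pose x t := crd (emb K (c t)) i; pose y t := crd (velocity K c t) i.
have dx t : is_derive t (1 : R) x (y t) by exact: (is1_crd i (dc t)).
have dy t : is_derive t (1 : R) y (K * x t).
  by have := is1_crd i (dv t); rewrite geodesic_equation crdZ.
have c1 t : is_derive t (1 : R) (fun t => cs K t * x t - sn K t * y t) 0.
  have h1 := dx t; have h2 := dy t; have h3 := is1_cs K t; have h4 := is1_sn K t.
  by dvE; ring.
have c2 t : is_derive t (1 : R) (fun t => cs K t * y t - K * (sn K t * x t)) 0.
  have h1 := dx t; have h2 := dy t; have h3 := is1_cs K t; have h4 := is1_sn K t.
  by dvE; ring.
have e1 := is_derive_0_is_cst s 0 c1.
have e2 := is_derive_0_is_cst s 0 c2.
rewrite -/(x s) -/(x 0) -/(y 0).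
have -> : x s = (cs K s ^+ 2 - K * sn K s ^+ 2) * x s by rewrite cs_sn mul1r.
move: e1 e2; rewrite /= cs0 sn0 !mul1r !mul0r mulr0 !subr0 => <- <-; ring.
Qed.

End Geodesic.

Lemma hinge_algebra (x u v : 'rV[R]_N) s t : (K != 0 -> K * b x x = 1) ->
  (K != 0 -> b x u = 0) -> (K != 0 -> b x v = 0) -> b u u = -1 -> b v v = -1 ->
  - b (cs K s *: x + sn K s *: u - (cs K t *: x + sn K t *: v))
      (cs K s *: x + sn K s *: u - (cs K t *: x + sn K t *: v)) / 2 =
  ph K s + ph K t + K * ph K s * ph K t + sn K s * sn K t * b u v.
Proof.
move=> n0 t1 t2 n1 n2.
have q1 := sn2E K s; have q2 := sn2E K t.
rewrite !(bDl, bNl, bZl) !(bDr, bNr, bZr) (bC u x) (bC v x) (bC v u) n1 n2.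
transitivity ((sn K s ^+ 2 + sn K t ^+ 2 - (cs K s - cs K t) ^+ 2 * b x x) / 2
  + sn K s * sn K t * b u v - (cs K s - cs K t) *
     (sn K s * b x u - sn K t * b x v)); first by field.
rewrite q1 q2 !csE.
have [K0|K0] := eqVneq K 0.
  have -> : 1 + K * ph K s - (1 + K * ph K t) = 0.
    by rewrite [X in 1 + X * _ - _]K0 [X in _ - (1 + X * _)]K0 !mul0r subrr.
  rewrite expr0n /= !mul0r !subr0 -[K * ph K s * _]mulrA.
  by rewrite [X in 2 + X * _]K0 [X in _ + _ * (2 + X * _)]K0 [X in _ + X * _ + _]K0; field.
rewrite t1 // t2 //.
have -> : (1 + K * ph K s - (1 + K * ph K t)) ^+ 2 * b x x =
   K * (ph K s - ph K t) ^+ 2 * (K * b x x) by ring.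
by rewrite n0 //; field.
Qed.

Lemma hinge c1 c2 s t : timelike_geodesic K c1 -> timelike_geodesic K c2 ->
  c1 0 = c2 0 -> world K (c1 s) (c2 t) =
  ph K s + ph K t + K * ph K s * ph K t +
  sn K s * sn K t * b (velocity K c1 0) (velocity K c2 0).
Proof.
move=> h1 h2 e; rewrite /world (geodesicE h1 s) (geodesicE h2 t) -e.
apply: hinge_algebra; [exact: emb_norm|exact: geodesic_tangent| | | ].
- by rewrite e; exact: geodesic_tangent.
- by case: h1.
- by case: h2.
Qed.

Definition affine (e : bool) (a t : R) : R := if e then a - t else a + t.

Lemma geodesic_affine c (e : bool) a : timelike_geodesic K c ->
  timelike_geodesic K (fun t => c (affine e a t)) /\
  forall t, velocity K (fun t => c (affine e a t)) t =
     (if e then -1 else 1) *: velocity K c (affine e a t).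
Proof.
case=> cc dc dvl nv av; set sg : R := if e then -1 else 1.
have da t : is_derive t (1 : R) (affine e a) sg.
  by rewrite /affine /sg; case: e {sg}; dvE; ring.
have comp (F : R -> 'rV[R]_N) t : derivable F (affine e a t) 1 ->
    derivable (fun t => F (affine e a t)) t 1 /\
    derive1 (fun t => F (affine e a t)) t = sg *: derive1 F (affine e a t).
  move=> dF; have [|d1 d2] := @derivable_crd R N (fun t => F (affine e a t)) t
      (fun i => crd (sg *: derive1 F (affine e a t)) i).
    move=> i _; have := is1_crd i dF => h; have hd := da t.
    have := is1_comp (f := fun t => crd (F t) i) (g := affine e a) h hd.
    by rewrite crdZ mulrC.
  by split=> //; apply: crd_eq.
have V t : velocity K (fun t => c (affine e a t)) t = sg *: velocity K c (affine e a t).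
  by have [] := comp (emb K \o c) t (dc _).
have VE : velocity K (fun t => c (affine e a t)) =
    fun t => sg *: velocity K c (affine e a t) by apply/funext.
have sg2 : sg * sg = 1 by rewrite /sg; case: (e); ring.
have dV t : derivable (fun t => sg *: velocity K c (affine e a t)) t 1 /\
   derive1 (fun t => sg *: velocity K c (affine e a t)) t =
   derive1 (velocity K c) (affine e a t).
  have [d1 d2] := comp (velocity K c) t (dvl _).
  have [|d3 d4] := @derivable_crd R N (fun t => sg *: velocity K c (affine e a t)) t
      (fun i => crd (derive1 (velocity K c) (affine e a t)) i).
    move=> i _; have := is1_crd i d1; rewrite d2 crdZ => h.
    rewrite (_ : (fun t => _) = (fun t => sg * crd (velocity K c (affine e a t)) i)).
      by dvE; rewrite ?mulr0 ?addr0 mulrA sg2 mul1r.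
    by apply/funext => x; rewrite crdZ.
  by split=> //; apply: crd_eq.
split; [split|exact: V].
- move=> t; apply: (@continuous_comp _ _ _ (affine e a) c); last exact: cc.
  exact: (is1_continuous (da t)).
- by move=> t; have [] := comp (emb K \o c) t (dc _).
- by move=> t; rewrite VE; have [] := dV t.
- by move=> t; rewrite V bZl bZr nv mulrA sg2 mul1r.
- by move=> t w ht; rewrite VE; have [_ ->] := dV t; exact: av.
Qed.

End GeodesicEquation.

(** * Regularity of geodesics in the chart *)

Section ChartDerivatives.
Variable R : realType.
Implicit Types (f h C S : R -> R) (s t x y : R).

Definition arsinh y : R := ln (y + Num.sqrt (y ^+ 2 + 1)).

Lemma sinhK : cancel (@sinh R) arsinh.
Proof.
move=> x; rewrite /arsinh addrC [_ ^+ 2 + 1]addrC one_sinh2 sqrtr_sqr.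
rewrite gtr0_norm ?cosh_gt0 // -[RHS]expRK; congr ln.
by rewrite /cosh /sinh; field.
Qed.

Lemma arsinh_arg_gt0 y : 0 < y + Num.sqrt (y ^+ 2 + 1).
Proof.
have : `|y| < Num.sqrt (y ^+ 2 + 1).
  by rewrite -sqrtr_sqr ltr_sqrt; have := sqr_ge0 y; lra.
by rewrite ltr_norml => /andP[h _]; lra.
Qed.

Lemma arsinhK : cancel arsinh (@sinh R).
Proof.
move=> y; rewrite /arsinh /sinh expRN lnK ?posrE ?arsinh_arg_gt0 //.
have h := arsinh_arg_gt0 y.
have sq : Num.sqrt (y ^+ 2 + 1) ^+ 2 = y ^+ 2 + 1.
  by rewrite sqr_sqrtr; have := sqr_ge0 y; lra.
move: h sq; set q := Num.sqrt _ => h sq.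
apply: (@mulIf _ (2 * (y + q))); first by rewrite mulf_neq0 ?gt_eqF.
transitivity ((y + q) ^+ 2 - 1); first by field; rewrite gt_eqF.
by rewrite sqrrD sq; ring.
Qed.

Lemma is1_arsinh y : is_derive y (1 : R) arsinh (Num.sqrt (y ^+ 2 + 1))^-1.
Proof.
have p0 : 0 < y ^+ 2 + 1 by have := sqr_ge0 y; lra.
have h := arsinh_arg_gt0 y; have q0 : 0 < Num.sqrt (y ^+ 2 + 1) by rewrite sqrtr_gt0.
by rewrite /arsinh; dvE => //; field; rewrite !gt_eqF.
Qed.

Lemma is1_from_sinh h s d : is_derive s (1 : R) (fun t => sinh (h t)) d ->
  is_derive s (1 : R) h (d / cosh (h s)).
Proof.
move=> dh; have := is1_comp (g := fun t => sinh (h t)) (is1_arsinh _) dh.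
have -> : (fun t => arsinh (sinh (h t))) = h by apply/funext => t; exact: sinhK.
by rewrite [_ ^+ 2 + 1]addrC one_sinh2 sqrtr_sqr gtr0_norm ?cosh_gt0 // mulrC.
Qed.

(** Only continuity of [th] is known. It keeps [th t - th s] within (- pi / 2, pi / 2) for [t] near
    [s], where the difference is the arctangent of a quotient of expressions in [C] and [S], which
    can be differentiated. *)
Lemma is1_angle th C S s dC dS : {for s, continuous th} ->
  (forall t, cos (th t) = C t) -> (forall t, sin (th t) = S t) ->
  is_derive s (1 : R) C dC -> is_derive s (1 : R) S dS ->
  is_derive s (1 : R) th (dS * C s - dC * S s).
Proof.
move=> ct EC ES hC hS; set c0 := C s; set s0 := S s.
pose G t := (S t * c0 - C t * s0) / (C t * c0 + S t * s0).
have n1 : c0 * c0 + s0 * s0 = 1 by rewrite /c0 /s0 -EC -ES -!expr2 cos2Dsin2.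
have e0 : S s * c0 - C s * s0 = 0 by rewrite /c0 /s0; ring.
have dG : is_derive s (1 : R) G (dS * c0 - dC * s0).
  rewrite /G; dvE; rewrite n1 ?oner_neq0 //.
  by rewrite e0 mul0r add0r invr1 mul1r; ring.
have G0 : G s = 0 by rewrite /G e0 mul0r.
have dF : is_derive s (1 : R) (fun t => th s + atan (G t)) (dS * c0 - dC * s0).
  by dvE; rewrite G0 expr0n /= addr0 invr1; ring.
have p2 : 0 < pi / 2 :> R by rewrite divr_gt0 // pi_gt0.
apply: near_eq_is_derive dF.
have /cvgrPdist_lt /(_ _ p2) := ct; apply: filterS => t; rewrite ltr_distlC.
move=> /andP[h1 h2].
have -> : G t = tan (th t - th s).
  rewrite /G /tan sinB cosB /c0 /s0 -!EC -!ES; congr (_ / _); ring.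
rewrite tanK; first by ring.
by rewrite in_itv /=; apply/andP; split; lra.
Qed.

(** For K nonzero the embedding is a polar decomposition with hyperbolic coordinate [h] and angle
    [th]. A geodesic is required to be continuous in the chart but differentiable only after
    embedding; the derivatives of its chart coordinates are recovered here. *)
Lemma is1_polar th h (kk : R) (xh xc xs yh yc ys : R -> R) :
  (forall t, sinh (h t) = kk * xh t) ->
  (forall t, cosh (h t) * cos (th t) = kk * xc t) ->
  (forall t, cosh (h t) * sin (th t) = kk * xs t) ->
  continuous th ->
  (forall t, is_derive t (1 : R) xh (yh t)) ->
  (forall t, is_derive t (1 : R) xc (yc t)) ->
  (forall t, is_derive t (1 : R) xs (ys t)) ->
  forall t, is_derive t (1 : R) h (kk * yh t / cosh (h t)) /\
    is_derive t (1 : R) th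
      (kk / cosh (h t) * (ys t * cos (th t) - yc t * sin (th t))).
Proof.
move=> Eh Ec Es cth dh dc ds t.
have h1 : is_derive t (1 : R) h (kk * yh t / cosh (h t)).
  apply: is1_from_sinh; rewrite (_ : (fun t => sinh (h t)) = fun t => kk * xh t).
    by have := dh t => ?; dvE; ring.
  by apply/funext.
split=> //.
have c0 u : cosh (h u) != 0 by exact: cosh_neq0.
have EC u : cos (th u) = kk * xc u / cosh (h u) by rewrite -Ec; field; rewrite c0.
have ES u : sin (th u) = kk * xs u / cosh (h u) by rewrite -Es; field; rewrite c0.
have d1 : is_derive t (1 : R) (fun u => (cosh (h u))^-1)
   (- (cosh (h t)) ^- 2 * (sinh (h t) * (kk * yh t / cosh (h t)))).
  by dvE; [rewrite c0|].
have d2 := dc t; have d3 := ds t.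
set D := - _ * _ in d1.
have gc : is_derive t (1 : R) (fun u => kk * xc u) (kk * yc t) by dvE; ring.
have dC : is_derive t (1 : R) (fun u => kk * xc u / cosh (h u))
   (kk * xc t * D + (cosh (h t))^-1 * (kk * yc t)).
  exact: (is1_mul gc d1).
have gs : is_derive t (1 : R) (fun u => kk * xs u) (kk * ys t) by dvE; ring.
have dS : is_derive t (1 : R) (fun u => kk * xs u / cosh (h u))
   (kk * xs t * D + (cosh (h t))^-1 * (kk * ys t)).
  exact: (is1_mul gs d1).
apply: (is1_eq (is1_angle (cth t) EC ES dC dS)); rewrite -EC -ES -Ec -Es.
by field; rewrite c0.
Qed.

End ChartDerivatives.

Section GeodesicChart.
Variables (R : realType) (K : R).
Local Notation k := (curv_root K).
Implicit Types (c : R -> model R) (s t : R).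

Lemma is1_pair_C1 (f g df dg : R -> R) c :
  (forall t, is_derive t (1 : R) f (df t)) -> (forall t, is_derive t (1 : R) g (dg t)) ->
  continuous df -> continuous dg -> (forall t, c t = (f t, g t)) ->
  (forall t, derivable c t 1) /\ continuous (derive1 c).
Proof.
move=> hf hg cf cg ec.
have -> : c = fun t => (f t, g t) by apply/funext.
split=> [t|]; first by have [] := is1_pair (hf t) (hg t).
have -> : derive1 (fun t => (f t, g t)) = fun t => (df t, dg t).
  by apply/funext => t; have [] := is1_pair (hf t) (hg t).
by move=> t; exact: (cvg_pair (cf t) (cg t)).
Qed.

Lemma geodesic_C1 c : timelike_geodesic K c ->
  (forall t, derivable c t 1) /\ continuous (derive1 c).
Proof.
move=> hc; case: (hc) => cc dc dvl _ _.
pose x i t := crd (emb K (c t)) i; pose y i t := crd (velocity K c t) i.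
have dx i t : is_derive t (1 : R) (x i) (y i t) by exact: (is1_crd i (dc t)).
have cy i : continuous (y i).
  by move=> t; exact: (is1_continuous (is1_crd i (dvl t))).
have ec t : c t = ((c t).1, (c t).2) by case: (c t).
have c1 : continuous (fun t => (c t).1) by move=> t; exact: (ct_fst (cc t)).
have c2 : continuous (fun t => (c t).2) by move=> t; exact: (ct_snd (cc t)).
have xE i t : x i t = nth 0 (emb_coords K (c t)) i by exact: crd_emb.
have P h th ih ic is_ : continuous th -> 
  (forall t, sinh (h t) = k * x ih t) ->
  (forall t, cosh (h t) * cos (th t) = k * x ic t) ->
  (forall t, cosh (h t) * sin (th t) = k * x is_ t) ->
  exists dh dth, [/\ forall t, is_derive t (1 : R) h (dh t),
     forall t, is_derive t (1 : R) th (dth t), continuous dh & continuous dth].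
  move=> cth Eh Ec Es.
  have D := is1_polar Eh Ec Es cth (dx ih) (dx ic) (dx is_).
  exists (fun t => k * y ih t / cosh (h t)).
  exists (fun t => k / cosh (h t) * (y is_ t * cos (th t) - y ic t * sin (th t))).
  have ch t : {for t, continuous h} by exact: (is1_continuous (D t).1).
  split=> [t|t|t|t]; first exact: (D t).1.
  - exact: (D t).2.
  - have h1 := ch t; have h2 := cy ih t.
    rewrite -[continuous_at _ _]/{for t, continuous _}; cv.
    by rewrite cosh_neq0.
  - have h1 := ch t; have h2 := cy is_ t; have h3 := cy ic t; have h4 := cth t.
    rewrite -[continuous_at _ _]/{for t, continuous _}; cv.
    by rewrite cosh_neq0.
case: (curvP K) xE => [K0 k0 KE|K0 k0 KE|K0] xE.
- have [|t|t|t|dh [dth [h1 h2 h3 h4]]] := P (fun t => (c t).1) (fun t => (c t).2) 0%N 1%N 2%N.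
  + exact: c2.
  + by rewrite xE ec /emb_coords K0 radiusE /=; field; rewrite gt_eqF.
  + by rewrite xE ec /emb_coords K0 radiusE /=; field; rewrite gt_eqF.
  + by rewrite xE ec /emb_coords K0 radiusE /=; field; rewrite gt_eqF.
  exact: (is1_pair_C1 h1 h2).
- have K00 : (0 < K) = false by apply/negbTE; rewrite -leNgt ltW.
  have [|t|t|t|dh [dth [h1 h2 h3 h4]]] := P (fun t => (c t).2) (fun t => (c t).1) 2%N 0%N 1%N.
  + exact: c1.
  + by rewrite xE ec /emb_coords K00 K0 radiusE /=; field; rewrite gt_eqF.
  + by rewrite xE ec /emb_coords K00 K0 radiusE /=; field; rewrite gt_eqF.
  + by rewrite xE ec /emb_coords K00 K0 radiusE /=; field; rewrite gt_eqF.
  exact: (is1_pair_C1 h2 h1).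
- have e1 t : (c t).1 = x 0%N t by rewrite xE ec /emb_coords K0 ltxx.
  have e2 t : (c t).2 = x 1%N t by rewrite xE ec /emb_coords K0 ltxx.
  apply: (is1_pair_C1 (dx 0%N) (dx 1%N)) => // t.
  by rewrite ec e1 e2.
Qed.

Definition future_geodesic c :=
  timelike_geodesic K c /\ forall t, 0 < (derive1 c t).1.

(** If the first component of the chart velocity vanished, the two null components would be opposite
    and the squared norm nonnegative, contrary to the value -1. Being continuous, this component has
    a constant sign. *)
Lemma geodesic_direction c : timelike_geodesic K c ->
  future_geodesic c \/ future_geodesic (fun t => c (affine true 0 t)).
Proof.
move=> hc; have [dc cc] := geodesic_C1 hc.
have n0 t : (derive1 c t).1 != 0.
  apply/eqP => e; have := velocity_norm K (dc t).
  case: hc => _ _ _ -> _; rewrite /dna /dnb.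
  have -> : dct K (c t) (derive1 c t) = 0 by rewrite /dct e mul0r; case: ifP.
  set v := dcx _ _ _; set m := cf _ _; have := sqr_ge0 (m * v); nra.
have c1 : continuous (fun t => (derive1 c t).1) by move=> t; exact: (ct_fst (cc t)).
have sgn s t : 0 < (derive1 c s).1 -> 0 < (derive1 c t).1.
  move=> h1; rewrite ltNge; apply/negP => h2.
  have [st|ts] := leP s t.
    have [|||u _ /eqP] := @IVT_le R (fun t => - (derive1 c t).1) s t 0 st.
    - by move=> u _; apply: ct_opp; exact: c1.
    - by rewrite oppr_le0 ltW.
    - by rewrite oppr_ge0.
    by rewrite oppr_eq0 (negbTE (n0 u)).
  have [|||u _ /eqP] := @IVT_le R (fun t => (derive1 c t).1) t s 0 (ltW ts).
  - by move=> u _; exact: c1.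
  - exact: h2.
  - exact: ltW.
  by rewrite (negbTE (n0 u)).
have [h0|h0] := ltP 0 (derive1 c 0).1; first by left; split; [exact: hc|move=> t; exact: sgn h0].
right; split; first by have [] := geodesic_affine true 0 hc.
move=> t.
have neg u : (derive1 c u).1 < 0.
  rewrite lt_neqAle n0 leNgt; apply/negP => /(sgn _ 0); rewrite ltNge => /negP; exact.
have da : is_derive t (1 : R) (affine true 0) (-1).
  by rewrite /affine; dvE; ring.
have d1 := is1_comp (f := fun t => (c t).1) (g := affine true 0) (is1_fst (dc _)) da.
have [dr _] := geodesic_C1 (geodesic_affine true 0 hc).1.
have d2 := is1_fst (dr t).
rewrite -(is1_derive1 d2) (is1_derive1 d1) mulrN1 oppr_gt0; exact: neg.
Qed.

Section Future.
Variable c : R -> model R.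
Hypothesis hc : future_geodesic c.

Lemma future_C1 r s : r < s -> C1_future_causal K c r s.
Proof.
move=> rs; have [dc cc] := geodesic_C1 hc.1.
split; [exact: rs|exact: dc|exact: cc|move=> t _].
by split; [exact: hc.2|case: hc.1 => _ _ _ -> _; lra].
Qed.

Lemma future_path r s : r < s -> causal_path K (c r) (c s) (s - r).
Proof.
move=> rs; suff <- : lorentzian_length K c r s = s - r.
  exact/CausalC1/future_C1.
rewrite /lorentzian_length.
have -> : (fun t => Num.sqrt (- b (velocity K c t) (velocity K c t))) = (fun _ => 1).
  by apply/funext => t; case: hc.1 => _ _ _ -> _; rewrite opprK sqrtr1.
rewrite (@Rint_FTC R (fun _ => 1) (fun t => t)) //.
  by move=> t; exact: cvg_cst.
Qed.

Lemma future_caus r s : r <= s -> model_caus K (c r) (c s).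
Proof.
rewrite le_eqVlt => /predU1P[->|rs]; [by left|right].
by exists (s - r); exact: future_path.
Qed.

End Future.

Lemma world_geodesic c s t : timelike_geodesic K c ->
  world K (c s) (c t) = ph K (t - s).
Proof.
move=> hc; have nv : b (velocity K c s) (velocity K c s) = -1 by case: hc.
have [h1 h2] := geodesic_affine false s hc.
have := @hinge R K (fun t => c (affine false s t)) (fun t => c (affine false s t))
   0 (t - s) h1 h1 erefl.
rewrite /affine addr0 (addrC s) subrK => ->.
by rewrite ph0 sn0 mulr0 !mul0r !(add0r, addr0).
Qed.

(** Along the geodesic 2 + K [world] is positive by [ph_room], so neither cosine of [room_cos]
    vanishes. Their arguments start in (- pi / 2, pi / 2) and by continuity cannot leave it. *)
Lemma geodesic_rng c l : timelike_geodesic K c -> 0 <= l -> below_diameter K l ->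
  rng K (c 0) (c l).
Proof.
move=> hc l0 lD K0; have [dc cc] := geodesic_C1 hc.
set p := c 0.
have hp s : 0 <= s <= l -> cos (nb K (c s) + sna K p) != 0 /\ cos (nb K p + sna K (c s)) != 0.
  move=> /andP[s0 sl].
  have : 0 < 2 + K * world K p (c s).
    rewrite world_geodesic // subr0; apply: ph_room => //.
    exact: below_diameter_le lD.
  rewrite room_cos //; case: (eqVneq (cos (nb K (c s) + sna K p)) 0) => [->|_].
    by rewrite mul0r mulr0 ltxx.
  by case: eqVneq => [->|_] //; rewrite !mulr0 ltxx.
have stay (f : R -> R) : (forall s, {for s, continuous f}) -> `|f 0| < pi / 2 ->
    (forall s, 0 <= s <= l -> cos (f s) != 0) -> `|f l| < pi / 2.
  move=> cf; rewrite ltr_norml => /andP[g1 g2] nz; rewrite ltNge; apply/negP.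
  rewrite ler_normr => /orP[] g3.
    have [|||s hs e] := @IVT_le R f 0 l (pi / 2) l0 => //; first exact: ltW.
    by have := nz s hs; rewrite e cos_pihalf eqxx.
  have [|||s hs e] := @IVT_le R (fun s => - f s) 0 l (pi / 2) l0 => //; try lra.
    by move=> s _; exact: ct_opp.
  by have := nz s hs; rewrite -cosN e cos_pihalf eqxx.
have ca s : {for s, continuous (fun t => na K (c t))} by exact: (is1_continuous (is1_na K (dc s))).
have cb s : {for s, continuous (fun t => nb K (c t))} by exact: (is1_continuous (is1_nb K (dc s))).
have cs' s : {for s, continuous (fun t => sna K (c t))}.
  by have := ca s; rewrite /sna; case: (K < 0) => // ?; cv.
split.
- apply: (stay (fun s => nb K (c s) + sna K p)).
  + by move=> s; have := cb s => ?; cv.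
  + by rewrite -/p -/(eta K p) eta_lt.
  + by move=> s /hp[].
- apply: (stay (fun s => nb K p + sna K (c s))).
  + by move=> s; have := cs' s => ?; cv.
  + by rewrite -/p -/(eta K p) eta_lt.
  + by move=> s /hp[].
Qed.

End GeodesicChart.

(** * Lifting curves to the universal cover; connecting geodesics *)

Section AngleLift.
Variable R : realType.

(** The angle is the integral of (A B' - B A') / (A^2 + B^2). The squared sine [E] of the error has
    zero derivative and starts at 0; the radial component [C] is then [r] up to sign, and the sign
    persists by continuity. *)
Lemma angle_lift (A B dA dB r : R -> R) (phi : R) :
  (forall t, is_derive t (1 : R) A (dA t)) -> (forall t, is_derive t (1 : R) B (dB t)) ->
  continuous dA -> continuous dB -> (forall t, 0 < r t) ->
  (forall t, A t ^+ 2 + B t ^+ 2 = r t ^+ 2) ->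
  A 0 = r 0 * cos phi -> B 0 = r 0 * sin phi ->
  exists th : R -> R, [/\ continuous th, th 0 = phi,
    forall t, A t = r t * cos (th t) & forall t, B t = r t * sin (th t)].
Proof.
move=> hA hB cA cB r0 hr A0 B0.
have q0 t : A t ^+ 2 + B t ^+ 2 != 0 by rewrite hr expf_neq0 // gt_eqF.
pose f t := (A t * dB t - B t * dA t) / (A t ^+ 2 + B t ^+ 2).
have cf : continuous f.
  move=> t; have h1 := is1_continuous (hA t); have h2 := is1_continuous (hB t).
  have h3 := cA t; have h4 := cB t.
  by rewrite -[continuous_at _ _]/{for t, continuous _} /f; cv.
have [F dF] := antiderivative cf.
pose th t := F t - F 0 + phi.
have dth t : is_derive t (1 : R) th (f t).
  by have h := dF t; rewrite /th; dvE; ring.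
have th0 : th 0 = phi by rewrite /th; ring.
pose E t := (B t * cos (th t) - A t * sin (th t)) ^+ 2 / (A t ^+ 2 + B t ^+ 2).
have dE t : is_derive t (1 : R) E 0.
  have h1 := hA t; have h2 := hB t; have h3 := dth t.
  rewrite /E; dvE => //; rewrite /f; have := q0 t.
  move: (A t) (B t) (dA t) (dB t) (cos (th t)) (sin (th t)) => a b0 a' b' x y n0.
  by rewrite /=; field.
have E0 t : B t * cos (th t) - A t * sin (th t) = 0.
  have e0 : E 0 = 0 by rewrite /E A0 B0 th0; ring.
  have := is_derive_0_is_cst t 0 dE; rewrite e0 => /eqP.
  by rewrite mulf_eq0 invr_eq0 (negbTE (q0 t)) orbF sqrf_eq0 => /eqP.
pose C t := A t * cos (th t) + B t * sin (th t).
have C2 t : C t ^+ 2 = r t ^+ 2.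
  rewrite -hr -[RHS]mulr1 -(cos2Dsin2 (th t)) -[RHS]subr0.
  by rewrite -[X in _ - X](expr0n R 2) -{1}(E0 t) /C; ring.
have cC t : {for t, continuous C}.
  have h1 := is1_continuous (hA t); have h2 := is1_continuous (hB t).
  have h3 := is1_continuous (dth t).
  by rewrite /C; cv.
have C0 : 0 < C 0.
  rewrite /C A0 B0 th0 -!mulrA -mulrDr -!expr2 cos2Dsin2 mulr1; exact: r0.
have Cn t : C t != 0 by rewrite -sqrf_eq0 C2 sqrf_eq0 gt_eqF.
have Cp t : 0 < C t.
  rewrite ltNge; apply/negP => h.
  have [t0|t0] := leP 0 t.
    have [|||u _ e] := @IVT_le R (fun t => - C t) 0 t 0 t0.
    - by move=> u _; apply: ct_opp; exact: cC.
    - by rewrite oppr_le0 ltW.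
    - by rewrite oppr_ge0.
    by have := Cn u; rewrite -oppr_eq0 e eqxx.
  have [|||u _ e] := @IVT_le R C t 0 0 (ltW t0).
  - by move=> u _; exact: cC.
  - exact: h.
  - exact: ltW.
  by have := Cn u; rewrite e eqxx.
have CE t : C t = r t.
  apply/eqP; rewrite -(@eqrXn2 _ 2) ?C2 //; first exact: ltW.
  exact: ltW (r0 t).
exists th; split=> // [t|t|t].
- exact: (is1_continuous (dth t)).
- rewrite -CE /C; have e := E0 t; have n1 := cos2Dsin2 (th t).
  transitivity (A t * (cos (th t) ^+ 2 + sin (th t) ^+ 2) +
     sin (th t) * (B t * cos (th t) - A t * sin (th t))); first by rewrite n1 e; ring.
  by ring.
- rewrite -CE /C; have e := E0 t; have n1 := cos2Dsin2 (th t).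
  transitivity (B t * (cos (th t) ^+ 2 + sin (th t) ^+ 2) -
     cos (th t) * (B t * cos (th t) - A t * sin (th t))); first by rewrite n1 e; ring.
  by ring.
Qed.

End AngleLift.

Section GeodesicExistence.
Variables (R : realType) (K : R).
Local Notation k := (curv_root K).
Local Notation N := (model_dim K).
Implicit Types (p q : model R) (c : R -> model R) (s t l : R).

Section Ray.
Variables (p : model R) (V : 'rV[R]_N).
Hypotheses (tV : tangent p V) (nV : b V V = -1).

Definition ambient_geodesic s : 'rV[R]_N := cs K s *: emb K p + sn K s *: V.
Definition ambient_velocity s : 'rV[R]_N := (K * sn K s) *: emb K p + cs K s *: V.

Lemma is1_ambient_geodesic i s : is_derive s (1 : R) (fun t => crd (ambient_geodesic t) i) (crd (ambient_velocity s) i).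
Proof.
rewrite (_ : (fun t => _) = fun t => cs K t * crd (emb K p) i + sn K t * crd V i).
  by rewrite /ambient_velocity crdD !crdZ; dvE; ring.
by apply/funext => t; rewrite /ambient_geodesic crdD !crdZ.
Qed.

Lemma is1_ambient_velocity i s : is_derive s (1 : R) (fun t => crd (ambient_velocity t) i) (K * crd (ambient_geodesic s) i).
Proof.
rewrite (_ : (fun t => _) = fun t => K * sn K t * crd (emb K p) i + cs K t * crd V i).
  by rewrite /ambient_geodesic crdD !crdZ; dvE; ring.
by apply/funext => t; rewrite /ambient_velocity crdD !crdZ.
Qed.

Lemma lift_geodesic c : continuous c -> (forall s, emb K (c s) = ambient_geodesic s) ->
  timelike_geodesic K c /\ velocity K c 0 = V.
Proof.
move=> cc ec.
have e1 : emb K \o c = ambient_geodesic by apply/funext.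
have D s : derivable ambient_geodesic s 1 /\ derive1 ambient_geodesic s = ambient_velocity s.
  have [d1 d2] := @derivable_crd R N ambient_geodesic s (fun i => crd (ambient_velocity s) i)
    (fun i _ => is1_ambient_geodesic i s).
  by split; [exact: d1|exact: crd_eq].
have ve : velocity K c = ambient_velocity by rewrite /velocity e1; apply/funext => s; exact: (D s).2.
have D2 s : derivable ambient_velocity s 1 /\ derive1 ambient_velocity s = K *: ambient_geodesic s.
  have [|d1 d2] := @derivable_crd R N ambient_velocity s (fun i => crd (K *: ambient_geodesic s) i).
    by move=> i _; rewrite crdZ; exact: is1_ambient_velocity.
  by split; [exact: d1|exact: crd_eq].
split; last by rewrite ve /ambient_velocity sn0 cs0 mulr0 scale0r scale1r add0r.
split; first exact: cc.
- by move=> s; rewrite e1; exact: (D s).1.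
- by move=> s; rewrite ve; exact: (D2 s).1.
- move=> s; rewrite ve /ambient_velocity bDl !bDr !bZl !bZr nV (bC V (emb K p)).
  have [K0|K0] := eqVneq K 0.
    have c1 : cs K s = 1 by rewrite csE [X in _ + X * _]K0 mul0r addr0.
    have -> : K * sn K s = 0 by rewrite [X in X * _]K0 mul0r.
    by rewrite c1; ring.
  rewrite (tV K0); have := emb_norm p K0; have := cs_sn K s.
  move: (b (emb K p) (emb K p)) => x e e'.
  transitivity (K * sn K s ^+ 2 * (K * x) - cs K s ^+ 2); first by ring.
  by rewrite e'; lra.
- move=> s w tw; rewrite ve (D2 s).2 bZl -ec.
  have [K0|K0] := eqVneq K 0; first by rewrite [X in X * _]K0 mul0r.
  by rewrite (tw K0) mulr0.
Qed.

Lemma ambient_geodesic_quadric s : K != 0 -> K * b (ambient_geodesic s) (ambient_geodesic s) = 1.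
Proof.
move=> K0; rewrite /ambient_geodesic bDl !bDr !bZl !bZr nV (bC V (emb K p)) (tV K0).
have := emb_norm p K0; have := cs_sn K s.
move: (b (emb K p) (emb K p)) => x e e'.
transitivity (cs K s ^+ 2 * (K * x) - K * sn K s ^+ 2); first by ring.
by rewrite e'; lra.
Qed.

Lemma ambient_geodesic0 : ambient_geodesic 0 = emb K p.
Proof. by rewrite /ambient_geodesic cs0 sn0 scale1r scale0r addr0. Qed.

(** For K nonzero the hyperbolic coordinate is found by [arsinh] and the angle by [angle_lift],
    started at the given point of the cover. *)
Lemma ambient_geodesic_lift : exists c, [/\ continuous c, c 0 = p & forall s, emb K (c s) = ambient_geodesic s].
Proof.
have cr i s : {for s, continuous (fun t => crd (ambient_geodesic t) i)}.
  exact: (is1_continuous (is1_ambient_geodesic i s)).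
have cdr i : continuous (fun t => crd (ambient_velocity t) i).
  by move=> s; exact: (is1_continuous (is1_ambient_velocity i s)).
have pE : p = (p.1, p.2) by case: p.
have P ih ic is_ (h0 th0 : R) : K != 0 ->
   (forall s, (k * crd (ambient_geodesic s) ic) ^+ 2 + (k * crd (ambient_geodesic s) is_) ^+ 2 =
              1 + (k * crd (ambient_geodesic s) ih) ^+ 2) ->
   k * crd (ambient_geodesic 0) ih = sinh h0 -> k * crd (ambient_geodesic 0) ic = cosh h0 * cos th0 ->
   k * crd (ambient_geodesic 0) is_ = cosh h0 * sin th0 ->
   exists h th : R -> R, [/\ continuous h, continuous th, h 0 = h0, th 0 = th0 &
     forall s, [/\ sinh (h s) = k * crd (ambient_geodesic s) ih,
       cosh (h s) * cos (th s) = k * crd (ambient_geodesic s) ic &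
       cosh (h s) * sin (th s) = k * crd (ambient_geodesic s) is_]].
  move=> K0 q eh ec es.
  pose h s := arsinh (k * crd (ambient_geodesic s) ih).
  have hh : continuous h.
    move=> s; rewrite -[continuous_at _ _]/{for s, continuous _}.
    apply: (@ct_comp R (@arsinh R) (fun s => k * crd (ambient_geodesic s) ih)).
      exact: (is1_continuous (is1_arsinh _)).
    by have := cr ih s => ?; cv.
  have h00 : h 0 = h0 by rewrite /h eh sinhK.
  have sh s : sinh (h s) = k * crd (ambient_geodesic s) ih by exact: arsinhK.
  have [||||||||th [t1 t2 t3 t4]] := @angle_lift R (fun s => k * crd (ambient_geodesic s) ic)
     (fun s => k * crd (ambient_geodesic s) is_) (fun s => k * crd (ambient_velocity s) ic)
     (fun s => k * crd (ambient_velocity s) is_) (fun s => cosh (h s)) th0.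
  - by move=> t; have := is1_ambient_geodesic ic t => ?; dvE; ring.
  - by move=> t; have := is1_ambient_geodesic is_ t => ?; dvE; ring.
  - by move=> t; have := cdr ic t => ?; rewrite -[continuous_at _ _]/{for t, continuous _}; cv.
  - by move=> t; have := cdr is_ t => ?; rewrite -[continuous_at _ _]/{for t, continuous _}; cv.
  - by move=> t; exact: cosh_gt0.
  - by move=> t; rewrite q -sh one_sinh2.
  - by rewrite ec h00.
  - by rewrite es h00.
  by exists h, th; split=> // s; split.
have Q s : K != 0 -> - (k * crd (ambient_geodesic s) 0) ^+ 2 + sig1 K * (k * crd (ambient_geodesic s) 1) ^+ 2 +
    (k * crd (ambient_geodesic s) 2) ^+ 2 = sig1 K.
  move=> K0; have := ambient_geodesic_quadric s K0; rewrite bE.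
  move: (crd (ambient_geodesic s)) => z; rewrite /sig1; move: K0.
  case: (curvP K) => // [K0 k0 KE|K0 k0 KE] _ e.
  - by rewrite -[X in _ = X]e [X in _ = X * _]KE; ring.
  - by rewrite -[X in _ = - X]e [X in _ = - (X * _)]KE; ring.
have fstsnd (f g : R -> R) : continuous f -> continuous g ->
    continuous (fun s => (f s, g s) : model R).
  by move=> cf cg s; exact: (cvg_pair (cf s) (cg s)).
have e0 i : crd (ambient_geodesic 0) i = nth 0 (emb_coords K p) i by rewrite ambient_geodesic0 crd_emb.
case: (eqVneq K 0) => [K0|K0].
  have V2 i : (2 <= i)%N -> crd V i = 0.
    by move=> hi; apply: crd_out; rewrite model_dim0.
  exists (fun s => (p.1 + s * crd V 0, p.2 + s * crd V 1)); split.
  - by apply: fstsnd => s; rewrite -[continuous_at _ _]/{for s, continuous _}; cv.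
  - by rewrite !mul0r !addr0 -pE.
  - move=> s; apply: crd_eq => i _; rewrite /ambient_geodesic crdD !crdZ !crd_emb pE.
    have [P0 P1] : (0 < K) = false /\ (K < 0) = false by rewrite K0 ltxx.
    rewrite /emb_coords /cs /sn P0 P1 mul1r.
    by case: i => [|[|i]] //=; rewrite V2 // !nth_nil mulr0 addr0.
move: (K0) e0 Q; case: (curvP K) => // [Kp k0 KE|Kp k0 KE] _ e0 Q.
- have [|s|||| h [th [c1 c2 h0 t0 H]]] := P 0%N 1%N 2%N p.1 p.2.
  + by [].
  + by have := Q s isT; rewrite /sig1 ltNge (ltW Kp) /= mul1r; lra.
  + by rewrite e0 pE /emb_coords Kp radiusE /=; field; rewrite gt_eqF.
  + by rewrite e0 pE /emb_coords Kp radiusE /=; field; rewrite gt_eqF.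
  + by rewrite e0 pE /emb_coords Kp radiusE /=; field; rewrite gt_eqF.
  exists (fun s => (h s, th s)); split; [exact: fstsnd|by rewrite h0 t0 -pE|].
  move=> s; have [a1 a2 a3] := H s.
  apply: crd_eq => i hi; rewrite crd_emb /emb_coords Kp radiusE.
  have kn : k != 0 by rewrite gt_eqF.
  have {}hi := leq_trans hi (model_dim_le3 K).
  case: i hi => [|[|[|i]]] //= _; apply: (mulfI kn).
  + by rewrite -a1; field.
  + by rewrite -a2; field.
  + by rewrite -a3; field.
- have Kp' : (0 < K) = false by apply/negbTE; rewrite -leNgt ltW.
  have [|s|||| h [th [c1 c2 h0 t0 H]]] := P 2%N 0%N 1%N p.2 p.1.
  + by [].
  + by have := Q s isT; rewrite /sig1 Kp /= mulN1r; lra.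
  + by rewrite e0 pE /emb_coords Kp' Kp radiusE /=; field; rewrite gt_eqF.
  + by rewrite e0 pE /emb_coords Kp' Kp radiusE /=; field; rewrite gt_eqF.
  + by rewrite e0 pE /emb_coords Kp' Kp radiusE /=; field; rewrite gt_eqF.
  exists (fun s => (th s, h s)); split; [exact: fstsnd|by rewrite h0 t0 -pE|].
  move=> s; have [a1 a2 a3] := H s.
  apply: crd_eq => i hi; rewrite crd_emb /emb_coords Kp' Kp radiusE.
  have kn : k != 0 by rewrite gt_eqF.
  have {}hi := leq_trans hi (model_dim_le3 K).
  case: i hi => [|[|[|i]]] //= _; apply: (mulfI kn).
  + by rewrite -a2; field.
  + by rewrite -a3; field.
  + by rewrite -a1; field.
Qed.

Lemma geodesic_exists : exists c,
  [/\ timelike_geodesic K c, c 0 = p & velocity K c 0 = V].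
Proof.
have [c [cc c0 ec]] := ambient_geodesic_lift.
by have [h1 h2] := lift_geodesic cc ec; exists c.
Qed.

End Ray.

Lemma sin_cos_eq (x y : R) : `|x - y| < 2 * pi -> cos x = cos y -> sin x = sin y ->
  x = y.
Proof.
move=> h ec es.
have c1 : cos (x - y) = 1 by rewrite cosB ec es -!expr2 cos2Dsin2.
have c2 : cos ((x - y) / 2) ^+ 2 = 1.
  have := cos_mulr2n ((x - y) / 2).
  have -> : (x - y) / 2 *+ 2 = x - y by rewrite -mulr_natr divfK ?pnatr_eq0.
  by rewrite c1 mulr2n; lra.
have s2 : sin ((x - y) / 2) = 0.
  by apply/eqP; rewrite -sqrf_eq0 sin2cos2 c2 subrr.
apply/eqP; rewrite -subr_eq0; apply/eqP.
case: (ltrgtP (x - y) 0) => // h0.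
- have : 0 < sin (- ((x - y) / 2)).
    by apply: sin_gt0_pi; move: h; rewrite ltr0_norm // => h; apply/andP; split; lra.
  by rewrite sinN s2 oppr0 ltxx.
- have : 0 < sin ((x - y) / 2).
    by apply: sin_gt0_pi; move: h; rewrite gtr0_norm // => h; apply/andP; split; lra.
  by rewrite s2 ltxx.
Qed.

(** The covering map identifies angles that differ by multiples of 2 pi; two points in the range of
    [p] have angles less than 2 pi apart. *)
Lemma emb_inj p q r : rng K p q -> rng K p r -> emb K q = emb K r -> q = r.
Proof.
move=> h1 h2 e.
have ei i : nth 0 (emb_coords K q) i = nth 0 (emb_coords K r) i by rewrite -!crd_emb e.
have D : K != 0 -> `|nb K q - nb K r| < pi /\ `|na K q - na K r| < pi.
  move=> K0; have [a1 a2] := h1 K0; have [a3 a4] := h2 K0.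
  move: a1 a2 a3 a4; rewrite /sna !ltr_norml.
  by case: ifP => _ a1 a2 a3 a4; split; lra.
have qE : q = (q.1, q.2) by case: q {h1 e ei D}.
have rE : r = (r.1, r.2) by case: r {h2 e ei D}.
move: (ei 0%N) (ei 1%N) (ei 2%N) D; rewrite qE rE /emb_coords radiusE /na /nb /ct /cx.
have inj (a a' : R) : sinh a = sinh a' -> a = a'.
  by move=> /(congr1 (@arsinh R)); rewrite !sinhK.
have split_ (kk C x y : R) : 0 < kk -> 0 < C -> kk^-1 * (C * x) = kk^-1 * (C * y) -> x = y.
  by move=> k0 C0; rewrite !mulrA => /mulfI; apply; rewrite mulf_neq0 ?invr_eq0 ?gt_eqF.
case: (curvP K) => [K0 k0 KE|K0 k0 KE|K0] /=.
- have kn : k^-1 != 0 by rewrite invr_eq0 gt_eqF.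
  move=> /(mulfI kn) /inj -> e1 e2 [] //; rewrite !ltr_norml => d1 d2.
  congr (_, _); apply: sin_cos_eq.
  + by rewrite ltr_norml; lra.
  + exact: split_ k0 (cosh_gt0 _) e1.
  + exact: split_ k0 (cosh_gt0 _) e2.
- have kn : k^-1 != 0 by rewrite invr_eq0 gt_eqF.
  move=> e1 e2 /(mulfI kn) /inj e3; move: e1 e2; rewrite e3 => e1 e2 [] //.
  rewrite !ltr_norml => d1 d2.
  congr (_, _); apply: sin_cos_eq.
  + by rewrite ltr_norml; lra.
  + exact: split_ k0 (cosh_gt0 _) e1.
  + exact: split_ k0 (cosh_gt0 _) e2.
- by move=> -> ->.
Qed.

(** The formula q = cs l p + sn l V of [geodesicE] is solved for the initial velocity [V]; the
    choice of [l] makes [V] tangent and of norm -1. The end point has the same embedding as [q],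
    hence is [q], because both are in the range of [p]. *)
Lemma connecting_geodesic p q : rng K p q -> nlt K p q ->
  exists c l, [/\ future_geodesic K c, 0 < l, below_diameter K l, ph K l = world K p q &
    c 0 = p /\ c l = q].
Proof.
move=> h n; have w0 := world_gt0 h n; have r0 := rng_room h.
set l := phinv K (world K p q).
have lph : ph K l = world K p q by rewrite /l phinvK // ltW.
have l0 : 0 < l.
  rewrite lt_neqAle eq_sym phinv_ge0 ?(ltW w0) // andbT.
  by apply/eqP => e; move: w0; rewrite -lph e ph0 ltxx.
have lD : below_diameter K l by exact: phinv_below.
have s0 := sn_gt0 l0 lD; have sN : sn K l != 0 by rewrite gt_eqF.
set V := (sn K l)^-1 *: (emb K q - cs K l *: emb K p).
have tV : tangent p V.
  move=> K0; rewrite /V bZr bDr bNr bZr.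
  apply: (mulfI K0); rewrite mulr0.
  transitivity ((sn K l)^-1 * (K * b (emb K p) (emb K q) -
     cs K l * (K * b (emb K p) (emb K p)))); first by ring.
  by rewrite worldE // emb_norm // -lph csE; ring.
have nV : b V V = -1.
  have e : world K p q = ph K l by [].
  have sq := sn2E K l.
  rewrite /V bZl bZr; set D := _ - _.
  have -> : b D D = - sn K l ^+ 2; last by field.
  rewrite sq; have [K0|K0] := eqVneq K 0.
    have c1 : cs K l = 1 by rewrite csE [X in _ + X * _]K0 mul0r addr0.
    by rewrite [X in 2 + X * _]K0 mul0r addr0 -e worldC /world /D c1 scale1r; field.
  have -> : D = emb K q + - (cs K l *: emb K p) by [].
  rewrite bDl !bDr !bNl !bNr !bZl !bZr (bC (emb K q) (emb K p)).
  apply: (mulfI K0).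
  transitivity (K * b (emb K q) (emb K q) - 2 * cs K l * (K * b (emb K p) (emb K q))
    + cs K l ^+ 2 * (K * b (emb K p) (emb K p))); first by ring.
  by rewrite (worldE p q K0) !emb_norm // e csE; ring.
have [c [cc c0 vc]] := geodesic_exists tV nV.
have el : emb K (c l) = emb K q.
  by rewrite (geodesicE cc) c0 vc /V scalerA divff // scale1r addrC subrK.
have rl : rng K p (c l) by rewrite -c0; apply: geodesic_rng => //; exact: ltW.
have cl : c l = q by exact: emb_inj rl h el.
exists c, l; split=> //.
(* A past directed geodesic would put [q] before [p], against the strict null order. *)
have [//|fc] := geodesic_direction cc.
have P := future_path fc (r := - l) (s := 0) ltac:(lra).
have e1 : 0 - - l = l by ring.
have e2 : 0 - 0 = 0 :> R by ring.
move: P; rewrite /affine e1 e2 cl c0 => /path_mono[[h1 h2] _ _].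
by case: n => h3 _; lra.
Qed.

(** Where [world] is positive the connecting geodesic attains the upper bound; where it is 0, so is
    the bound. *)
Lemma mtauE p q : rng K p q -> nle K p q ->
  model_tau K p q = (phinv K (world K p q))%:E.
Proof.
move=> h n; apply/eqP; rewrite eq_le mtau_upper //=.
have w0 := world_ge0 h n.
have [w|w] : 0 = world K p q \/ 0 < world K p q.
  by move: w0; rewrite le_eqVlt => /predU1P.
  rewrite -w; have -> : phinv K 0 = 0; last exact: mtau_ge0.
  have r : 0 < 2 + K * 0 :> R by rewrite mulr0 addr0.
  apply: (@ph_inj R K) => //; [exact: phinv_ge0|exact: phinv_below| |].
    by rewrite below_diameterE; case: (curvP K) => //= *; rewrite mulr0 pi_gt0.
  by rewrite phinvK // ph0.
have n' : nlt K p q.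
  by have [//|[a1 a2]] := world_order h w; case: n => a3 a4; lra.
have [c [l [fc l0 lD lph [c0 cl]]]] := connecting_geodesic h n'.
have := mtau_path (future_path fc l0); rewrite c0 cl subr0.
have -> // : l = phinv K (world K p q).
apply: (@ph_inj R K) => //; [exact: ltW|exact: phinv_ge0 w0 (rng_room h)|exact: phinv_below|].
by rewrite phinvK // rng_room.
Qed.

End GeodesicExistence.

(** * Leaving the range, and the diameter *)

Section Exit.
Variables (R : realType) (K : R).
Local Notation k := (curv_root K).
Local Notation mtau := (model_tau K).
Local Notation mcaus := (model_caus K).
Implicit Types (p q y z : model R) (c : R -> model R) (s t l m : R).

(** For ordered points the remaining inequalities follow from [eta_lt]; in particular only negative
    curvature imposes a condition. *)
Lemma rngE p q : nle K p q -> rng K p q <->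
  (K < 0 -> nb K q - na K p < pi / 2 /\ na K q - nb K p < pi / 2).
Proof.
move=> [h1 h2]; have [K0|K0|K0] := ltrgtP K 0.
- have Kn : K != 0 by rewrite lt_eqF.
  have := eta_lt p Kn; rewrite /eta /rng /sna K0 !ltr_norml => h3.
  split=> [/(_ Kn) h _|/(_ isT) h _]; first by split; lra.
  by split; lra.
- have Kn : K != 0 by rewrite gt_eqF.
  have := eta_lt p Kn; have := eta_lt q Kn.
  rewrite /eta /rng /sna (lt_gtF K0) !ltr_norml => h3 h4.
  by split=> // _ _; split; lra.
- by split=> // _; rewrite /rng K0 eqxx.
Qed.

Lemma phinv_gt m f : 0 <= m -> below_diameter K m -> 0 <= f -> 0 < 2 + K * f ->
  (m < phinv K f) = (ph K m < f).
Proof.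
move=> m0 mD f0 fr; rewrite -{2}(phinvK f0 fr) ph_ltE //.
- exact: phinv_ge0.
- exact: phinv_below.
Qed.

Lemma phinv_ph m : 0 <= m -> below_diameter K m -> phinv K (ph K m) = m.
Proof.
move=> m0 mD; have f0 := ph_ge0 m0 mD; have fr := ph_room m0 mD.
apply: (@ph_inj R K) => //; [exact: phinv_ge0|exact: phinv_below|].
exact: phinvK.
Qed.

Lemma nlt_caus p q : rng K p q -> nlt K p q -> mcaus p q.
Proof.
move=> h n; have [c [l [fc l0 _ _ [<- <-]]]] := connecting_geodesic h n.
by apply: future_caus => //; exact: ltW.
Qed.

Lemma C1_restrict c r s t : C1_future_causal K c r s -> r <= t -> t < s ->
  C1_future_causal K c t s.
Proof.
move=> [rs dc cc h] rt ts; split; [exact: ts|exact: dc|exact: cc|].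
by move=> u /andP[h1 h2]; apply: h; rewrite (le_trans rt h1).
Qed.

(* The world function tends to [-2 / K], its value at separation [D_K], where the curve leaves
   the range of [y]. *)
Lemma exit_C1 c r s y m : C1_future_causal K c r s -> nle K y (c r) -> rng K y (c r) ->
  ~ rng K y (c s) -> 0 <= m -> below_diameter K m -> (m%:E < mtau y (c s))%E.
Proof.
move=> H n1 r1 r2 m0 mD; have [rs dc cc _] := H.
have mono t t' : r <= t -> t <= t' -> t' <= s -> nle K (c t) (c t') by exact: (C1_nle H).
have ny t : r <= t -> t <= s -> nle K y (c t).
  by move=> h1 h2; apply: nle_trans n1 _; exact: mono.
have K0 : K < 0.
  rewrite ltNge; apply/negP => K0; apply: r2; apply/(rngE (ny s (ltW rs) (lexx s))).
  by rewrite ltNge K0.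
have Kn : K != 0 by rewrite lt_eqF.
suff [z [zs rz nz wz]] : exists z, [/\ mcaus z (c s), rng K y z, nle K y z &
    ph K m < world K y z].
  have w0 : 0 < world K y z by apply: le_lt_trans wz; exact: ph_ge0.
  have nlz : nlt K y z.
    by have [//|[a1 a2]] := world_order rz w0; case: nz => a3 a4; lra.
  apply: lt_le_trans (le_trans _ (mtau_triangle (nlt_caus rz nlz) zs)); last first.
    by apply: leeDl; exact: mtau_ge0.
  by rewrite mtauE // lte_fin phinv_gt ?rng_room ?(ltW w0).
have cw t : {for t, continuous (fun t => world K y (c t))}.
  exact: (is1_continuous (is1_world K y (dc t))).
have [h|h] := ltP (ph K m) (world K y (c r)).
  exists (c r); split=> //; right; exists (lorentzian_length K c r s).
  exact: CausalC1.
pose e1 t := nb K (c t) - na K y; pose e2 t := na K (c t) - nb K y.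
(* The maximum of [e1] and [e2], written with a square root so that continuity follows by syntax.
   The point is in range as long as [e] is below pi / 2. *)
pose e t := (e1 t + e2 t + Num.sqrt ((e1 t - e2 t) ^+ 2)) / 2.
have eE t : e t = Num.max (e1 t) (e2 t).
  rewrite /e sqrtr_sqr; case: (leP (e1 t) (e2 t)) => h0.
    by rewrite ler0_norm; [field|lra].
  by rewrite gtr0_norm; [field|lra].
have ce t : {for t, continuous e}.
  have h1 := is1_continuous (is1_na K (dc t)); have h2 := is1_continuous (is1_nb K (dc t)).
  by rewrite /e /e1 /e2; cv.
have [|||s1 /andP[rs1 s1s] es1] := @IVT_le R e r s (pi / 2) (ltW rs).
- by move=> t _; exact: ce.
- have [/(_ r1 K0) [a1 a2] _] := rngE n1.
  by rewrite eE ge_max /e1 /e2 !ltW.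
- rewrite leNgt; apply/negP; rewrite eE gt_max => /andP[a1 a2]; apply: r2.
  by apply/(rngE (ny s (ltW rs) (lexx s))) => _.
have edge t : e t = pi / 2 -> 2 + K * world K y (c t) = 0.
  rewrite eE room_cos // /sna K0 => et.
  suff [-> | ->] : cos (nb K (c t) - na K y) = 0 \/ cos (nb K y - na K (c t)) = 0.
  - by rewrite mul0r mulr0.
  - by rewrite !mulr0.
  move: et; rewrite /e1 /e2; case: leP => _ e3; [right|left].
    by rewrite -opprB cosN e3 cos_pihalf.
  by rewrite e3 cos_pihalf.
have E1 := edge s1 es1; have rm := ph_room m0 mD.
have lt1 : ph K m < world K y (c s1) by nra.
(* At [s1] the world function is - 2 / K, and [v] lies strictly between [ph K m] and this value. At
   the parameter where [v] is taken, [e] thus differs from pi / 2, and the point is still in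
   range. *)
pose v := (ph K m + world K y (c s1)) / 2.
have [|||s2 /andP[rs2 s2s1] vs2] := @IVT_le R (fun t => world K y (c t)) r s1 v rs1.
- by move=> t _; exact: cw.
- by rewrite /v; lra.
- by rewrite /v; lra.
have s2s := le_trans s2s1 s1s.
have ne : e s2 != pi / 2.
  by apply/eqP => /edge; rewrite vs2 /v => E2; move: E1 K0 lt1 E2; nra.
have le2 : e s2 < pi / 2.
  rewrite lt_neqAle ne /= -es1 !eE.
  have [a1 a2] := mono s2 s1 rs2 s2s1 s1s.
  by rewrite /e1 /e2 ge_max !le_max !lerD2r a1 a2 orbT.
exists (c s2); split.
- move: s2s; rewrite le_eqVlt => /predU1P[->|s2s]; first by left.
  right; exists (lorentzian_length K c s2 s); apply: CausalC1.
  exact: C1_restrict H rs2 s2s.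
- apply/(rngE (ny s2 rs2 s2s)) => _; move: le2; rewrite eE gt_max /e1 /e2 => /andP[a1 a2].
  by [].
- exact: ny.
- by rewrite vs2 /v; lra.
Qed.

Lemma diameter_ltP (x : \bar R) : (0 <= x)%E -> ~~ (model_diameter K <= x)%E ->
  exists m, [/\ x = m%:E, 0 <= m & below_diameter K m].
Proof.
rewrite -ltNge; case: x => [m| |] // h1 h2; first by exists m.
by move: h2; rewrite ltNge leey.
Qed.

Lemma diameter_gt0 : (0 < model_diameter K)%E.
Proof.
have : below_diameter K 0 by rewrite below_diameterE mulr0 pi_gt0 implybT.
by [].
Qed.

Lemma exit_path q z l : causal_path K q z l -> forall y, nle K y q -> rng K y q ->
  ~ rng K y z -> (model_diameter K <= mtau y z)%E.
Proof.
elim=> {q z l} [c r s H|q z w l l' P1 IH1 P2 IH2] y n1 r1 r2.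
  apply: contrapT => /negP h; have [m [e m0 mD]] := diameter_ltP (mtau_ge0 _ _ _) h.
  by have := exit_C1 H n1 r1 r2 m0 mD; rewrite e ltxx.
have [n2 _ _] := path_mono P1; have nz := nle_trans n1 n2.
have [rz|rz] := pselect (rng K y z); first exact: IH2.
have h := IH1 _ n1 r1 rz.
have cyz : mcaus y z by apply: mtau_gt0_caus; exact: lt_le_trans diameter_gt0 h.
apply: le_trans h _; apply: le_trans (mtau_triangle cyz _).
  by apply: leeDl; exact: mtau_ge0.
by right; exists l'.
Qed.

(** Outside the range [exit_path] yields a separation of at least D_K; the size bound therefore
    places [q] in the range, where [mtauE] applies. *)
Lemma mtau_world p q : mcaus p q -> (mtau p q < model_diameter K)%E ->
  [/\ rng K p q, nle K p q & exists m,
    [/\ mtau p q = m%:E, 0 <= m, below_diameter K m & ph K m = world K p q]].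
Proof.
move=> cpq h; have n := mcaus_nle cpq.
have r : rng K p q.
  case: cpq h => [<- _|[l P] h]; first exact: rng_refl.
  apply: contrapT => nr.
  have := exit_path P (nle_refl K p) (@rng_refl _ K p) nr.
  by rewrite leNgt h.
have w0 := world_ge0 r n; have rm := rng_room r.
split=> //; exists (phinv K (world K p q)); split; first exact: mtauE.
- exact: phinv_ge0.
- exact: phinv_below.
- exact: phinvK.
Qed.

Lemma mtau_anti p q : mcaus p q -> mtau q p = 0%E.
Proof.
move=> h; apply/eqP; rewrite eq_le mtau_ge0 andbT; apply: mtau_le => // l P.
have e : p = q by apply: (mcaus_anti h); right; exists l.
by case: (no_loop (K := K) (p := q) (l := l)); rewrite -{2}e.
Qed.

Lemma future_tau c s l : future_geodesic K c -> 0 <= s -> s <= l ->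
  below_diameter K l -> [/\ mcaus (c 0) (c s), mtau (c 0) (c s) = s%:E & mtau (c s) (c 0) = 0%E].
Proof.
move=> fc s0 sl lD; have sD := below_diameter_le sl lD.
have h : mcaus (c 0) (c s) by exact: future_caus.
split=> //; last exact: mtau_anti.
rewrite mtauE; [|exact: (geodesic_rng fc.1)|exact: mcaus_nle].
by rewrite (world_geodesic _ _ fc.1) subr0 phinv_ph.
Qed.

Lemma past_tau c s l : future_geodesic K (fun t => c (affine true 0 t)) ->
  timelike_geodesic K c -> 0 <= s -> s <= l ->
  below_diameter K l -> [/\ mcaus (c s) (c 0), mtau (c s) (c 0) = s%:E & mtau (c 0) (c s) = 0%E].
Proof.
move=> fc hc s0 sl lD; have sD := below_diameter_le sl lD.
have h : mcaus (c s) (c 0).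
  have := future_caus fc (r := - s) (s := 0) ltac:(lra).
  have e1 : 0 - - s = s by ring.
  by rewrite /affine e1 subr0.
split=> //; last exact: mtau_anti.
rewrite mtauE; [|apply: rngC; exact: (geodesic_rng hc)|exact: mcaus_nle].
by rewrite worldC (world_geodesic _ _ hc) subr0 phinv_ph.
Qed.

End Exit.

(** * Null curves *)

Section NullPaths.
Variables (R : realType) (K : R).
Implicit Types p q : model R.

Lemma C1_null c (f g df dg : R -> R) r s :
  (forall t, is_derive t (1 : R) f (df t)) -> (forall t, is_derive t (1 : R) g (dg t)) ->
  continuous df -> continuous dg -> (forall t, c t = (f t, g t)) ->
  (forall t, 0 < df t) -> r < s ->
  (forall t, na K (c t) = na K (c r)) \/ (forall t, nb K (c t) = nb K (c r)) ->
  C1_future_causal K c r s.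
Proof.
move=> hf hg cf cg ec pf rs hn; have [dc cc] := is1_pair_C1 hf hg cf cg ec.
split; [exact: rs|exact: dc|exact: cc|move=> t _; split].
  have := is1_fst (dc t); rewrite (_ : (fun t => (c t).1) = f); last first.
    by apply/funext => u; rewrite ec.
  by move=> h; rewrite -(is1_derive1 h) (is1_derive1 (hf t)).
rewrite velocity_norm //; case: hn => hn.
- have := is1_na K (dc t); rewrite (_ : (fun t => na K (c t)) = fun _ => na K (c r)).
    by move=> h; rewrite -(is1_derive1 h) (is1_derive1 (is1_cst _ _)) mul0r mulr0 oppr0.
  by apply/funext.
- have := is1_nb K (dc t); rewrite (_ : (fun t => nb K (c t)) = fun _ => nb K (c r)).
    by move=> h; rewrite -(is1_derive1 h) (is1_derive1 (is1_cst _ _)) !mulr0 oppr0.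
  by apply/funext.
Qed.

Lemma gd_mono (x y : R) : (gd x < gd y) = (x < y).
Proof.
case: (ltrgtP x y) => [h|h|->]; last by rewrite ltxx.
- by rewrite gd_lt_mono.
- by apply/negbTE; rewrite -leNgt ltW // gd_lt_mono.
Qed.

Lemma gd_inj (x y : R) : gd x = gd y -> x = y.
Proof.
by move=> e; case: (ltrgtP x y) => // h; have := gd_lt_mono h; rewrite e ltxx.
Qed.

Lemma coshV_continuous : continuous (fun t : R => (cosh t)^-1).
Proof.
move=> t; rewrite -[continuous_at _ _]/{for t, continuous _}; cv.
exact: cosh_neq0.
Qed.

(** Null curves are explicit: for K nonzero the curve is parametrized by the coordinate to which
    [gd] is applied, up to sign, and the other coordinate is a constant plus or minus [gd]. *)
Lemma null_path p q : (na K p = na K q /\ nb K p < nb K q) \/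
  (nb K p = nb K q /\ na K p < na K q) -> model_caus K p q.
Proof.
have pE : p = (p.1, p.2) by case: p.
have qE : q = (q.1, q.2) by case: q.
have c1 : continuous (fun _ : R => 1 : R) by move=> t; exact: cvg_cst.
have cN1 : continuous (fun _ : R => -1 : R) by move=> t; exact: cvg_cst.
have dgd a t : is_derive t (1 : R) (fun t => a + gd t) (cosh t)^-1.
  by have h := is1_gd t; dvE; ring.
have dNgd a t : is_derive t (1 : R) (fun t => a - gd t) (- (cosh t)^-1).
  by have h := is1_gd t; dvE; ring.
have dN t : is_derive t (1 : R) (fun t => - t) (-1) by dvE; ring.
have cN := coshV_continuous.
have cNN : continuous (fun t : R => - (cosh t)^-1).
  move=> t; rewrite -[continuous_at _ _]/{for t, continuous _}; cv.
  exact: cosh_neq0.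
have p0 (t : R) : 0 < (cosh t)^-1 by rewrite invr_gt0 cosh_gt0.
have path c r s : C1_future_causal K c r s -> c r = p -> c s = q -> model_caus K p q.
  move=> H <- <-; right; exists (lorentzian_length K c r s); exact: CausalC1.
case: (curvP K) => [K0 k0 KE|K0 k0 KE|K0].
- have Kn : (K < 0) = false by apply/negbTE; rewrite -leNgt ltW.
  rewrite {1 2 3 4}/na {1 2 3 4}/nb /ct /cx K0 Kn => -[] [e1 e2].
  + have lt : p.1 < q.1 by rewrite -gd_mono; lra.
    apply: (path (fun s => (s, (p.2 - gd p.1) + gd s)) p.1 q.1).
    * apply: (C1_null (@is1_id R) (dgd _)) => //; left => t.
      by rewrite /na /ct /cx K0 Kn /=; field.
    * by rewrite [RHS]pE; congr (_, _); ring.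
    * by rewrite [RHS]qE; congr (_, _); lra.
  + have lt : p.1 < q.1 by rewrite -gd_mono; lra.
    apply: (path (fun s => (s, (p.2 + gd p.1) - gd s)) p.1 q.1).
    * apply: (C1_null (@is1_id R) (dNgd _)) => //; right => t.
      by rewrite /nb /ct /cx K0 Kn /=; field.
    * by rewrite [RHS]pE; congr (_, _); ring.
    * by rewrite [RHS]qE; congr (_, _); lra.
- have Kn : (0 < K) = false by apply/negbTE; rewrite -leNgt ltW.
  rewrite {1 2 3 4}/na {1 2 3 4}/nb /ct /cx K0 Kn => -[] [e1 e2].
  + have lt : p.2 < q.2 by rewrite -gd_mono; lra.
    apply: (path (fun s => ((p.1 - gd p.2) + gd s, s)) p.2 q.2).
    * apply: (C1_null (dgd _) (@is1_id R)) => //; left => t.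
      by rewrite /na /ct /cx K0 Kn /=; field.
    * by rewrite [RHS]pE; congr (_, _); ring.
    * by rewrite [RHS]qE; congr (_, _); lra.
  + have lt : q.2 < p.2 by rewrite -gd_mono; lra.
    have gN (x : R) : gd (- x) = - gd x by rewrite /gd sinhN atanN.
    (* The space coordinate decreases along this curve, so its negative serves as parameter. *)
    apply: (path (fun s => ((p.1 + gd p.2) + gd s, - s)) (- p.2) (- q.2)).
    * apply: (C1_null (dgd _) dN) => //; first by rewrite ltrN2.
      by right => t; rewrite /nb /ct /cx K0 Kn /= !gN; field.
    * by rewrite [RHS]pE opprK gN; congr (_, _); ring.
    * by rewrite [RHS]qE opprK gN; congr (_, _); lra.
- have [P0 P1] : (0 < K) = false /\ (K < 0) = false by rewrite K0 ltxx.
  rewrite {1 2 3 4}/na {1 2 3 4}/nb /ct /cx P0 P1 => -[] [e1 e2].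
  + have lt : p.1 < q.1 by lra.
    have d1 t : is_derive t (1 : R) (fun t => (p.2 - p.1) + t) 1 by dvE; ring.
    apply: (path (fun s => (s, (p.2 - p.1) + s)) p.1 q.1).
    * apply: (C1_null (@is1_id R) d1) => //; left => t.
      by rewrite /na /ct /cx P0 P1 /=; field.
    * by rewrite [RHS]pE; congr (_, _); ring.
    * by rewrite [RHS]qE; congr (_, _); lra.
  + have lt : p.1 < q.1 by lra.
    have d1 t : is_derive t (1 : R) (fun t => (p.2 + p.1) - t) (-1) by dvE; ring.
    apply: (path (fun s => (s, (p.2 + p.1) - s)) p.1 q.1).
    * apply: (C1_null (@is1_id R) d1) => //; right => t.
      by rewrite /nb /ct /cx P0 P1 /=; field.
    * by rewrite [RHS]pE; congr (_, _); ring.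
    * by rewrite [RHS]qE; congr (_, _); lra.
Qed.

End NullPaths.

(** * Hinges and triangles in the model space *)

Section ModelTriangles.
Variables (R : realType) (K : R).
Local Notation k := (curv_root K).
Local Notation mtau := (model_tau K).
Local Notation mcaus := (model_caus K).
Implicit Types (p q x y z : model R) (c : R -> model R) (s t l m : R).

(** One of the two terms vanishes for causally related points; the symmetric form treats future and
    past directed sides alike. *)
Definition sep p q : R := fine (mtau p q) + fine (mtau q p).

Lemma null_inj p q : na K p = na K q -> nb K p = nb K q -> p = q.
Proof.
move=> h1 h2; have h3 : ct K p = ct K q by move: h1 h2; rewrite /na /nb; lra.
have h4 : cx K p = cx K q by move: h1 h2; rewrite /na /nb; lra.
have pE : p = (p.1, p.2) by case: (p).
have qE : q = (q.1, q.2) by case: (q).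
rewrite pE qE; move: h3 h4; rewrite /ct /cx.
by case: (0 < K); case: (K < 0) => h3 h4; congr (_, _) => //; exact: gd_inj.
Qed.

Lemma nle_caus p q : rng K p q -> nle K p q -> mcaus p q.
Proof.
move=> h [h1 h2]; move: h1 h2; rewrite le_eqVlt => /predU1P[ea|ha].
  rewrite le_eqVlt => /predU1P[eb|hb]; first by rewrite (null_inj ea eb); left.
  by apply: null_path; left.
rewrite le_eqVlt => /predU1P[eb|hb]; first by apply: null_path; right.
exact: nlt_caus.
Qed.

(** [p] and [q] need not be in range of one another. Since both lie on the same causal side of [x]
    and in its range, their null differences are still below pi, so the sines have the signs of the
    differences; a nonnegative product excludes strictly opposite signs. *)
Lemma world_cmp x p q : rng K x p -> rng K x q ->
  (nle K x p /\ nle K x q) \/ (nle K p x /\ nle K q x) -> 0 <= world K p q ->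
  nle K p q \/ nle K q p.
Proof.
move=> r1 r2 h w0.
have G : K != 0 -> `|na K q - na K p| < pi /\ `|nb K q - nb K p| < pi.
  move=> K0; have [a1 a2] := rng_gap K0 r1; have [a3 a4] := rng_gap K0 r2.
  move: a1 a2 a3 a4; rewrite !ltr_norml.
  by case: h => -[[b1 b2] [b3 b4]] a1 a2 a3 a4; split; lra.
have S u : (K != 0 -> `|u| < pi) -> (0 < u -> 0 < nsin K u) /\ (u < 0 -> nsin K u < 0).
  rewrite /nsin; case: eqVneq => [//|K0] /(_ isT); rewrite ltr_norml => u1.
  split=> u0; first by apply: sin_gt0_pi; lra.
  by rewrite -oppr_gt0 -sinN; apply: sin_gt0_pi; lra.
have [sa1 sa2] := S _ (fun h => (G h).1); have [sb1 sb2] := S _ (fun h => (G h).2).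
rewrite world_null in w0; set M := 2 * _ * _ in w0.
have M0 : 0 < M by rewrite !mulr_gt0 ?cf_gt0.
rewrite (pmulr_rge0 _ M0) in w0.
have [ha|ha] := leP (na K p) (na K q); have [hb|hb] := leP (nb K p) (nb K q).
- by left.
- move: ha; rewrite le_eqVlt => /predU1P[ha|ha]; first by right; split; [rewrite ha|exact: ltW].
  have := sa1 ltac:(lra); have := sb2 ltac:(lra) => h1 h2.
  by have := nmulr_llt0 (nsin K (na K q - na K p)) h1; rewrite h2 ltNge w0.
- move: hb; rewrite le_eqVlt => /predU1P[hb|hb]; first by right; split; [exact: ltW|rewrite hb].
  have := sa2 ltac:(lra); have := sb1 ltac:(lra) => h1 h2.
  by have := nmulr_rlt0 (nsin K (nb K q - nb K p)) h2; rewrite h1 ltNge w0.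
- by right; split; exact: ltW.
Qed.

Lemma sep_world p q : mcaus p q \/ mcaus q p -> (mtau p q < model_diameter K)%E ->
  (mtau q p < model_diameter K)%E ->
  [/\ 0 <= sep p q, below_diameter K (sep p q) & world K p q = ph K (sep p q)].
Proof.
move=> [h|h] h1 h2; rewrite /sep.
- have [_ _ [m [e m0 mD w]]] := mtau_world h h1.
  by rewrite (mtau_anti h) e /= addr0.
- have [_ _ [m [e m0 mD w]]] := mtau_world h h2.
  by rewrite (mtau_anti h) e /= add0r worldC.
Qed.

Lemma geodesic_length c l p q : geodesic_from_to K c l p q ->
  (mtau p q < model_diameter K)%E -> (mtau q p < model_diameter K)%E ->
  [/\ below_diameter K l, sep p q = l &
     (future_geodesic K c /\ mcaus p q) \/
     (future_geodesic K (fun t => c (affine true 0 t)) /\ mcaus q p)].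
Proof.
move=> [hc l0 <- <-] h1 h2; have [fc|fc] := geodesic_direction hc.
- have P := future_path fc l0; rewrite subr0 in P.
  have lD : below_diameter K l by exact: le_lt_trans (mtau_path P) h1.
  have [h3 e1 e2] := future_tau fc (ltW l0) (lexx l) lD.
  by split; [exact: lD|rewrite /sep e1 e2 /= addr0|left].
- have P := future_path fc (r := - l) (s := 0) ltac:(lra).
  have e1 : 0 - - l = l by ring.
  rewrite /affine e1 !subr0 in P.
  have lD : below_diameter K l.
    exact: le_lt_trans (mtau_path P) h2.
  have [h3 e3 e2] := past_tau fc hc (ltW l0) (lexx l) lD.
  by split; [exact: lD|rewrite /sep e3 e2 /= add0r|right].
Qed.

(* The law of cosines: [l1], [l2] are the sides of a hinge, [B] is the scalar product of its
   initial unit velocities, and [hingeF] is the world function of its end points. *)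
Definition hingeF l1 l2 B : R :=
  ph K l1 + ph K l2 + K * ph K l1 * ph K l2 + sn K l1 * sn K l2 * B.

Definition hingeB l1 l2 m : R :=
  (ph K m - ph K l1 - ph K l2 - K * ph K l1 * ph K l2) / (sn K l1 * sn K l2).

Lemma hingeBC l1 l2 m : hingeB l1 l2 m = hingeB l2 l1 m.
Proof. rewrite /hingeB (mulrC (sn K l1)); congr (_ / _); ring. Qed.

Section Hinge.
Variables l1 l2 : R.
Hypotheses (l10 : 0 < l1) (l20 : 0 < l2).
Hypotheses (l1D : below_diameter K l1) (l2D : below_diameter K l2).

Lemma hinge_sn : 0 < sn K l1 * sn K l2.
Proof. by rewrite mulr_gt0 // sn_gt0. Qed.

Lemma hingeBK m : hingeF l1 l2 (hingeB l1 l2 m) = ph K m.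
Proof.
by rewrite /hingeF /hingeB; field; rewrite !gt_eqF ?sn_gt0.
Qed.

Lemma hingeF_le B B' : (hingeF l1 l2 B <= hingeF l1 l2 B') = (B <= B').
Proof. by rewrite /hingeF lerD2l ler_pM2l // hinge_sn. Qed.

Lemma hingeF_inj B B' : hingeF l1 l2 B = hingeF l1 l2 B' -> B = B'.
Proof. by move=> e; apply/eqP; rewrite eq_le -(hingeF_le B B') -(hingeF_le B' B) e lexx. Qed.

(** [B = -1] closes the hinge: its ends are then at separation |l1 - l2|, and [hingeF] increases
    with [B]. *)
Lemma hingeB_le1 m : 0 <= m -> m <= `|l1 - l2| -> hingeB l1 l2 m <= -1.
Proof.
move=> m0 h; rewrite -hingeF_le hingeBK /hingeF.
have -> : ph K l1 + ph K l2 + K * ph K l1 * ph K l2 + sn K l1 * sn K l2 * -1 =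
   ph K `|l1 - l2|.
  have -> : ph K `|l1 - l2| = ph K (l1 + - l2).
    by case: (leP 0 (l1 - l2)) => hh; [rewrite ger0_norm|rewrite ltr0_norm // phN].
  by rewrite phD phN snN; ring.
have p1 := l10; have p2 := l20.
apply: ph_le => //; case: (leP 0 (l1 - l2)) => hh.
  by rewrite ger0_norm //; apply: below_diameter_le l1D; lra.
by rewrite ltr0_norm //; apply: below_diameter_le l2D; lra.
Qed.

(** [B = 1] straightens the hinge, to separation [l1 + l2]. *)
Lemma hingeB_ge1 m : l1 + l2 <= m -> below_diameter K m -> 1 <= hingeB l1 l2 m.
Proof.
move=> h mD; rewrite -hingeF_le hingeBK /hingeF mulr1 -phD.
by have p1 := l10; have p2 := l20; apply: ph_le => //; lra.
Qed.

End Hinge.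

Lemma hinge_world c1 c2 s t : timelike_geodesic K c1 -> timelike_geodesic K c2 ->
  c1 0 = c2 0 ->
  world K (c1 s) (c2 t) = hingeF s t (b (velocity K c1 0) (velocity K c2 0)).
Proof. exact: hinge. Qed.

(** The world function gives the size of the separation but not its direction. [world_cmp] orders
    the two ends, and the wrong order would give [lf <= ln] by the reverse triangle inequality. *)
Lemma hinge_future c1 c2 ln lf m : future_geodesic K c1 -> future_geodesic K c2 ->
  c1 0 = c2 0 -> 0 < ln -> ln < lf -> below_diameter K lf -> 0 <= m -> m <= lf ->
  world K (c1 ln) (c2 lf) = ph K m ->
  mcaus (c1 ln) (c2 lf) /\ mtau (c1 ln) (c2 lf) = m%:E.
Proof.
move=> f1 f2 e ln0 nf fD m0 mf w.
have nD := below_diameter_le (ltW nf) fD; have mD := below_diameter_le mf fD.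
have lf0 : 0 < lf by exact: lt_trans nf.
have [c1n e1 _] := future_tau f1 (ltW ln0) (lexx ln) nD.
have [c2f e2 _] := future_tau f2 (ltW lf0) (lexx lf) fD.
have r1 := geodesic_rng f1.1 (ltW ln0) nD; have r2 := geodesic_rng f2.1 (ltW lf0) fD.
rewrite -e in c2f e2 r2.
have n1 := mcaus_nle c1n; have n2 := mcaus_nle c2f.
have w0 : 0 <= world K (c1 ln) (c2 lf) by rewrite w ph_ge0.
have [n3|n3] := world_cmp r1 r2 (or_introl (conj n1 n2)) w0.
  have r3 : rng K (c1 ln) (c2 lf) by apply: (rng_diamond r2).
  by split; [exact: nle_caus|rewrite mtauE // w phinv_ph].
have r3 : rng K (c2 lf) (c1 ln) by apply: (rng_diamond r1).
have := mtau_triangle c2f (nle_caus r3 n3); rewrite e2 e1 => h.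
have : (lf%:E <= ln%:E)%E by apply: le_trans h; apply: leeDl; exact: mtau_ge0.
by rewrite lee_fin leNgt nf.
Qed.

Lemma hinge_past c1 c2 ln lf m :
  timelike_geodesic K c1 -> timelike_geodesic K c2 ->
  future_geodesic K (fun t => c1 (affine true 0 t)) ->
  future_geodesic K (fun t => c2 (affine true 0 t)) ->
  c1 0 = c2 0 -> 0 < ln -> ln < lf -> below_diameter K lf -> 0 <= m -> m <= lf ->
  world K (c1 ln) (c2 lf) = ph K m ->
  mcaus (c2 lf) (c1 ln) /\ mtau (c2 lf) (c1 ln) = m%:E.
Proof.
move=> g1 g2 f1 f2 e ln0 nf fD m0 mf w.
have nD := below_diameter_le (ltW nf) fD; have mD := below_diameter_le mf fD.
have lf0 : 0 < lf by exact: lt_trans nf.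
have [c1n e1 _] := past_tau f1 g1 (ltW ln0) (lexx ln) nD.
have [c2f e2 _] := past_tau f2 g2 (ltW lf0) (lexx lf) fD.
have r1 := geodesic_rng g1 (ltW ln0) nD; have r2 := geodesic_rng g2 (ltW lf0) fD.
rewrite -e in c2f e2 r2.
have n1 := mcaus_nle c1n; have n2 := mcaus_nle c2f.
have w0 : 0 <= world K (c1 ln) (c2 lf) by rewrite w ph_ge0.
have [n3|n3] := world_cmp r1 r2 (or_intror (conj n1 n2)) w0; last first.
  have r3 : rng K (c2 lf) (c1 ln) by apply: (rng_diamond (rngC r2)).
  by split; [exact: nle_caus|rewrite mtauE // worldC w phinv_ph].
have r3 : rng K (c1 ln) (c2 lf) by apply: (rng_diamond (rngC r1)).
have := mtau_triangle (nle_caus r3 n3) c2f; rewrite e2 e1 => h.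
have : (lf%:E <= ln%:E)%E by apply: le_trans h; apply: leeDr; exact: mtau_ge0.
by rewrite lee_fin leNgt nf.
Qed.

(** Components in an orthonormal basis, timelike vector first, of the tangent space at [origin]; the
    place of this space among the ambient coordinates depends on the sign of K. *)
Definition frame (al be : R) : 'rV[R]_(model_dim K) := \row_(i < model_dim K)
  nth 0 (if 0 < K then [:: al; 0; be] else if K < 0 then [:: 0; al; be]
         else [:: al; be]) i.

Lemma crd_frame al be i : crd (frame al be) i =
  nth 0 (if 0 < K then [:: al; 0; be] else if K < 0 then [:: 0; al; be]
         else [:: al; be]) i.
Proof.
rewrite /crd; case: insubP => [j _ ji|]; first by rewrite mxE ji.
rewrite -leqNgt => h; rewrite nth_default //; apply: leq_trans h.
by rewrite /model_dim; case: (curvP K).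
Qed.

Lemma b_frame al be al' be' : b (frame al be) (frame al' be') = - (al * al') + be * be'.
Proof.
rewrite bE !crd_frame /sig1; case: (curvP K) => [K0 _ _|K0 _ _|K0] /=; ring.
Qed.

Definition origin : model R := (0, 0).

Lemma tangent_frame al be : @tangent R K origin (frame al be).
Proof.
move=> K0; rewrite bE !crd_emb !crd_frame /emb_coords /origin sinh0 cosh0 sin0 cos0.
by move: K0; case: (curvP K) => //= [K0 _ _|K0 _ _] _; ring.
Qed.

Lemma frame_direction c al be : timelike_geodesic K c -> c 0 = origin ->
  velocity K c 0 = frame al be ->
  exists2 C, 0 < C & (derive1 c 0).1 = C * al.
Proof.
move=> hc c0 v; have [dc _] := geodesic_C1 hc.
have [_ h] := velocity_crd K (dc 0).
move: h; rewrite v c0 /demb /origin sinh0 cosh0 sin0 cos0 => h.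
have dimE : model_dim K = if K == 0 then 2%N else 3%N by [].
have := h 0%N; have := h 1%N; rewrite !crd_frame dimE.
case: (curvP K) => [K0 k0 KE|K0 k0 KE|K0] /= h1 h0.
- by exists k => //; rewrite (h0 isT) mul1r mulrC divfK ?gt_eqF.
- by exists k => //; rewrite (h1 isT) !mul0r add0r !mul1r mulrC divfK ?gt_eqF.
- by exists 1 => //; rewrite (h0 isT) mul1r.
Qed.

Lemma affine_direction c : timelike_geodesic K c ->
  (derive1 (fun t => c (affine true 0 t)) 0).1 = - (derive1 c 0).1.
Proof.
move=> hc; have [dc _] := geodesic_C1 hc.
have [dr _] := geodesic_C1 (geodesic_affine true 0 hc).1.
have da : is_derive (0 : R) (1 : R) (affine true 0) (-1) by rewrite /affine; dvE; ring.
have d1 := is1_comp (f := fun t => (c t).1) (g := affine true 0) (is1_fst (dc _)) da.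
rewrite -(is1_derive1 (is1_fst (dr 0))) (is1_derive1 d1) mulrN1.
by rewrite /affine subr0.
Qed.

Lemma future_of_pos c : timelike_geodesic K c -> 0 < (derive1 c 0).1 ->
  future_geodesic K c.
Proof.
move=> hc h; have [fc|[_ /(_ 0)]] := geodesic_direction hc; first exact: fc.
by rewrite (affine_direction hc) oppr_gt0 => h'; have := lt_trans h h'; rewrite ltxx.
Qed.

Lemma past_of_neg c : timelike_geodesic K c -> (derive1 c 0).1 < 0 ->
  future_geodesic K (fun t => c (affine true 0 t)).
Proof.
move=> hc h; have [[_ /(_ 0) h']|fc] := geodesic_direction hc; last exact: fc.
by have := lt_trans h h'; rewrite ltxx.
Qed.

(** With sg = 1 or -1, the velocities (sg, 0) and (- B sg, sqrt(B^2 - 1)) are unit timelike with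
    product [B]; they point to the same side in time because - B is positive. *)
Lemma frame_geodesics (e : bool) B : B <= -1 -> exists c1 c2,
  [/\ c1 0 = c2 0, timelike_geodesic K c1, timelike_geodesic K c2,
      b (velocity K c1 0) (velocity K c2 0) = B &
   if e then future_geodesic K c1 /\ future_geodesic K c2 else
     future_geodesic K (fun t => c1 (affine true 0 t)) /\
     future_geodesic K (fun t => c2 (affine true 0 t))].
Proof.
move=> B1; set sg : R := if e then 1 else -1.
have sg2 : sg * sg = 1 by rewrite /sg; case: (e); ring.
have sq : Num.sqrt (B ^+ 2 - 1) * Num.sqrt (B ^+ 2 - 1) = B ^+ 2 - 1.
  by rewrite -expr2 sqr_sqrtr //; nra.
have [|c1 [g1 o1 v1]] := geodesic_exists (@tangent_frame sg 0).
  by rewrite b_frame sg2; ring.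
have [|c2 [g2 o2 v2]] := geodesic_exists (@tangent_frame (- B * sg) (Num.sqrt (B ^+ 2 - 1))).
  rewrite b_frame sq.
  transitivity (- (B ^+ 2 * (sg * sg)) + (B ^+ 2 - 1)); first by ring.
  by rewrite sg2; ring.
exists c1, c2; split=> //; first by rewrite o1 o2.
  rewrite v1 v2 b_frame.
  transitivity (B * (sg * sg)); first by ring.
  by rewrite sg2 mulr1.
have [C1 C10 d1] := frame_direction g1 o1 v1.
have [C2 C20 d2] := frame_direction g2 o2 v2.
have sB : - B > 0 by lra.
rewrite /sg in d1 d2; case: (e) d1 d2 => d1 d2; split.
- by apply: future_of_pos => //; rewrite d1 mulr1.
- by apply: future_of_pos => //; rewrite d2 mulr1 mulr_gt0.
- by apply: past_of_neg => //; rewrite d1 mulrN1 oppr_lt0.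
- by apply: past_of_neg => //; rewrite d2 mulrN1 mulrN oppr_lt0 mulr_gt0.
Qed.

(** A hinge whose product of velocities is prescribed by the law of cosines; [ln + m <= lf] makes
    this product at most -1. If [ln = lf] then [m] is 0, and the degenerate hinge with coinciding
    ends is taken, which the last clause records. *)
Lemma triangle_future ln lf m : 0 < ln -> 0 <= m -> ln + m <= lf ->
  below_diameter K lf -> exists x n f,
  [/\ mcaus x n /\ mtau x n = ln%:E, mcaus x f /\ mtau x f = lf%:E,
      mcaus n f /\ mtau n f = m%:E & ln = lf -> n = f].
Proof.
move=> ln0 m0 h fD.
have lf0 : 0 < lf by lra.
have nlf : ln <= lf by lra.
have nD : below_diameter K ln := below_diameter_le nlf fD.
move: (nlf); rewrite le_eqVlt => /predU1P[e|lt].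
  have [c1 [c2 [_ _ _ _ [f1 _]]]] := @frame_geodesics true (-1) (lexx _).
  have [h1 h2 _] := future_tau f1 (ltW ln0) (lexx ln) nD.
  have -> : m = 0 by lra.
  exists (c1 0), (c1 ln), (c1 ln); rewrite -e mtau_refl; split=> //.
  by split=> //; left.
have B1 : hingeB ln lf m <= -1.
  by apply: hingeB_le1 => //; rewrite ltr0_norm; lra.
have [c1 [c2 [e g1 g2 bv [f1 f2]]]] := @frame_geodesics true _ B1.
have [h1 h2 _] := future_tau f1 (ltW ln0) (lexx ln) nD.
have [h3 h4 _] := future_tau f2 (ltW lf0) (lexx lf) fD.
exists (c1 0), (c1 ln), (c2 lf); rewrite -e in h3 h4; split=> //.
  apply: hinge_future => //; first by lra.
  by rewrite hinge_world // bv hingeBK.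
by move=> ee; move: lt; rewrite ee ltxx.
Qed.

Lemma triangle_past ln lf m : 0 < ln -> 0 <= m -> ln + m <= lf ->
  below_diameter K lf -> exists x n f,
  [/\ mcaus n x /\ mtau n x = ln%:E, mcaus f x /\ mtau f x = lf%:E,
      mcaus f n /\ mtau f n = m%:E & ln = lf -> n = f].
Proof.
move=> ln0 m0 h fD.
have lf0 : 0 < lf by lra.
have nlf : ln <= lf by lra.
have nD : below_diameter K ln := below_diameter_le nlf fD.
move: (nlf); rewrite le_eqVlt => /predU1P[e|lt].
  have [c1 [c2 [_ g1 _ _ [f1 _]]]] := @frame_geodesics false (-1) (lexx _).
  have [h1 h2 _] := past_tau f1 g1 (ltW ln0) (lexx ln) nD.
  have -> : m = 0 by lra.
  exists (c1 0), (c1 ln), (c1 ln); rewrite -e mtau_refl; split=> //.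
  by split=> //; left.
have B1 : hingeB ln lf m <= -1.
  by apply: hingeB_le1 => //; rewrite ltr0_norm; lra.
have [c1 [c2 [e g1 g2 bv [f1 f2]]]] := @frame_geodesics false _ B1.
have [h1 h2 _] := past_tau f1 g1 (ltW ln0) (lexx ln) nD.
have [h3 h4 _] := past_tau f2 g2 (ltW lf0) (lexx lf) fD.
exists (c1 0), (c1 ln), (c2 lf); rewrite -e in h3 h4; split=> //.
  apply: hinge_past => //; first by lra.
  by rewrite hinge_world // bv hingeBK.
by move=> ee; move: lt; rewrite ee ltxx.
Qed.

Lemma timelike_geodesics p q m : mtau p q = m%:E -> 0 < m -> below_diameter K m ->
  (exists c, geodesic_from_to K c m p q) /\ (exists c, geodesic_from_to K c m q p).
Proof.
move=> e m0 mD.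
have cpq : mcaus p q by apply: mtau_gt0_caus; rewrite e lte_fin.
have [r n [m' [e' m0' mD' w]]] := mtau_world cpq ltac:(by rewrite e).
move: e'; rewrite e => -[em]; rewrite -{}em in m0' mD' w.
have w0 : 0 < world K p q by rewrite -w ph_gt0.
have n' : nlt K p q.
  by have [//|[a1 a2]] := world_order r w0; case: n => /(lt_le_trans a1); rewrite ltxx.
have [c [l [fc l0 lD lw [c0 cl]]]] := connecting_geodesic r n'.
have em : l = m by apply: (@ph_inj R K) => //; [exact: ltW|rewrite lw].
rewrite em in cl; split; first by exists c; split=> //; exact: fc.1.
exists (fun t => c (affine true m t)); split=> //.
- by have [] := geodesic_affine true m fc.1.
- by rewrite /affine subr0.
- by rewrite /affine subrr.
Qed.

End ModelTriangles.

(** * Realizers in a Lorentzian pre-length space *)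

Section TimeSeparation.
Variables (R : realType) (X : metricType R) (L : lorentzian_pre_length X).
Implicit Types (x y z p q : X) (g : curve R X) (s t : R).

Lemma chron_gt0 x y : chron L x y -> (0 < tau L x y)%E.
Proof. by move=> /tau_gt0. Qed.

Lemma chron_le x y z : chron L x y -> caus L y z -> chron L x z.
Proof.
move=> h1 h2; apply/tau_gt0; apply: lt_le_trans (tau_triangle (chron_caus h1) h2).
by apply: lt_le_trans (leeDl _ (tau_ge0 _ _ _)); exact: chron_gt0.
Qed.

Lemma le_chron x y z : caus L x y -> chron L y z -> chron L x z.
Proof.
move=> h1 h2; apply/tau_gt0; apply: lt_le_trans (tau_triangle h1 (chron_caus h2)).
by apply: lt_le_trans (leeDr _ (tau_ge0 _ _ _)); exact: chron_gt0.
Qed.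

Lemma chron_irrefl x : (tau L x x < +oo)%E -> ~ chron L x x.
Proof.
move=> f h; have h0 := chron_gt0 h.
have := tau_triangle (caus_refl L x) (caus_refl L x).
move: h0 f; case: (tau L x x) => [r| |] //; rewrite -EFinD !(lte_fin, lee_fin) => r0 _.
lra.
Qed.

Lemma tau_xx x : (tau L x x < +oo)%E -> tau L x x = 0%E.
Proof.
move=> f; apply/eqP; rewrite eq_le tau_ge0 andbT leNgt; apply/negP => h.
by apply: (chron_irrefl f); apply/tau_gt0.
Qed.

Definition tfin x y : R := fine (tau L x y).
Local Notation T := tfin.

Lemma tfin_ge0 x y : 0 <= T x y.
Proof. by apply: fine_ge0; exact: tau_ge0. Qed.

Lemma tfinE x y : (tau L x y < +oo)%E -> tau L x y = (T x y)%:E.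
Proof.
move=> h; rewrite /tfin fineK // fin_numE; apply/andP; split; last by rewrite lt_eqF.
by rewrite gt_eqF // (lt_le_trans _ (tau_ge0 L x y)).
Qed.

Lemma tfin_gt0 x y : (tau L x y < +oo)%E -> (0 < T x y) <-> chron L x y.
Proof. by move=> h; rewrite -lte_fin -tfinE //; exact: tau_gt0. Qed.

Section Additive.
Variables (g : curve R X) (F : R -> R).
Hypothesis HF : forall s t, lo g <= s -> s <= t -> t <= hi g ->
  tau L (g s) (g t) = (F t - F s)%:E.

Lemma additive_sum d (a : R) (r : seq R) : lo g <= a -> last a r <= hi g ->
  path <%O a r ->
  (\sum_(0 <= i < size r) tau L (g (nth d (a :: r) i)) (g (nth d (a :: r) i.+1)))%E
  = (F (last a r) - F a)%:E.
Proof.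
elim: r a => [|b r IH] a la lb /=; first by rewrite big_geq // subrr.
move=> /andP[ab pr]; rewrite big_nat_recl //=.
have bl : b <= last b r.
  by move: pr; rewrite lt_path_sortedE => /andP[/allP h _];
     case: r h {IH lb} => // c r h; apply/ltW/h => /=; rewrite mem_last.
rewrite HF //; [|exact: ltW|exact: le_trans lb].
rewrite -[X in (_ + X)%E]/(\sum_(0 <= i < size r)
  tau L (g (nth d (b :: r) i)) (g (nth d (b :: r) i.+1)))%E.
rewrite IH //; last by exact: le_trans (ltW ab).
by rewrite -EFinD; congr (_%:E); ring.
Qed.

(** All partition sums telescope to the same value. *)
Lemma additive_realizer : future_causal L g -> realizer L g (g (lo g)) (g (hi g)).
Proof.
move=> fg; split=> //.
have lh : lo g < hi g.
  case: fg => -[s [t [/=]]]; rewrite /cdom /= !in_itv /= => /andP[a1 a2] /andP[a3 a4] n _ _.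
  rewrite lt_neqAle (le_trans a1 a2) andbT; apply/eqP => e; apply: n.
  by congr (g _); apply/le_anti; rewrite -{2}e in a2 a4 *; apply/andP; split; lra.
rewrite HF ?lexx ?(ltW lh) //; apply/eqP; rewrite eq_le; apply/andP; split.
  apply: ereal_inf_lbound; exists [:: hi g]; first exact: itv_partition1.
  by rewrite /tau_sum /= big_nat1 HF ?lexx ?(ltW lh).
apply: le_ereal_inf_tmp => _ [r [pr /eqP lr] <-].
rewrite /tau_sum /=.
by have := @additive_sum (hi g) (lo g) r (lexx _) ltac:(by rewrite lr) pr;
  rewrite lr => ->.
Qed.

End Additive.

Section Realizer.
Variables (g : curve R X) (p q : X).
Hypotheses (hg : realizer L g p q) (fpq : (tau L p q < +oo)%E).

Lemma realizer_lt : lo g < hi g.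
Proof.
case: hg => -[[s [t [/=]]]]; rewrite /cdom /= !in_itv /= => /andP[a1 a2] /andP[a3 a4] n _ _ _ _ _.
rewrite lt_neqAle (le_trans a1 a2) andbT; apply/eqP => e; apply: n.
by congr (g _); apply/le_anti; apply/andP; split; rewrite -?e; lra.
Qed.

Lemma realizer_caus s t : lo g <= s -> s <= t -> t <= hi g -> caus L (g s) (g t).
Proof.
move=> h1; rewrite le_eqVlt => /predU1P[->|h2] h3; first exact: caus_refl.
case: hg => -[_ _ h] _ _ _; apply: h => //; rewrite /cdom /= in_itv /=.
  by rewrite h1 (le_trans (ltW h2) h3).
by rewrite h3 (le_trans h1 (ltW h2)).
Qed.

Let E0 : g (lo g) = p. Proof. by case: hg. Qed.
Let E1 : g (hi g) = q. Proof. by case: hg. Qed.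

(** The length is an infimum, hence at most the sum over the partition through [s]. Partition points
    increase strictly, so the ends are treated apart. *)
Lemma realizer_part1 s : lo g <= s -> s <= hi g ->
  (tau L p q <= tau L p (g s) + tau L (g s) q)%E.
Proof.
have lh := realizer_lt.
rewrite le_eqVlt => /predU1P[<- _|ls].
  by rewrite E0; apply: leeDr; exact: tau_ge0.
rewrite le_eqVlt => /predU1P[->|sh].
  by rewrite E1; apply: leeDl; exact: tau_ge0.
case: (hg) => _ _ _ <-; apply: le_trans (ereal_inf_lbound _) _.
  exists [:: s; hi g]; last reflexivity.
  by split; rewrite /= ?ls ?sh ?eqxx.
by rewrite /tau_sum /= big_nat_recl //= big_nat1 /= E0 E1.
Qed.

Lemma realizer_part2 s t : lo g <= s -> s <= t -> t <= hi g ->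
  (tau L p q <= tau L p (g s) + (tau L (g s) (g t) + tau L (g t) q))%E.
Proof.
have lh := realizer_lt => h1 h2 h3.
have tnn := tau_ge0 L.
have [e1|n1] := eqVneq (lo g) s.
  apply: le_trans (realizer_part1 (le_trans h1 h2) h3) _.
  by rewrite -e1 E0; apply: leeDr.
have [e2|n2] := eqVneq s t.
  apply: le_trans (realizer_part1 h1 (le_trans h2 h3)) _.
  by rewrite e2; apply: leeD2l; apply: leeDr.
have [e3|n3] := eqVneq t (hi g).
  apply: le_trans (realizer_part1 h1 (le_trans h2 h3)) _.
  by rewrite e3 E1; apply: leeD2l; apply: leeDl.
have l1 : lo g < s by rewrite lt_neqAle n1.
have l2 : s < t by rewrite lt_neqAle n2.
have l3 : t < hi g by rewrite lt_neqAle n3.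
case: (hg) => _ _ _ <-; apply: le_trans (ereal_inf_lbound _) _.
  exists [:: s; t; hi g]; last reflexivity.
  by split; rewrite /= ?l1 ?l2 ?l3 ?eqxx.
by rewrite /tau_sum /= big_nat_recl //= big_nat_recl //= big_nat1 /= E0 E1.
Qed.

Lemma realizer_fin s t : lo g <= s -> s <= t -> t <= hi g ->
  (tau L (g s) (g t) < +oo)%E.
Proof.
have lh := ltW realizer_lt => h1 h2 h3.
apply: le_lt_trans fpq.
have c1 := realizer_caus (lexx _) h1 (le_trans h2 h3).
have c2 := realizer_caus h1 h2 h3.
have c3 := realizer_caus (le_trans h1 h2) h3 (lexx _).
rewrite E0 in c1; rewrite E1 in c3.
apply: le_trans (tau_triangle c1 (caus_trans c2 c3)).
apply: le_trans (leeDr _ (tau_ge0 _ _ _)).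
by apply: le_trans (tau_triangle c2 c3); apply: leeDl; exact: tau_ge0.
Qed.

(** The bound from a partition through [s] and [t] is opposite to the reverse triangle inequality;
    together they force equality. *)
Lemma realizer_additive s t : lo g <= s -> s <= t -> t <= hi g ->
  tau L (g s) (g t) = (T p (g t) - T p (g s))%:E.
Proof.
have lh := ltW realizer_lt => h1 h2 h3.
have c1 := realizer_caus (lexx _) h1 (le_trans h2 h3).
have c2 := realizer_caus h1 h2 h3.
have c3 := realizer_caus (le_trans h1 h2) h3 (lexx _).
have f1 := realizer_fin (lexx _) h1 (le_trans h2 h3).
have f2 := realizer_fin h1 h2 h3.
have f3 := realizer_fin (le_trans h1 h2) h3 (lexx _).
have f4 := realizer_fin (lexx _) (le_trans h1 h2) h3.
have b2 := realizer_part2 h1 h2 h3.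
have a1 := tau_triangle c1 c2.
have a2 := tau_triangle (caus_trans c1 c2) c3.
rewrite E0 E1 in c1 c3 f1 f3 f4 a1 a2.
move: a1 a2 b2; rewrite (tfinE f1) (tfinE f2) (tfinE f3) (tfinE f4) (tfinE fpq) -!EFinD !lee_fin.
by move=> a1 a2 b2; congr (_%:E); lra.
Qed.

End Realizer.

Definition reparam g (e : bool) (a : R) l h : curve R X :=
  Curve (fun t => g (affine e a t)) l h.

Lemma lipschitz_reparam g e a l h : locally_lipschitz g ->
  (forall t, l <= t <= h -> lo g <= affine e a t <= hi g) ->
  locally_lipschitz (reparam g e a l h).
Proof.
move=> hg hl t ht; have dE (u : R) : cdom (reparam g e a l h) u -> cdom g (affine e a u).
  by rewrite /cdom /= !in_itv /=; exact: hl.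
have [d [C [d0 H]]] := hg _ (dE _ ht).
have nE u v : `|affine e a u - affine e a v| = `|u - v|.
  rewrite /affine; case: (e); last by congr `|_|; ring.
  by rewrite distrC; congr `|_|; ring.
exists d, C; split=> // s s' hs hs' h1 h2.
by have := H _ _ (dE _ hs) (dE _ hs'); rewrite !nE; exact.
Qed.

(** Distinct end points are required because causal curves are non-constant by definition. *)
Lemma sub_realizer g p q e a l h : realizer L g p q -> (tau L p q < +oo)%E ->
  l < h -> e = false -> lo g <= affine e a l -> affine e a h <= hi g ->
  g (affine e a l) <> g (affine e a h) ->
  realizer L (reparam g e a l h) (g (affine e a l)) (g (affine e a h)).
Proof.
move=> hg fpq lh -> h1 h2 ne.
have fc : future_causal L (reparam g false a l h).
  split.
  - by exists l, h; split; rewrite ?/cdom /= ?in_itv /= ?lexx ?(ltW lh).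
  - apply: lipschitz_reparam; first by case: hg => -[].
    by move=> t; rewrite /affine in h1 h2 *; lra.
  - move=> s t; rewrite /cdom /= !in_itv /= => /andP[s1 s2] /andP[t1 t2] st.
    by rewrite /affine in h1 h2 *; apply: (realizer_caus hg); lra.
apply: (additive_realizer (F := fun t => T p (g (affine false a t)))) fc => s t s1 st t2.
by apply: (realizer_additive hg fpq); move: s1 t2; rewrite /affine in h1 h2 * => /= s1 t2; lra.
Qed.

End TimeSeparation.

(** * Comparison triangles and angles *)

Section Arcosh.
Variable R : realType.

Lemma arcosh_le (u v : R) : 1 <= u -> 1 <= v -> (arcosh u <= arcosh v) = (u <= v).
Proof.
have M (x y : R) : 1 <= x -> x < y -> arcosh x < arcosh y.
  move=> x1 xy; rewrite /arcosh ltr_ln ?posrE; last 2 first.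
  - by rewrite ltr_wpDr ?sqrtr_ge0 //; lra.
  - by rewrite ltr_wpDr ?sqrtr_ge0 //; lra.
  by apply: ltr_leD => //; apply: ler_wsqrtr; nra.
move=> u1 v1; case: (leP u v) => [|vu].
  by rewrite le_eqVlt => /predU1P[->|uv]; rewrite ?lexx ?ltW ?M.
by apply/negbTE; rewrite -ltNge M.
Qed.

End Arcosh.

Section Triples.
Variables (R : realType) (X : metricType R) (L : lorentzian_pre_length X) (K : R).
Implicit Types (x y z p q : X) (xb yb zb : model R).
Local Notation T := (tfin L).
Local Notation mtau := (model_tau K).
Local Notation mcaus := (model_caus K).

Definition i0 : 'I_3 := Ordinal (isT : (0 < 3)%N).
Definition i1 : 'I_3 := Ordinal (isT : (1 < 3)%N).
Definition i2 : 'I_3 := Ordinal (isT : (2 < 3)%N).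

Lemma I3_ind (P : 'I_3 -> Prop) : P i0 -> P i1 -> P i2 -> forall i, P i.
Proof.
move=> h0 h1 h2 [[|[|[|i]]] hi] //.
- by rewrite (_ : Ordinal hi = i0) //; exact: val_inj.
- by rewrite (_ : Ordinal hi = i1) //; exact: val_inj.
- by rewrite (_ : Ordinal hi = i2) //; exact: val_inj.
Qed.

Definition pair_cmp x y xb yb : Prop :=
  (caus L x y -> mcaus xb yb) /\ mtau xb yb = tau L x y.

Definition tri_cmp x y z xb yb zb : Prop :=
  [/\ pair_cmp x y xb yb /\ pair_cmp y x yb xb,
      pair_cmp x z xb zb /\ pair_cmp z x zb xb &
      pair_cmp y z yb zb /\ pair_cmp z y zb yb].

Lemma pair_cmp_refl x xb : (tau L x x < +oo)%E -> pair_cmp x x xb xb.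
Proof. by move=> f; split; [left|rewrite mtau_refl tau_xx]. Qed.

Lemma tri_comparison x y z xb yb zb :
  (tau L x x < +oo)%E -> (tau L y y < +oo)%E -> (tau L z z < +oo)%E ->
  tri_cmp x y z xb yb zb ->
  comparison_triangle L K (triple x y z) (tnth [tuple xb; yb; zb]).
Proof.
move=> fx fy fz [[a1 a2] [a3 a4] [a5 a6]].
by do 2 (apply: I3_ind); rewrite /triple /=; do ?[exact: pair_cmp_refl|assumption].
Qed.

Lemma comparison_tri (P : 'I_3 -> X) (Pb : 'I_3 -> model R) :
  comparison_triangle L K P Pb ->
  tri_cmp (P i0) (P i1) (P i2) (Pb i0) (Pb i1) (Pb i2).
Proof. by move=> h; do ![split]; by [apply h|have [] := h i0 i1|have [] := h i1 i0|
  have [] := h i0 i2|have [] := h i2 i0|have [] := h i1 i2|have [] := h i2 i1]. Qed.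

Definition fin2 x y := (tau L x y < +oo)%E /\ (tau L y x < +oo)%E.

Lemma chron_anti x y : (tau L x x < +oo)%E -> chron L x y -> ~ caus L y x.
Proof. by move=> f h1 h2; apply: (chron_irrefl f); exact: chron_le h1 h2. Qed.

Lemma tau0_of_caus x y : (tau L x x < +oo)%E -> caus L x y -> tau L y x = 0%E.
Proof.
move=> f h; apply/eqP; rewrite eq_le tau_ge0 andbT leNgt; apply/negP => /tau_gt0 h2.
by apply: (chron_irrefl f); exact: le_chron h h2.
Qed.

Lemma pair_future x y xb yb l : (tau L x x < +oo)%E -> caus L x y -> 
  (caus L y x -> xb = yb) -> tau L x y = l%:E -> mcaus xb yb -> mtau xb yb = l%:E ->
  pair_cmp x y xb yb /\ pair_cmp y x yb xb.
Proof.
move=> f h h' e c e'; split; split.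
- by [].
- by rewrite e' e.
- by move=> /h' ->; left.
- by rewrite (mtau_anti c) (tau0_of_caus f h).
Qed.

Section Existence.
Variables (x n f : X).
Hypotheses (fxx : (tau L x x < +oo)%E) (fnn : (tau L n n < +oo)%E).
Hypothesis fff : (tau L f f < +oo)%E.

Lemma ordered_future : chron L x n -> chron L x f -> caus L n f ->
  (tau L x n < +oo)%E -> (tau L x f < model_diameter K)%E -> (tau L x f < +oo)%E ->
  (tau L n f < +oo)%E ->
  exists xb nb fb, tri_cmp x n f xb nb fb.
Proof.
move=> h1 h2 h3 f1 s2 f2 f3.
have p1 : 0 < T x n by apply/tfin_gt0.
have p3 : 0 <= T n f by exact: tfin_ge0.
have e1 := tfinE f1; have e2 := tfinE f2; have e3 := tfinE f3.
have t1 : T x n + T n f <= T x f.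
  have := tau_triangle (chron_caus h1) h3.
  by rewrite e1 e2 e3 -EFinD lee_fin.
have D : below_diameter K (T x f) by rewrite /below_diameter -e2.
have [xb [nb [fb [[c1 m1] [c2 m2] [c3 m3] e]]]] := triangle_future p1 p3 t1 D.
exists xb, nb, fb; split.
- by apply: (pair_future fxx (chron_caus h1) _ e1) => // /(chron_anti fxx h1).
- by apply: (pair_future fxx (chron_caus h2) _ e2) => // /(chron_anti fxx h2).
(* In X both [n <= f] and [f <= n] may hold for distinct points, whereas the model relation is
   antisymmetric. The separations from [x] are then equal, and the comparison points were chosen to
   coincide. *)
- apply: (pair_future fnn h3 _ e3) => // h4; apply: e.
  have t2 := tau_triangle (chron_caus h2) h4.
  have z1 := tau0_of_caus fnn h3; have z2 := tau0_of_caus fff h4.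
  move: t2 t1; rewrite z1 adde0 e1 e2 lee_fin.
  have -> : T n f = 0 by rewrite /tfin z2.
  lra.
Qed.

Lemma ordered_past : chron L n x -> chron L f x -> caus L f n ->
  (tau L n x < +oo)%E -> (tau L f x < model_diameter K)%E -> (tau L f x < +oo)%E ->
  (tau L f n < +oo)%E ->
  exists xb nb fb, tri_cmp x n f xb nb fb.
Proof.
move=> h1 h2 h3 f1 s2 f2 f3.
have p1 : 0 < T n x by apply/tfin_gt0.
have p3 : 0 <= T f n by exact: tfin_ge0.
have e1 := tfinE f1; have e2 := tfinE f2; have e3 := tfinE f3.
have t1 : T n x + T f n <= T f x.
  have := tau_triangle h3 (chron_caus h1).
  by rewrite e1 e2 e3 -EFinD lee_fin addrC.
have D : below_diameter K (T f x) by rewrite /below_diameter -e2.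
have [xb [nb [fb [[c1 m1] [c2 m2] [c3 m3] e]]]] := triangle_past p1 p3 t1 D.
exists xb, nb, fb; split.
- by apply/and_comm; apply: (pair_future fnn (chron_caus h1) _ e1) => // /(chron_anti fnn h1).
- by apply/and_comm; apply: (pair_future fff (chron_caus h2) _ e2) => // /(chron_anti fff h2).
- apply/and_comm; apply: (pair_future fff h3 _ e3) => // h4; apply/esym/e.
  have t2 := tau_triangle h4 (chron_caus h2).
  have z1 := tau0_of_caus fff h3; have z2 := tau0_of_caus fnn h4.
  move: t2 t1; rewrite z1 add0e e1 e2 lee_fin.
  have -> : T f n = 0 by rewrite /tfin z2.
  lra.
Qed.

End Existence.

Lemma tri_swap12 x y z xb yb zb : tri_cmp x y z xb yb zb -> tri_cmp y x z yb xb zb.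
Proof. by move=> [[a1 a2] [a3 a4] [a5 a6]]. Qed.

Lemma tri_swap23 x y z xb yb zb : tri_cmp x y z xb yb zb -> tri_cmp x z y xb zb yb.
Proof. by move=> [[a1 a2] [a3 a4] [a5 a6]]. Qed.

(** [angle_defined] unfolded pair by pair, without the indices in ['I_3]. *)
Record triple_ok x y z : Prop := TripleOk {
  ok_xx : (tau L x x < +oo)%E; ok_yy : (tau L y y < +oo)%E; ok_zz : (tau L z z < +oo)%E;
  ok_xy : fin2 x y; ok_xz : fin2 x z; ok_yz : fin2 y z;
  ok_sxy : (tau L x y < model_diameter K)%E /\ (tau L y x < model_diameter K)%E;
  ok_sxz : (tau L x z < model_diameter K)%E /\ (tau L z x < model_diameter K)%E;
  ok_syz : (tau L y z < model_diameter K)%E /\ (tau L z y < model_diameter K)%E;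
  ok_txy : timelike_related L x y; ok_txz : timelike_related L x z;
  ok_cyz : causally_related L y z }.

Lemma tau_xx_small x : (tau L x x < +oo)%E -> (tau L x x < model_diameter K)%E.
Proof. by move=> /tau_xx ->; exact: diameter_gt0. Qed.

Lemma tl_caus x y : timelike_related L x y -> causally_related L x y.
Proof. by case=> /chron_caus; [left|right]. Qed.

Lemma tr_C x y : causally_related L x y -> causally_related L y x.
Proof. by case; [right|left]. Qed.

Lemma angle_definedP x y z : angle_defined L K x y z <-> triple_ok x y z.
Proof.
split.
  move=> [h1 h2 h3 h4 h5]; rewrite /finite_separations /size_bounds in h2 h3.
  split=> //; do ?split; by [exact: (h2 i0 i0)|exact: (h2 i1 i1)|exact: (h2 i2 i2)
   |exact: (h2 i0 i1)|exact: (h2 i1 i0)|exact: (h2 i0 i2)|exact: (h2 i2 i0)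
   |exact: (h2 i1 i2)|exact: (h2 i2 i1)|exact: (h3 i0 i1)|exact: (h3 i1 i0)
   |exact: (h3 i0 i2)|exact: (h3 i2 i0)|exact: (h3 i1 i2)|exact: (h3 i2 i1)
   |exact: (h1 i1 i2)].
move=> [fx fy fz [a1 a2] [a3 a4] [a5 a6] [b1 b2] [b3 b4] [b5 b6] t1 t2 c].
have r u : causally_related L u u by left; exact: caus_refl.
have k1 := tl_caus t1; have k2 := tl_caus t2.
have k3 := tr_C k1; have k4 := tr_C k2; have k5 := tr_C c.
have s1 := tau_xx_small fx; have s2 := tau_xx_small fy; have s3 := tau_xx_small fz.
by split=> //; do 2 (apply: I3_ind); rewrite /triple //=.
Qed.

(** If [x] is an end of the triangle it is the vertex of the model hinge; if it lies between the
    other two, the earliest point takes that role. *)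
Lemma comparison_exists x y z : triple_ok x y z ->
  exists xb yb zb, tri_cmp x y z xb yb zb.
Proof.
move=> [fx fy fz [a1 a2] [a3 a4] [a5 a6] [b1 b2] [b3 b4] [b5 b6] t1 t2 c].
case: t1 t2 => h1 [] h2.
- case: c => h3.
    exact: (ordered_future fx fy fz).
  have [xb [nb [fb h]]] := ordered_future fx fz fy h2 h1 h3 a3 b1 a1 a6.
  by exists xb, fb, nb; exact: tri_swap23.
- have [zb [xb [yb h]]] := ordered_future fz fx fy h2 (chron_trans h2 h1) (chron_caus h1)
    a4 b6 a6 a1.
  by exists xb, yb, zb; apply: tri_swap23; apply: tri_swap12.
- have [yb [xb [zb h]]] := ordered_future fy fx fz h1 (chron_trans h1 h2) (chron_caus h2)
    a2 b5 a5 a3.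
  by exists xb, yb, zb; apply: tri_swap12.
- case: c => h3; last exact: (ordered_past fy fz h1 h2 h3 a2 b4 a4 a6).
  have [xb [nb [fb h]]] := ordered_past fz fy h2 h1 h3 a4 b2 a2 a5.
  by exists xb, fb, nb; exact: tri_swap23.
Qed.

(* One of the two terms vanishes for causally related points. *)
Definition tsep x y : R := T x y + T y x.

Lemma tsepC x y : tsep x y = tsep y x. Proof. exact: addrC. Qed.

Lemma sep_cmp x y xb yb : pair_cmp x y xb yb -> pair_cmp y x yb xb ->
  sep K xb yb = tsep x y.
Proof. by move=> [_ e1] [_ e2]; rewrite /sep /tsep /tfin e1 e2. Qed.

Lemma pair_related x y xb yb : pair_cmp x y xb yb -> pair_cmp y x yb xb ->
  causally_related L x y -> mcaus xb yb \/ mcaus yb xb.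
Proof. by move=> [h1 _] [h2 _] [/h1|/h2]; [left|right]. Qed.

Lemma tsep_chron x y : fin2 x y -> (tau L x x < +oo)%E -> chron L x y ->
  tsep x y = T x y /\ 0 < tsep x y.
Proof.
move=> [f1 f2] fx h; rewrite /tsep.
have -> : T y x = 0 by rewrite /tfin (tau0_of_caus fx (chron_caus h)).
by rewrite addr0; split=> //; apply/tfin_gt0.
Qed.

Lemma tsep_gt0 x y : fin2 x y -> timelike_related L x y -> 0 < tsep x y.
Proof.
move=> [f1 f2] [h|h]; rewrite /tsep.
- by rewrite ltr_pwDl ?tfin_ge0 //; apply/tfin_gt0.
- by rewrite ltr_pwDr ?tfin_ge0 //; apply/tfin_gt0.
Qed.

Lemma tsep_ge0 x y : 0 <= tsep x y.
Proof. by rewrite addr_ge0 ?tfin_ge0. Qed.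

Lemma tsep_below x y : fin2 x y -> (tau L x x < +oo)%E ->
  (tau L x y < model_diameter K)%E -> (tau L y x < model_diameter K)%E ->
  below_diameter K (tsep x y).
Proof.
move=> [f1 f2] fx s1 s2; rewrite /tsep.
have [c|n] := pselect (caus L x y).
  have -> : T y x = 0 by rewrite /tfin (tau0_of_caus fx c).
  by rewrite addr0 /below_diameter -tfinE.
have -> : T x y = 0.
  apply/eqP; rewrite eq_le tfin_ge0 andbT leNgt; apply/negP => /(tfin_gt0 f1) h.
  by apply: n; exact: chron_caus.
by rewrite add0r /below_diameter -tfinE.
Qed.

Lemma pair_world x y xb yb : pair_cmp x y xb yb -> pair_cmp y x yb xb ->
  causally_related L x y ->
  (tau L x y < model_diameter K)%E -> (tau L y x < model_diameter K)%E ->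
  world K xb yb = ph K (tsep x y).
Proof.
move=> p1 p2 c s1 s2; rewrite -(sep_cmp p1 p2).
have := pair_related p1 p2 c; case: p1 p2 => _ e1 [_ e2] h.
by have [] := sep_world h; rewrite ?e1 ?e2.
Qed.

Lemma related_geodesic u v ub vb : pair_cmp u v ub vb -> pair_cmp v u vb ub ->
  timelike_related L u v -> fin2 u v -> (tau L u v < model_diameter K)%E ->
  (tau L v u < model_diameter K)%E -> exists c l, geodesic_from_to K c l ub vb.
Proof.
move=> [_ e1] [_ e2] [] h1 [f1 f2] s1 s2.
- have [|||[c g] _] := @timelike_geodesics R K ub vb (T u v).
  + by rewrite e1 tfinE.
  + exact/tfin_gt0.
  + by rewrite /below_diameter -tfinE.
  by exists c, (T u v).
- have [|||_ [c g]] := @timelike_geodesics R K vb ub (T v u).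
  + by rewrite e2 tfinE.
  + exact/tfin_gt0.
  + by rewrite /below_diameter -tfinE.
  by exists c, (T v u).
Qed.

Section Angle.
Variables x y z : X.
Hypothesis ok : triple_ok x y z.
Let l1 := tsep x y.
Let l2 := tsep x z.
Let m := tsep y z.

Lemma ok_lengths : [/\ 0 < l1, 0 < l2, below_diameter K l1 & below_diameter K l2].
Proof.
case: ok => *; split; rewrite /l1 /l2.
- exact: tsep_gt0.
- exact: tsep_gt0.
- by apply: tsep_below => //; case: (ok_sxy ok).
- by apply: tsep_below => //; case: (ok_sxz ok).
Qed.

(** By the law of cosines the product of the initial velocities is determined by the three
    separations, whatever comparison triangle and geodesics are chosen. *)
Lemma angle_unique a : is_comparison_angle L K x y z a ->
  a = arcosh `|hingeB K l1 l2 m|.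
Proof.
move=> [xb [yb [zb [c1 [c2 [k1 [k2 [/comparison_tri h g1 g2 ->]]]]]]]].
move: h => [[a1 a2] [a3 a4] [a5 a6]].
have [s1 s2] := ok_sxy ok; have [s3 s4] := ok_sxz ok; have [s5 s6] := ok_syz ok.
have [l10 l20 D1 D2] := ok_lengths.
have [_ e1 _] := geodesic_length g1 ltac:(by rewrite a1.2) ltac:(by rewrite a2.2).
have [_ e2 _] := geodesic_length g2 ltac:(by rewrite a3.2) ltac:(by rewrite a4.2).
have {}e1 : k1 = l1 by rewrite -e1 (sep_cmp a1 a2).
have {}e2 : k2 = l2 by rewrite -e2 (sep_cmp a3 a4).
have w := pair_world a5 a6 (ok_cyz ok) s5 s6.
case: g1 g2 => h1 _ c10 c1l [h2 _ c20 c2l].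
congr (arcosh `|_|); apply: (hingeF_inj l10 l20 D1 D2).
rewrite hingeBK // -hinge_world //; last by rewrite c10 c20.
by rewrite -e1 -e2 c1l c2l; exact: w.
Qed.

Lemma angle_value : comparison_angle L K x y z = arcosh `|hingeB K l1 l2 m|.
Proof.
apply: angle_unique; rewrite /comparison_angle; apply: xgetPex.
have [xb [yb [zb h]]] := comparison_exists ok.
have [[a1 a2] [a3 a4] [a5 a6]] := h.
have [s1 s2] := ok_sxy ok; have [s3 s4] := ok_sxz ok.
have [c1 [k1 g1]] := related_geodesic a1 a2 (ok_txy ok) (ok_xy ok) s1 s2.
have [c2 [k2 g2]] := related_geodesic a3 a4 (ok_txz ok) (ok_xz ok) s3 s4.
exists (arcosh `| b (velocity K c1 0) (velocity K c2 0) |).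
exists xb, yb, zb, c1, c2, k1, k2; split=> //.
by apply: tri_comparison h; [exact: (ok_xx ok)|exact: (ok_yy ok)|exact: (ok_zz ok)].
Qed.

(** When [x] is an end of the triangle, the reverse triangle inequality reads m <= |l1 - l2|; when
    it lies in the middle, it reads l1 + l2 <= m. So the sign of the angle is the sign of
    [hingeB]. *)
Lemma angle_sign_hinge :
  (angle_sign L x y z = -1 /\ hingeB K l1 l2 m <= -1) \/
  (angle_sign L x y z = 1 /\ 1 <= hingeB K l1 l2 m).
Proof.
have [l10 l20 D1 D2] := ok_lengths.
have := ok; case=> fx fy fz xy xz yz [s1 s2] [s3 s4] [s5 s6] t1 t2 c.
have N u v w : fin2 u v -> fin2 u w -> fin2 v w -> (tau L u u < +oo)%E ->
   (tau L v v < +oo)%E -> chron L u v -> chron L u w -> caus L v w ->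
   tsep v w <= tsep u w - tsep u v.
  move=> f1 f2 f3 fu fv h1 h2 h3.
  have [-> _] := tsep_chron f1 fu h1; have [-> _] := tsep_chron f2 fu h2.
  rewrite /tsep; have -> : T w v = 0 by rewrite /tfin (tau0_of_caus fv h3).
  have := tau_triangle (chron_caus h1) h3.
  rewrite (tfinE f1.1) (tfinE f2.1) (tfinE f3.1) -EFinD lee_fin => t0.
  by rewrite addr0 lerBrDl.
have P u v w : fin2 u v -> fin2 u w -> fin2 v w -> (tau L v v < +oo)%E ->
   (tau L w w < +oo)%E -> chron L v u -> chron L w u -> caus L v w ->
   tsep v w <= tsep u v - tsep u w.
  move=> [f1 f1'] [f2 f2'] f3 fv fw h1 h2 h3.
  rewrite (tsepC u v) (tsepC u w).
  have [-> _] := tsep_chron (conj f1' f1) fv h1.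
  have [-> _] := tsep_chron (conj f2' f2) fw h2.
  rewrite /tsep; have -> : T w v = 0 by rewrite /tfin (tau0_of_caus fv h3).
  have := tau_triangle h3 (chron_caus h2).
  rewrite (tfinE f1') (tfinE f2') (tfinE f3.1) -EFinD lee_fin => t0.
  by rewrite addr0 lerBrDr.
have S v w : fin2 v w -> fin2 w v by case.
have m0 : 0 <= m by exact: tsep_ge0.
have nab (u v w : R) : w <= u - v -> w <= `|u - v|.
  by move=> h; exact: le_trans h (ler_norm _).
rewrite /angle_sign; case: t1 t2 => h1 [] h2.
- left; rewrite asboolT; last by left.
  split=> //; apply: hingeB_le1 => //; case: c => h3.
    by rewrite distrC; apply: nab; exact: N.
  by apply: nab; rewrite /m tsepC; apply: N => //; exact: S.
- right; rewrite asboolF; last by move=> [[_ h]|[h _]]; [apply: (chron_anti fz h2 (chron_caus h))|apply: (chron_anti fx h1 (chron_caus h))].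
  split=> //; apply: hingeB_ge1 => //.
    have [e1 _] := tsep_chron xy fx h1; have [e2 _] := tsep_chron (S _ _ xz) fz h2.
    have [e3 _] := tsep_chron (S _ _ yz) fz (chron_trans h2 h1).
    rewrite /l1 /l2 /m e1 (tsepC x z) e2 (tsepC y z) e3.
    have := tau_triangle (chron_caus h2) (chron_caus h1).
    rewrite (tfinE xz.2) (tfinE xy.1) (tfinE yz.2) -EFinD lee_fin => t0.
    by rewrite addrC.
  exact: tsep_below.
- right; rewrite asboolF; last by move=> [[h _]|[_ h]]; [apply: (chron_anti fy h1 (chron_caus h))|apply: (chron_anti fx h2 (chron_caus h))].
  split=> //; apply: hingeB_ge1 => //.
    have [e1 _] := tsep_chron (S _ _ xy) fy h1; have [e2 _] := tsep_chron xz fx h2.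
    have [e3 _] := tsep_chron yz fy (chron_trans h1 h2).
    rewrite /l1 /l2 /m e2 (tsepC x y) e1 e3.
    have := tau_triangle (chron_caus h1) (chron_caus h2).
    rewrite (tfinE xy.2) (tfinE xz.1) (tfinE yz.1) -EFinD lee_fin => t0.
    by [].
  exact: tsep_below.
- left; rewrite asboolT; last by right.
  split=> //; apply: hingeB_le1 => //; case: c => h3.
    by apply: nab; exact: P.
  by rewrite distrC; apply: nab; rewrite /m tsepC; apply: P => //; exact: S.
Qed.

End Angle.

(** Once the signs agree, the signed angle is arcosh B for B >= 1 or - arcosh (- B) for B <= -1, and
    both increase with B. *)
Lemma signed_angle_le x y z y' z' : triple_ok x y z -> triple_ok x y' z' ->
  angle_sign L x y z = angle_sign L x y' z' ->
  (signed_angle L K x y z <= signed_angle L K x y' z') =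
  (hingeB K (tsep x y) (tsep x z) (tsep y z) <=
   hingeB K (tsep x y') (tsep x z') (tsep y' z')).
Proof.
move=> o1 o2; rewrite /signed_angle (angle_value o1) (angle_value o2).
set B := hingeB _ _ _ _; set B' := hingeB _ _ _ _.
have := angle_sign_hinge o1; have := angle_sign_hinge o2; rewrite -/B -/B'.
move=> [] [-> h1] [] [-> h2] e; try by (exfalso; lra).
- rewrite !mulN1r lerN2 arcosh_le; first by rewrite !ler0_norm ?lerN2 //; lra.
    by rewrite ler0_norm; lra.
  by rewrite ler0_norm; lra.
- rewrite !mul1r arcosh_le; first by rewrite !ger0_norm //; lra.
    by rewrite ger0_norm; lra.
  by rewrite ger0_norm; lra.
Qed.

End Triples.

(** Stated for an abstract preorder because it is used both in X and in the model: three pairwise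
    comparable points have a least and a greatest among them. *)
Lemma chain_bounds (A : Type) (le sz : A -> A -> Prop) (x y z : A) :
  (forall u, le u u) -> (forall u v w, le u v -> le v w -> le u w) ->
  le x y \/ le y x -> le x z \/ le z x -> le y z \/ le z y ->
  sz x x -> sz y y -> sz z z -> sz x y /\ sz y x -> sz x z /\ sz z x ->
  sz y z /\ sz z y ->
  exists m M, sz m M /\ [/\ le m x, le m y & le m z] /\ [/\ le x M, le y M & le z M].
Proof.
move=> r t [] h1 [] h2 [] h3 s1 s2 s3 [s4 s5] [s6 s7] [s8 s9].
- by exists x, z.
- by exists x, y.
- by exists z, y; have h := t _ _ _ h2 h1.
- by exists z, y.
- by exists y, z.
- by exists y, z; have h := t _ _ _ h1 h2.
- by exists y, x.
- by exists z, x.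
Qed.

Section ModelHinge.
Variables (R : realType) (K : R).
Local Notation mtau := (model_tau K).
Local Notation mcaus := (model_caus K).
Implicit Types (p q m M : model R) (c : R -> model R).

Lemma mtau_diamond m M p q : (mtau m M < model_diameter K)%E ->
  mcaus m p -> mcaus p M -> mcaus m q -> mcaus q M ->
  rng K p q /\ (mtau p q < model_diameter K)%E.
Proof.
move=> s h1 h2 h3 h4.
have [r _ _] := mtau_world (mcaus_trans h1 h2) s.
split; first by apply: (rng_diamond r); exact: mcaus_nle.
have [c|n] := pselect (mcaus p q); last first.
  suff -> : mtau p q = 0%E by exact: diameter_gt0.
  apply/eqP; rewrite eq_le mtau_ge0 andbT leNgt; apply/negP => h.
  by apply: n; exact: mtau_gt0_caus.
apply: le_lt_trans s; apply: le_trans (mtau_triangle h1 h2).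
apply: le_trans (leeDr _ (mtau_ge0 _ _ _)); apply: le_trans (mtau_triangle c h4).
by apply: leeDl; exact: mtau_ge0.
Qed.

Lemma geodesic_between c l s : geodesic_from_to K c l (c 0) (c l) ->
  0 <= s <= l ->
  (mcaus (c 0) (c s) /\ mcaus (c s) (c l)) \/ (mcaus (c l) (c s) /\ mcaus (c s) (c 0)).
Proof.
move=> [hc l0 _ _] /andP[s0 sl]; have [fc|fc] := geodesic_direction hc.
  by left; split; exact: future_caus.
right; have h1 := future_caus fc (r := - l) (s := - s) ltac:(lra).
have h2 := future_caus fc (r := - s) (s := 0) ltac:(lra).
have e (u : R) : affine true 0 (- u) = u by rewrite /affine; ring.
by move: h1 h2; rewrite !e /affine subr0.
Qed.

End ModelHinge.

Section HingePackage.
Variables (R : realType) (X : metricType R) (L : lorentzian_pre_length X) (K : R).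
Local Notation mtau := (model_tau K).
Local Notation mcaus := (model_caus K).
Local Notation T := (tfin L).
Implicit Types (x y z : X).

(** Points on the two sides lie in the diamond spanned by the least and the greatest vertex, which
    keeps them in range of one another and at separations below D_K. *)
Lemma model_hinge x y z xb yb zb c1 c2 k1 k2 : triple_ok L K x y z ->
  tri_cmp L K x y z xb yb zb ->
  geodesic_from_to K c1 k1 xb yb -> geodesic_from_to K c2 k2 xb zb ->
  [/\ k1 = tsep L x y, k2 = tsep L x z & forall s t, 0 <= s <= k1 -> 0 <= t <= k2 ->
    [/\ world K (c1 s) (c2 t) = hingeF K s t (hingeB K k1 k2 (tsep L y z)),
        rng K (c1 s) (c2 t), (mtau (c1 s) (c2 t) < model_diameter K)%E &
        (mtau (c2 t) (c1 s) < model_diameter K)%E]].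
Proof.
move=> ok h g1 g2; have [[a1 a2] [a3 a4] [a5 a6]] := h.
have [s1 s2] := ok_sxy ok; have [s3 s4] := ok_sxz ok; have [s5 s6] := ok_syz ok.
have [l10 l20 D1 D2] := ok_lengths ok.
have [_ e1 _] := geodesic_length g1 ltac:(by rewrite a1.2) ltac:(by rewrite a2.2).
have [_ e2 _] := geodesic_length g2 ltac:(by rewrite a3.2) ltac:(by rewrite a4.2).
have {}e1 : k1 = tsep L x y by rewrite -e1 (sep_cmp a1 a2).
have {}e2 : k2 = tsep L x z by rewrite -e2 (sep_cmp a3 a4).
split=> // s t hs ht.
have w := pair_world a5 a6 (ok_cyz ok) s5 s6.
have r1 := pair_related a1 a2 (tl_caus (ok_txy ok)).
have r2 := pair_related a3 a4 (tl_caus (ok_txz ok)).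
have r3 := pair_related a5 a6 (ok_cyz ok).
have [h1 _ c10 c1l] := g1; have [h2 _ c20 c2l] := g2.
have bv : b (velocity K c1 0) (velocity K c2 0) = hingeB K k1 k2 (tsep L y z).
  rewrite -e1 in l10 D1; rewrite -e2 in l20 D2.
  apply: (hingeF_inj l10 l20 D1 D2); rewrite hingeBK // -hinge_world //.
    by rewrite c1l c2l.
  by rewrite c10 c20.
have [|||||||m [M [sM [[m1 m2 m3] [M1 M2 M3]]]]] :=
  @chain_bounds _ mcaus (fun p q => (mtau p q < model_diameter K)%E) xb yb zb _
   (fun u v w h h' => mcaus_trans h h') r1 r2 r3.
- by left.
- by rewrite mtau_refl; exact: diameter_gt0.
- by rewrite mtau_refl; exact: diameter_gt0.
- by rewrite mtau_refl; exact: diameter_gt0.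
- by rewrite a1.2 a2.2.
- by rewrite a3.2 a4.2.
- by rewrite a5.2 a6.2.
have [b1 b2] : mcaus m (c1 s) /\ mcaus (c1 s) M.
  have g1' : geodesic_from_to K c1 k1 (c1 0) (c1 k1) by rewrite c10 c1l.
  have [[u v]|[u v]] := geodesic_between g1' hs; rewrite c10 c1l in u v.
    by split; [exact: mcaus_trans u|exact: mcaus_trans M2].
  by split; [exact: mcaus_trans u|exact: mcaus_trans M1].
have [b3 b4] : mcaus m (c2 t) /\ mcaus (c2 t) M.
  have g2' : geodesic_from_to K c2 k2 (c2 0) (c2 k2) by rewrite c20 c2l.
  have [[u v]|[u v]] := geodesic_between g2' ht; rewrite c20 c2l in u v.
    by split; [exact: mcaus_trans u|exact: mcaus_trans M3].
  by split; [exact: mcaus_trans u|exact: mcaus_trans M1].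
have [rg t1] := mtau_diamond sM b1 b2 b3 b4.
have [_ t2] := mtau_diamond sM b3 b4 b1 b2.
split=> //; rewrite hinge_world //; first by rewrite bv.
by rewrite c10 c20.
Qed.

Lemma tau_diamond m M x y : (tau L m M < model_diameter K)%E ->
  caus L m x -> caus L x M -> caus L m y -> caus L y M ->
  (tau L x y < model_diameter K)%E.
Proof.
move=> s h1 h2 h3 h4.
have [c|n] := pselect (caus L x y); last first.
  suff -> : tau L x y = 0%E by exact: diameter_gt0.
  apply/eqP; rewrite eq_le tau_ge0 andbT leNgt; apply/negP => /tau_gt0 h.
  by apply: n; exact: chron_caus.
apply: le_lt_trans s; apply: le_trans (tau_triangle h1 h2).
apply: le_trans (leeDr _ (tau_ge0 _ _ _)); apply: le_trans (tau_triangle c h4).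
by apply: leeDl; exact: tau_ge0.
Qed.

Definition between x y q := (caus L x q /\ caus L q y) \/ (caus L y q /\ caus L q x).

Lemma ok_diamond x y z q q' : triple_ok L K x y z -> between x y q -> between x z q' ->
  (tau L q q' < model_diameter K)%E /\ (tau L q' q < model_diameter K)%E.
Proof.
move=> ok h1 h2.
have [|||||||m [M [sM [[m1 m2 m3] [M1 M2 M3]]]]] :=
  @chain_bounds _ (caus L) (fun p q => (tau L p q < model_diameter K)%E) x y z _
   (fun u v w h h' => caus_trans h h') (tl_caus (ok_txy ok)) (tl_caus (ok_txz ok)) (ok_cyz ok).
- exact: caus_refl.
- exact: tau_xx_small (ok_xx ok).
- exact: tau_xx_small (ok_yy ok).
- exact: tau_xx_small (ok_zz ok).
- exact: ok_sxy ok.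
- exact: ok_sxz ok.
- exact: ok_syz ok.
have [b1 b2] : caus L m q /\ caus L q M.
  by case: h1 => -[u v]; split; [exact: caus_trans u|exact: caus_trans v _|
    exact: caus_trans u|exact: caus_trans v _].
have [b3 b4] : caus L m q' /\ caus L q' M.
  by case: h2 => -[u v]; split; [exact: caus_trans u|exact: caus_trans v _|
    exact: caus_trans u|exact: caus_trans v _].
by split; exact: (tau_diamond sM).
Qed.

End HingePackage.

(** * From curvature bounds to monotonicity *)

Section VertexComparison.
Variables (R : realType) (X : metricType R) (L : lorentzian_pre_length X) (K : R).
Variables (cmp : rel (\bar R)) (U : set X).
Hypothesis fU : forall x y, U x -> U y -> (tau L x y < +oo)%E.
Hypothesis gU : forall x y, U x -> U y -> chron L x y ->
  exists g, Defs.in_set g U /\ realizer L g x y.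
Hypothesis HT : triangle_comparison L K cmp U.
Local Notation mtau := (model_tau K).
Implicit Types (x y z q : X) (G : curve R X).

(** Only the index pairs (0, 1), (0, 2) and (1, 2) matter; the other values are arbitrary. *)
Definition sides3 (g01 g02 g12 : curve R X) (i j : 'I_3) : curve R X :=
  if i == i0 then (if j == i1 then g01 else g02) else g12.

Section Sorted.
Variables (p0 p1 p2 : X) (g01 g02 g12 : curve R X) (b0 b1 b2 : model R).
Hypotheses (U0 : U p0) (U1 : U p1) (U2 : U p2).
Hypotheses (c01 : chron L p0 p1) (c12 : chron L p1 p2).
Hypotheses (r01 : realizer L g01 p0 p1) (r02 : realizer L g02 p0 p2)
  (r12 : realizer L g12 p1 p2).
Hypotheses (u01 : Defs.in_set g01 U) (u02 : Defs.in_set g02 U) (u12 : Defs.in_set g12 U).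
Hypothesis sz : forall i j, (tau L (triple p0 p1 p2 i) (triple p0 p1 p2 j) < model_diameter K)%E.
Hypothesis ht : tri_cmp L K p0 p1 p2 b0 b1 b2.

Lemma sorted_comparison (i j k l : 'I_3) (s t : R) (q1b q2b : model R) :
  (i < j)%N -> (k < l)%N ->
  let P := triple p0 p1 p2 in let Pb := tnth [tuple b0; b1; b2] in
  let S := sides3 g01 g02 g12 in
  cdom (S i j) s -> cdom (S k l) t ->
  corresponds L K (P i) (S i j s) (Pb i) (Pb j) q1b ->
  corresponds L K (P k) (S k l t) (Pb k) (Pb l) q2b ->
  cmp (tau L (S i j s) (S k l t)) (mtau q1b q2b).
Proof.
move=> ij kl P Pb S; apply: (HT (p := P) (side := S) (pb := Pb)) => //.
- split.
  + by do 2 apply: I3_ind => //; move=> _; [exact: chron_trans c12].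
  + by do 2 apply: I3_ind; apply: fU.
  + by do 2 apply: I3_ind.
- by do 2 apply: I3_ind.
- by apply: tri_comparison => //; exact: fU.
Qed.

End Sorted.

Lemma corresponds_lo x xb yb c l : tau L x x = 0%E -> geodesic_from_to K c l xb yb ->
  corresponds L K x x xb yb xb.
Proof.
move=> e g; split; last by rewrite mtau_refl e.
exists c, l, 0; split=> //; first by rewrite lexx; case: g => _ /ltW.
by case: g.
Qed.

Lemma corresponds_hi x y xb yb c l : mtau xb yb = tau L x y ->
  geodesic_from_to K c l xb yb -> corresponds L K x y xb yb yb.
Proof.
move=> e g; split; last exact: e.
exists c, l, l; split=> //; first by rewrite lexx andbT; case: g => _ /ltW.
by case: g.
Qed.

Lemma chron_geodesic x y xb yb : (tau L x y < +oo)%E ->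
  (tau L x y < model_diameter K)%E -> chron L x y ->
  pair_cmp L K x y xb yb -> exists c l, geodesic_from_to K c l xb yb.
Proof.
move=> f s h [_ e].
have [|||[c g] _] := @timelike_geodesics R K xb yb (tfin L x y).
- by rewrite e tfinE.
- exact/tfin_gt0.
- by rewrite /below_diameter -tfinE.
by exists c, (tfin L x y).
Qed.

(** The second point [z] is a vertex, so it is an end point of some side of the triangle sorted by
    time. There are three cases, with [z] before [x], after [y], or between them. *)
Lemma vertex_comparison x y z xb yb zb q qb G u :
  U x -> U y -> U z -> chron L x y -> triple_ok L K x y z -> timelike_related L y z ->
  tri_cmp L K x y z xb yb zb ->
  realizer L G x y -> Defs.in_set G U -> cdom G u -> G u = q ->
  corresponds L K x q xb yb qb ->
  cmp (tau L q z) (mtau qb zb) /\ cmp (tau L z q) (mtau zb qb).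
Proof.
move=> Ux Uy Uz cxy ok tyz h rG uG Gu <- hq.
have [[a1 a2] [a3 a4] [a5 a6]] := h.
have [s1 s2] := ok_sxy ok; have [s3 s4] := ok_sxz ok; have [s5 s6] := ok_syz ok.
have x1 := tau_xx_small K (ok_xx ok); have x2 := tau_xx_small K (ok_yy ok).
have x3 := tau_xx_small K (ok_zz ok).
have lo_in g p' q' : realizer L g p' q' -> cdom g (lo g).
  by move=> r; rewrite /cdom /= in_itv /= lexx /= ltW // (realizer_lt r).
have hi_in g p' q' : realizer L g p' q' -> cdom g (hi g).
  by move=> r; rewrite /cdom /= in_itv /= lexx andbT ltW // (realizer_lt r).
case: (ok_txz ok) => [cxz|czx]; last first.
  have [g01 [u01 r01]] := gU Uz Ux czx.
  have [g02 [u02 r02]] := gU Uz Uy (chron_trans czx cxy).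
  have H := @sorted_comparison z x y g01 g02 G zb xb yb Uz Ux Uy czx cxy r01 r02 rG u01 u02 uG
    ltac:(by do 2 apply: I3_ind) (tri_swap12 (tri_swap23 h)).
  have [c [l g]] := chron_geodesic (fU Uz Ux) s4 czx a4.
  have z0 := tau_xx (ok_zz ok).
  have cz := corresponds_lo z0 g.
  have ez : g01 (lo g01) = z by case: r01.
  split.
  - have := H i1 i2 i0 i1 u (lo g01) qb zb isT isT; rewrite /= ez; apply=> //.
    exact: lo_in r01.
  - have := H i0 i1 i1 i2 (lo g01) u zb qb isT isT; rewrite /= ez; apply=> //.
    exact: lo_in r01.
case: tyz => [cyz|czy].
  have [g02 [u02 r02]] := gU Ux Uz cxz.
  have [g12 [u12 r12]] := gU Uy Uz cyz.
  have H := @sorted_comparison x y z G g02 g12 xb yb zb Ux Uy Uz cxy cyz rG r02 r12 uG u02 u12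
    ltac:(by do 2 apply: I3_ind) h.
  have [c [l g]] := chron_geodesic (fU Ux Uz) s3 cxz a3.
  have cz := corresponds_hi a3.2 g.
  have ez : g02 (hi g02) = z by case: r02.
  split.
  - have := H i0 i1 i0 i2 u (hi g02) qb zb isT isT; rewrite /= ez; apply=> //.
    exact: hi_in r02.
  - have := H i0 i2 i0 i1 (hi g02) u zb qb isT isT; rewrite /= ez; apply=> //.
    exact: hi_in r02.
have [g01 [u01 r01]] := gU Ux Uz cxz.
have [g12 [u12 r12]] := gU Uz Uy czy.
have H := @sorted_comparison x z y g01 G g12 xb zb yb Ux Uz Uy cxz czy r01 rG r12 u01 uG u12
  ltac:(by do 2 apply: I3_ind) (tri_swap23 h).
have [c [l g]] := chron_geodesic (fU Ux Uz) s3 cxz a3.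
have cz := corresponds_hi a3.2 g.
have ez : g01 (hi g01) = z by case: r01.
split.
- have := H i0 i2 i0 i1 u (hi g01) qb zb isT isT; rewrite /= ez; apply=> //.
  exact: hi_in r01.
- have := H i0 i1 i0 i2 (hi g01) u zb qb isT isT; rewrite /= ez; apply=> //.
  exact: hi_in r01.
Qed.

End VertexComparison.

(** * Rays: realizers parametrized from a vertex *)

Section Rays.
Variables (R : realType) (X : metricType R) (L : lorentzian_pre_length X).
Variable U : set X.
Hypothesis oU : open U.
Hypothesis fcU : tau_finite_continuous L U.
Local Notation T := (tfin L).
Implicit Types (x y z q : X) (G g al : curve R X) (r : R -> X) (s t a : R) (e : bool).

Lemma U_fin x y : U x -> U y -> (tau L x y < +oo)%E.
Proof. by move=> hx hy; exact: fcU.1. Qed.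

Lemma U_fin2 x y : U x -> U y -> fin2 L x y.
Proof. by move=> hx hy; split; exact: U_fin. Qed.

Lemma tfin_continuous (r1 r2 : R -> X) s : {for s, continuous r1} ->
  {for s, continuous r2} -> U (r1 s) -> U (r2 s) ->
  {for s, continuous (fun t => T (r1 t) (r2 t))}.
Proof.
move=> c1 c2 u1 u2; have [fu] := fcU.
have oUU : open (U `*` U).
  rewrite openE => -[p q] [/= up uq]; exists (U, U); last by case.
  by split; apply: open_nbhs_nbhs.
rewrite continuous_open_subspace //.
move=> /(_ (r1 s, r2 s)); rewrite inE => /(_ (conj u1 u2)) ct.
have cp : {for s, continuous (fun t => (r1 t, r2 t))}.
  exact: (cvg_pair c1 c2).
have := cvg_comp _ _ cp ct; rewrite /= (tfinE (fu _ _ u1 u2)) => h.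
exact: (@fine_cvg _ _ (nbhs s) _ (fun t => tau L (r1 t) (r2 t)) _ h).
Qed.

Lemma tsep_continuous (r1 r2 : R -> X) s : {for s, continuous r1} ->
  {for s, continuous r2} -> U (r1 s) -> U (r2 s) ->
  {for s, continuous (fun t => tsep L (r1 t) (r2 t))}.
Proof. by move=> *; apply: ct_add; exact: tfin_continuous. Qed.

Definition directed_chron e x y := if e then chron L x y else chron L y x.
Definition directed_tfin e x y : R := if e then T x y else T y x.

(* A geodesic parametrized from its vertex [r 0], future directed when [e] and past directed
   otherwise, and extended by constants outside [0, a]. *)
Record ray e a r : Prop := Ray {
  ray_a : 0 < a;
  ray_cont : forall s, {for s, continuous r};
  ray_U : forall s, U (r s);
  ray_rel : forall s t, 0 <= s -> s < t -> t <= a -> directed_chron e (r s) (r t);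
  ray_add : forall s t, 0 <= s -> s <= t -> t <= a ->
    directed_tfin e (r s) (r t) = directed_tfin e (r 0) (r t) - directed_tfin e (r 0) (r s);
  ray_side : forall s t, 0 <= s -> s <= t -> t <= a -> 0 < t -> exists G u,
    [/\ Defs.in_set G U,
        realizer L G (if e then r 0 else r t) (if e then r t else r 0),
        cdom G u & G u = r s] }.

(* The values of a curve outside its domain are arbitrary. *)
Definition clamp a s : R := Num.max 0 (Num.min s a).

Lemma clamp_in a s : 0 <= a -> 0 <= clamp a s <= a.
Proof. by move=> a0; rewrite /clamp le_max lexx /= ge_max a0 ge_min lexx orbT. Qed.

Lemma clamp_id a s : 0 <= s -> s <= a -> clamp a s = s.
Proof. by move=> s0 sa; rewrite /clamp (min_idPl sa) (max_idPr s0). Qed.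

Lemma clamp_lip a s t : 0 <= a -> `|clamp a s - clamp a t| <= `|s - t|.
Proof.
move=> a0; rewrite /clamp.
have M (u v : R) : u <= v -> Num.max 0 (Num.min u a) <= Num.max 0 (Num.min v a) /\
    Num.max 0 (Num.min v a) - Num.max 0 (Num.min u a) <= v - u.
  move=> uv; rewrite !maxEle !minEle.
  by do 4 case: ifP => //; move=> *; split; lra.
case: (leP s t) => st; [have [h1 h2] := M _ _ st|have [h1 h2] := M _ _ (ltW st)].
- by rewrite distrC (distrC s) !ger0_norm ?subr_ge0.
- by rewrite !ger0_norm ?subr_ge0 // ltW.
Qed.

Lemma clamp_curve_continuous al : lo al = 0 -> 0 < hi al -> locally_lipschitz al ->
  forall s, {for s, continuous (fun t => al (clamp (hi al) t))}.
Proof.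
move=> l0 h0 hl s; have ci t : cdom al (clamp (hi al) t).
  by rewrite /cdom /= in_itv /= l0; exact/clamp_in/ltW.
have [d [C [d0 H]]] := hl _ (ci s).
apply/cvg_ballP => ep ep0; apply/nbhs_ballP.
exists (Num.min d (ep / (`|C| + 1))) => /=.
  by rewrite lt_min d0 divr_gt0 // ltr_wpDl.
move=> t; rewrite /ball /= lt_min => /andP[t1 t2].
rewrite -/(ball _ _ _) ballEmdist /=.
have lip := clamp_lip s t (ltW h0).
have := H _ _ (ci s) (ci t); rewrite subrr normr0 => /(_ d0).
rewrite (distrC (clamp _ t)) => /(_ (le_lt_trans lip t1)) h.
apply: le_lt_trans h _.
apply: le_lt_trans (_ : `|C| * `|s - t| < ep).
  apply: le_trans (ler_wpM2r (normr_ge0 _) (ler_norm C)) _.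
  exact: ler_wpM2l.
move: t2; rewrite ltr_pdivlMr ?ltr_wpDl // mulrC => t2.
have := normr_ge0 (s - t); nra.
Qed.

Lemma realizer_additive_U g p q s t : realizer L g p q -> (tau L p q < +oo)%E ->
  lo g <= s -> s <= t -> t <= hi g -> T (g s) (g t) = T p (g t) - T p (g s).
Proof. by move=> rg f h1 h2 h3; rewrite /tfin (realizer_additive rg f) // . Qed.

Lemma ray_of_realizer al : lo al = 0 -> Defs.in_set al U -> timelike_realizer L al ->
  exists e, ray e (hi al) (fun t => al (clamp (hi al) t)).
Proof.
move=> l0 ual [[ft rg]|[ft rg]].
- exists true.
  have h0 : 0 < hi al by rewrite -l0; exact: realizer_lt rg.
  have ci t : cdom al (clamp (hi al) t).
    by rewrite /cdom /= in_itv /= l0; exact/clamp_in/ltW.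
  have id0 : clamp (hi al) 0 = 0 by rewrite clamp_id // ltW.
  have f : (tau L (al (lo al)) (al (hi al)) < +oo)%E.
    by apply: U_fin; apply: ual; rewrite /cdom /= in_itv /= ?lexx ?l0 ?(ltW h0).
  have ltl : (tau L (al (lo al)) (al (lo al)) < +oo)%E.
    by apply: U_fin; apply: ual; rewrite /cdom /= in_itv /= ?lexx ?l0 ?(ltW h0).
  have rel s t : 0 <= s -> s < t -> t <= hi al -> chron L (al s) (al t).
    move=> s0 st ta; case: ft => _ _; apply=> //; rewrite /cdom /= in_itv /= l0.
      by rewrite s0 (le_trans (ltW st)).
    by rewrite ta (le_trans s0 (ltW st)).
  split=> //.
  + by apply: clamp_curve_continuous => //; case: ft.
  + by move=> s; apply: ual.
  + move=> s t s0 st ta /=; rewrite !clamp_id //; first exact: rel.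
    * by lra.
    * by lra.
  + move=> s t s0 st ta; rewrite /directed_tfin id0 -l0.
    rewrite !clamp_id ?(le_trans s0 st) ?(le_trans st ta) //.
    by rewrite (realizer_additive_U rg f) // l0.
  + move=> s t s0 st ta t0; rewrite id0 !clamp_id ?(le_trans s0 st) ?(le_trans st ta) //.
    exists (reparam al false 0 0 t), s.
    have a0 (u : R) : affine false 0 u = u by rewrite /affine add0r.
    split.
    * move=> u; rewrite /cdom /= in_itv /= add0r => /andP[u0 ut]; apply: ual.
      by rewrite /cdom /= in_itv /= l0 u0 (le_trans ut ta).
    * have := @sub_realizer _ _ L al _ _ false 0 0 t rg f t0 erefl; rewrite !a0 l0.
      apply=> // e0; have := rel 0 t (lexx _) t0 ta; rewrite -e0 -l0.
      exact: chron_irrefl.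
    * by rewrite /cdom /= in_itv /= s0 st.
    * by rewrite /= add0r.
- exists false; set g := reverse al in ft rg.
  have lg : lo g = 0 by [].
  have hg : hi g = hi al by [].
  have gE u : g u = al (hi al - u) by rewrite /g /= l0 add0r.
  have h0 : 0 < hi al by rewrite -hg -lg; exact: realizer_lt rg.
  have ci t : cdom al (clamp (hi al) t).
    by rewrite /cdom /= in_itv /= l0; exact/clamp_in/ltW.
  have id0 : clamp (hi al) 0 = 0 by rewrite clamp_id // ltW.
  have f : (tau L (al (hi al)) (al (lo al)) < +oo)%E.
    by apply: U_fin; apply: ual; rewrite /cdom /= in_itv /= ?lexx ?l0 ?(ltW h0).
  have al_g u : al u = g (hi al - u) by rewrite gE; congr (al _); ring.
  have rel s t : 0 <= s -> s < t -> t <= hi al -> chron L (al t) (al s).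
    move=> s0 st ta; rewrite !al_g; case: ft => _ _; apply.
    * by rewrite /cdom /= in_itv /= l0; lra.
    * by rewrite /cdom /= in_itv /= l0; lra.
    * lra.
  split=> //.
  + apply: clamp_curve_continuous => //; case: ft => _ lip _ t ht.
    have hm u : cdom al u -> cdom g (hi al - u).
      by rewrite /cdom /= !in_itv /= l0 => /andP[v1 v2]; apply/andP; split; lra.
    have [d [C [d0 H]]] := lip _ (hm _ ht).
    exists d, C; split=> // u v hu hv n1 n2; rewrite (al_g u) (al_g v).
    have E (p q : R) : `|hi al - p - (hi al - q)| = `|p - q|.
      by rewrite distrC; congr `|_|; ring.
    by have := H _ _ (hm _ hu) (hm _ hv); rewrite !E; apply.
  + by move=> s; apply: ual.
  + move=> s t s0 st ta /=; rewrite !clamp_id //; first exact: rel.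
    * by lra.
    * by lra.
  + move=> s t s0 st ta; rewrite /directed_tfin id0.
    rewrite !clamp_id ?(le_trans s0 st) ?(le_trans st ta) //.
    rewrite (al_g t) (al_g s) (al_g 0).
    rewrite !(realizer_additive_U rg f) ?lg ?hg; lra.
  + move=> s t s0 st ta t0; rewrite id0 !clamp_id ?(le_trans s0 st) ?(le_trans st ta) //.
    exists (reparam g false 0 (hi al - t) (hi al)), (hi al - s).
    have a0 (u : R) : affine false 0 u = u by rewrite /affine add0r.
    have e1 u : reparam g false 0 (hi al - t) (hi al) u = al (hi al - u).
      by rewrite -gE; congr (g _); exact: a0.
    split.
    * move=> u; rewrite e1 /cdom /= in_itv /= => /andP[u0 ut]; apply: ual.
      by rewrite /cdom /= in_itv /= l0; lra.
    * have := @sub_realizer _ _ L g _ _ false 0 (hi al - t) (hi al) rg f; rewrite !a0 lg hg.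
      rewrite (al_g t) (al_g 0) subr0; apply; [lra|by []|lra|by []|].
      move=> e0; have := rel 0 t (lexx _) t0 ta; rewrite (al_g t) (al_g 0) subr0 -e0.
      apply: chron_irrefl; rewrite gE; apply: U_fin; apply: ual;
      by rewrite /cdom /= in_itv /= l0; lra.
    * by rewrite /cdom /= in_itv /=; lra.
    * by rewrite e1 -gE -al_g.
Qed.

Section RayFacts.
Variables (e : bool) (a : R) (r : R -> X).
Hypothesis hr : ray e a r.

Lemma ray_irr s : (tau L (r s) (r s) < +oo)%E.
Proof. by apply: U_fin; exact: (ray_U hr _). Qed.

Lemma tsep_directed s t : 0 <= s -> s <= t -> t <= a -> tsep L (r s) (r t) = directed_tfin e (r s) (r t).
Proof.
move=> s0; rewrite le_eqVlt => /predU1P[-> _|st ta].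
  by rewrite /tsep /directed_tfin /tfin (tau_xx (ray_irr t)) addr0; case: (e).
have := ray_rel hr s0 st ta; rewrite /directed_chron /directed_tfin /tsep; case: (e) => h.
- by rewrite [X in _ + X]/tfin (tau0_of_caus (ray_irr s) (chron_caus h)) addr0.
- by rewrite [X in X + _]/tfin (tau0_of_caus (ray_irr t) (chron_caus h)) add0r.
Qed.

(** Proper time from the vertex, for either time direction of the ray. *)
Definition ell s : R := tsep L (r 0) (r s).

Lemma ell_add s t : 0 <= s -> s <= t -> t <= a -> tsep L (r s) (r t) = ell t - ell s.
Proof.
move=> s0 st ta; rewrite tsep_directed // (ray_add hr) // /ell !tsep_directed //.
- exact: le_trans st ta.
- exact: le_trans s0 st.
Qed.

Lemma ray_tl s t : 0 <= s -> s < t -> t <= a -> timelike_related L (r s) (r t).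
Proof. by move=> h1 h2 h3; have := ray_rel hr h1 h2 h3; rewrite /directed_chron; case: (e); [left|right]. Qed.

Lemma ell_lt s t : 0 <= s -> s < t -> t <= a -> ell s < ell t.
Proof.
move=> s0 st ta; rewrite -subr_gt0 -ell_add //; last exact: ltW.
by apply: tsep_gt0; [apply: U_fin2; exact: (ray_U hr _)|exact: ray_tl].
Qed.

Lemma ell0 : ell 0 = 0.
Proof. by rewrite /ell tsep_directed ?lexx ?(ltW (ray_a hr)) // /directed_tfin /tfin (tau_xx (ray_irr 0)); case: (e). Qed.

Lemma ell_le s t : 0 <= s -> s <= t -> t <= a -> ell s <= ell t.
Proof. by move=> s0; rewrite le_eqVlt => /predU1P[->//|st] ta; exact/ltW/ell_lt. Qed.

Lemma ell_continuous s : {for s, continuous ell}.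
Proof.
by apply: (@tsep_continuous (fun _ => r 0) r); [exact: cvg_cst|exact: (ray_cont hr)|exact: (ray_U hr _)|exact: (ray_U hr _)].
Qed.

Lemma ray_between s t : 0 <= s -> s <= t -> t <= a -> between L (r 0) (r t) (r s).
Proof.
move=> s0 st ta.
have C u v : 0 <= u -> u <= v -> v <= a -> if e then caus L (r u) (r v) else caus L (r v) (r u).
  move=> u0; rewrite le_eqVlt => /predU1P[-> _|uv va]; first by case: (e); exact: caus_refl.
  by have := ray_rel hr u0 uv va; rewrite /directed_chron; case: (e) => /chron_caus.
have := C 0 s (lexx _) s0 (le_trans st ta); have := C s t s0 st ta.
by rewrite /between; case: (e) => h1 h2; [left|right].
Qed.

End RayFacts.

(** The sign depends only on the directions of the rays, so comparing signed angles along them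
    amounts to comparing values of [hingeB]. *)
Lemma ray_sign e1 a1 r1 e2 a2 r2 s t : ray e1 a1 r1 -> ray e2 a2 r2 -> r1 0 = r2 0 ->
  0 < s -> s <= a1 -> 0 < t -> t <= a2 ->
  angle_sign L (r1 0) (r1 s) (r2 t) = if e1 == e2 then -1 else 1.
Proof.
move=> h1 h2 e0 s0 sa t0 ta.
have c1 := ray_rel h1 (lexx 0) s0 sa; have c2 := ray_rel h2 (lexx 0) t0 ta.
have i0' := ray_irr h1 0; have i1' := ray_irr h1 s; have i2' := ray_irr h2 t.
rewrite /angle_sign; rewrite -e0 in c2; move: c1 c2; rewrite /directed_chron.
case: e1 e2 {h1 h2} => -[] /= c1 c2.
- by rewrite asboolT //; left.
- rewrite asboolF // => -[[_ h]|[h _]].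
    exact: (chron_anti i2' c2 (chron_caus h)).
  exact: (chron_anti i0' c1 (chron_caus h)).
- rewrite asboolF // => -[[h _]|[_ h]].
    exact: (chron_anti i1' c1 (chron_caus h)).
  exact: (chron_anti i0' c2 (chron_caus h)).
- by rewrite asboolT //; right.
Qed.

End Rays.

(** * From triangle comparison to an inequality for hinges *)

Section CurvatureToMonotonicity.
Variables (R : realType) (X : metricType R) (L : lorentzian_pre_length X) (K : R).
Variables (U : set X) (be : bool).
Hypothesis oU : open U.
Hypothesis fcU : tau_finite_continuous L U.
Implicit Types (x y z q : X) (r : R -> X) (s t a : R) (e : bool).
Local Notation T := (tfin L).
Local Notation S := (tsep L).
Local Notation mtau := (model_tau K).
Local Notation mcaus := (model_caus K).

(* [be] selects the bound from below. *)
Definition cmp_ereal : rel (\bar R) := if be then fun u v => (u <= v)%E else fun u v => (u >= v)%E.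
Definition cmp_real : rel R := if be then fun u v => u <= v else fun u v => u >= v.

(* From below nothing can be concluded from [d = 0]: points that are not causally related in
   [X] may have [F < 0]. *)
Definition hinge_cmp (d F : R) : Prop :=
  if be then 0 < d -> ph K d <= F else F <= ph K d.

(** From below, the premise [0 < d] is an open condition and so is available at the approximating
    points; from above, the inequality is closed. *)
Lemma hinge_cmp_limit (d F : R -> R) (x : R) : {for x, continuous d} -> {for x, continuous F} ->
  (forall ep : R, 0 < ep -> exists2 u : R, `|x - u| < ep & hinge_cmp (d u) (F u)) ->
  hinge_cmp (d x) (F x).
Proof.
rewrite /hinge_cmp => cd cF.
have cph : {for x, continuous (fun t => ph K (d t))}.
  exact: (@ct_comp R (ph K) d x (is1_continuous (is1_ph K (d x))) cd).
case: be => H.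
- move=> d0; have [e1 e10 h1] := pos_near cd d0.
  rewrite -subr_ge0; apply: (@limit_ge0 R (fun t => F t - ph K (d t))).
    by apply: ct_add => //; exact: ct_opp.
  move=> e e0; have [|y hy hh] := H (Num.min e e1); first by rewrite lt_min e0.
  move: hy; rewrite lt_min => /andP[y1 y2]; exists y => //.
  by rewrite subr_ge0; apply: hh; exact: h1.
- rewrite -subr_ge0; apply: (@limit_ge0 R (fun t => ph K (d t) - F t)).
    by apply: ct_add => //; exact: ct_opp.
  by move=> e e0; have [y y1 y2] := H e e0; exists y => //; rewrite subr_ge0.
Qed.

(** From below, a timelike relation in X forces one in the model by the comparison itself. From
    above, a positive world function orders the model points, and a nonpositive one makes the claim
    trivial. *)
Lemma hinge_cmp_of_tau q z qb zb F : fin2 L q z -> (tau L q q < +oo)%E ->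
  (tau L q z < model_diameter K)%E -> (tau L z q < model_diameter K)%E ->
  rng K qb zb -> (mtau qb zb < model_diameter K)%E -> (mtau zb qb < model_diameter K)%E ->
  world K qb zb = F -> cmp_ereal (tau L q z) (mtau qb zb) ->
  cmp_ereal (tau L z q) (mtau zb qb) -> hinge_cmp (S q z) F.
Proof.
move=> f2 fq s1 s2 rg m1 m2 <-; have bS := tsep_below f2 fq s1 s2.
have [f3 f4] := f2; have S0 := tsep_ge0 L q z.
rewrite /hinge_cmp /cmp_ereal; case: be => c1 c2.
- move=> d0.
  have [h|h] : chron L q z \/ chron L z q.
    have [h|h] := ltP 0 (T q z); first by left; apply/(tfin_gt0 f3).
    by right; apply/(tfin_gt0 f4); move: d0; rewrite /tsep; lra.
  + have cb : mcaus qb zb.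
      by apply: mtau_gt0_caus; apply: lt_le_trans c1; apply/tau_gt0.
    have [_ _ [m [e m0 mD <-]]] := mtau_world cb m1.
    apply: ph_le => //; rewrite /tsep [X in _ + X]/tfin (tau0_of_caus fq (chron_caus h)).
    by move: c1; rewrite e (tfinE f3) lee_fin addr0.
  + have cb : mcaus zb qb.
      by apply: mtau_gt0_caus; apply: lt_le_trans c2; apply/tau_gt0.
    have [_ _ [m [e m0 mD w]]] := mtau_world cb m2.
    rewrite worldC -w; apply: ph_le => //.
    have zq : T q z = 0.
      apply/eqP; rewrite eq_le tfin_ge0 andbT leNgt; apply/negP => /(tfin_gt0 f3) h'.
      exact: (chron_anti fq h' (chron_caus h)).
    by rewrite /tsep zq add0r; move: c2; rewrite e (tfinE f4) lee_fin.
- have [w0|w0] := leP (world K qb zb) 0.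
    by apply: le_trans w0 _; exact: ph_ge0.
  have [n|n] := world_order rg w0.
  + have [_ _ [m [e m0 mD <-]]] := mtau_world (nlt_caus rg n) m1.
    apply: ph_le => //; rewrite /tsep; have := tfin_ge0 L z q.
    by move: c1; rewrite e (tfinE f3) lee_fin; lra.
  + have [_ _ [m [e m0 mD w]]] := mtau_world (nlt_caus (rngC rg) n) m2.
    rewrite worldC -w; apply: ph_le => //; rewrite /tsep; have := tfin_ge0 L q z.
    by move: c2; rewrite e (tfinE f4) lee_fin; lra.
Qed.

Hypothesis gU : forall x y, U x -> U y -> chron L x y ->
  exists g, Defs.in_set g U /\ realizer L g x y.
Hypothesis HT : triangle_comparison L K cmp_ereal U.

(** Corresponding points are defined by the separation from the past end of a side. A past directed
    ray runs from the future end, so its parameter [s] corresponds to the separation [S x y - s]. *)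
Lemma oriented_geodesic e x y xb yb : fin2 L x y ->
  (tau L x x < +oo)%E -> (tau L y y < +oo)%E -> directed_chron L e x y ->
  (tau L x y < model_diameter K)%E -> (tau L y x < model_diameter K)%E ->
  pair_cmp L K x y xb yb -> pair_cmp L K y x yb xb ->
  exists c, geodesic_from_to K c (S x y) xb yb /\
    forall q s, 0 <= s <= S x y -> (tau L (if e then x else y) q < +oo)%E ->
      T (if e then x else y) q = (if e then s else S x y - s) ->
      corresponds L K (if e then x else y) q (if e then xb else yb)
        (if e then yb else xb) (c s).
Proof.
have main u v ub vb : fin2 L u v -> (tau L u u < +oo)%E -> chron L u v ->
    (tau L u v < model_diameter K)%E -> pair_cmp L K u v ub vb ->
    exists c, geodesic_from_to K c (S u v) ub vb /\
    forall q s, 0 <= s <= S u v -> (tau L u q < +oo)%E -> T u q = s ->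
      corresponds L K u q ub vb (c s).
  move=> f2 fu h s1 p; have [eS S0] := tsep_chron f2 fu h.
  have [|||[c g] _] := @timelike_geodesics R K ub vb (S u v).
  - by rewrite p.2 eS (tfinE f2.1).
  - by [].
  - by rewrite eS /below_diameter -(tfinE f2.1).
  exists c; split=> // q s /andP[s0 sS] fq eq; split.
    by exists c, (S u v), s; split=> //; rewrite s0.
  have e1 := p.2; rewrite (tfinE f2.1) -eS in e1.
  have cuv : mcaus ub vb by apply: mtau_gt0_caus; rewrite e1 lte_fin.
  have d1 : (mtau ub vb < model_diameter K)%E by rewrite p.2.
  have d2 : (mtau vb ub < model_diameter K)%E by rewrite (mtau_anti cuv); exact: diameter_gt0.
  have [lD _ dir] := geodesic_length g d1 d2.
  case: dir => [[fc _]|[_ c2]]; last by move: S0; have := mtau_anti c2; rewrite e1 => -[->]; rewrite ltxx.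
  have [_ e2 _] := future_tau fc s0 sS lD; case: g => _ _ c0 _.
  by rewrite (tfinE fq) eq -e2 c0.
move=> f2 fx fy; case: e => h s1 s2 p1 p2; first exact: main.
have [c [g H]] := main _ _ _ _ (conj f2.2 f2.1) fy h s2 p2.
rewrite tsepC; exists (fun t => c (affine true (S y x) t)); split.
  case: g => g1 g2 g3 g4; split.
  - by have [] := geodesic_affine true (S y x) g1.
  - by [].
  - by rewrite /affine subr0.
  - by rewrite /affine subrr.
move=> q s hs fq eq; rewrite /affine; apply: H => //; lra.
Qed.

Section Stage1.
Variables (e : bool) (a : R) (r : R -> X) (s t : R) (z : X).
Hypothesis hr : ray L U e a r.
Hypotheses (s0 : 0 < s) (st : s <= t) (ta : t <= a) (Uz : U z).
Hypothesis ok : triple_ok L K (r 0) (r t) z.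

Lemma hinge_cmp_timelike : timelike_related L (r t) z ->
  hinge_cmp (S (r s) z) (hingeF K (ell L r s) (S (r 0) z)
    (hingeB K (ell L r t) (S (r 0) z) (S (r t) z))).
Proof.
move=> tyz; have [xb [yb [zb h]]] := comparison_exists ok.
have [[a1 a2] [a3 a4] [a5 a6]] := h.
have [s1 s2] := ok_sxy ok; have [s3 s4] := ok_sxz ok; have [s5 s6] := ok_syz ok.
have UU := ray_U hr; have t0 : 0 < t by exact: lt_le_trans st.
have cxy := ray_rel hr (lexx 0) t0 ta.
have [c1 [g1 H1]] := oriented_geodesic (ok_xy ok) (ok_xx ok) (ok_yy ok) cxy s1 s2 a1 a2.
have [c2 [k2 g2]] := related_geodesic a3 a4 (ok_txz ok) (ok_xz ok) s3 s4.
have [_ ek2 HM] := model_hinge ok h g1 g2.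
have hs : 0 <= ell L r s <= S (r 0) (r t).
  rewrite -{1}(ell0 fcU hr); apply/andP; split; apply: (ell_le fcU hr) => //.
  - exact: ltW.
  - exact: le_trans ta.
  - exact: ltW.
have [|w rg m1 m2] := HM (ell L r s) k2 hs _.
  by rewrite lexx andbT ek2; exact: tsep_ge0.
have c2k : c2 k2 = zb by case: g2.
rewrite c2k ek2 in w rg m1 m2.
have bt := ray_between hr (ltW s0) st ta.
have btz : between L (r 0) z z.
  by case: (tl_caus (ok_txz ok)) => hh; [left|right]; split=> //; exact: caus_refl.
have [sz1 sz2] := ok_diamond ok bt btz.
have Uend : U (if e then r 0 else r t) by case: (e).
have cor := H1 (r s) (ell L r s) hs (U_fin fcU Uend (UU _)).
have sa : s <= a by exact: le_trans ta.
have eT : T (if e then r 0 else r t) (r s) = if e then ell L r s else S (r 0) (r t) - ell L r s.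
  have E1 := ell_add fcU hr (ltW s0) st ta; have E2 := tsep_directed fcU hr (ltW s0) st ta.
  have E3 := tsep_directed fcU hr (lexx 0) (ltW s0) sa.
  move: E1 E2 E3; rewrite /ell /directed_tfin; case: (e) => E1 E2 E3; first by rewrite -E3.
  by rewrite -E2 E1.
have {}cor := cor eT.
have [G [u [uG rG du eG]]] := ray_side hr (ltW s0) st ta t0.
have fU' := U_fin fcU.
apply: (hinge_cmp_of_tau (U_fin2 fcU (UU s) Uz) (fU' _ _ (UU s) (UU s)) sz1 sz2 rg m1 m2 w);
  move: cxy cor rG; rewrite /directed_chron; case: (e) => cxy cor rG.
- by have [] := vertex_comparison fU' gU HT (UU _) (UU _) Uz cxy ok tyz h rG uG du eG cor.
(* On a past directed ray the past end of the side is [r t], so the triangle is relabelled with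
   [r t] as first vertex. *)
- have ok' : triple_ok L K (r t) (r 0) z.
    case: ok => q1 q2 q3 [q4 q4'] q5 q6 [q7 q7'] q8 q9 q10 q11 q12; split=> //; first by left.
    exact: tl_caus.
  by have [] := vertex_comparison fU' gU HT (UU _) (UU _) Uz cxy ok' (ok_txz ok) (tri_swap12 h) rG uG du eG cor.
- by have [] := vertex_comparison fU' gU HT (UU _) (UU _) Uz cxy ok tyz h rG uG du eG cor.
- have ok' : triple_ok L K (r t) (r 0) z.
    case: ok => q1 q2 q3 [q4 q4'] q5 q6 [q7 q7'] q8 q9 q10 q11 q12; split=> //; first by left.
    exact: tl_caus.
  by have [] := vertex_comparison fU' gU HT (UU _) (UU _) Uz cxy ok' (ok_txz ok) (tri_swap12 h) rG uG du eG cor.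
Qed.

End Stage1.

End CurvatureToMonotonicity.

Lemma hinge_continuous (R : realType) (K : R) (g1 g2 f1 f2 m : R -> R) (u : R) :
  {for u, continuous g1} -> {for u, continuous g2} -> {for u, continuous f1} ->
  {for u, continuous f2} -> {for u, continuous m} ->
  sn K (f1 u) * sn K (f2 u) != 0 ->
  {for u, continuous (fun v => hingeF K (g1 v) (g2 v) (hingeB K (f1 v) (f2 v) (m v)))}.
Proof.
move=> c1 c2 c3 c4 c5 n0; rewrite /hingeF /hingeB.
by cv; first exact: n0.
Qed.

Lemma triple_ok_swap (R : realType) (X : metricType R) (L : lorentzian_pre_length X) (K : R)
  (x y z : X) : triple_ok L K x y z -> triple_ok L K x z y.
Proof.
case=> q1 q2 q3 q4 q5 [q6 q6'] q7 q8 [q9 q9'] q10 q11 q12; split=> //.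
exact: tr_C.
Qed.

(** * Monotonicity along two rays *)

Section TwoRays.
Variables (R : realType) (X : metricType R) (L : lorentzian_pre_length X) (K : R).
Variables (U : set X) (be : bool).
Hypothesis oU : open U.
Hypothesis fcU : tau_finite_continuous L U.
Hypothesis gU : forall x y, U x -> U y -> chron L x y ->
  exists g, Defs.in_set g U /\ realizer L g x y.
Hypothesis HT : triangle_comparison L K (cmp_ereal be) U.
Local Notation T := (tfin L).
Local Notation S := (tsep L).
Local Notation hcmp := (hinge_cmp K be).

Section Stages.
Variables (e1 e2 : bool) (a1 a2 : R) (r1 r2 : R -> X).
Hypotheses (h1 : ray L U e1 a1 r1) (h2 : ray L U e2 a2 r2) (E0 : r1 0 = r2 0).
Local Notation ell1 := (ell L r1).
Local Notation ell2 := (ell L r2).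
Local Notation ok s t := (triple_ok L K (r1 0) (r1 s) (r2 t)).
Implicit Types s t : R.

(** The world function between the points at proper times [ell1 s] and [ell2 t] on the model hinge
    determined by the vertex, [r1 s'] and [r2 t']. *)
Definition hinge_value s t s' t' : R :=
  hingeF K (ell1 s) (ell2 t) (hingeB K (ell1 s') (ell2 t') (S (r1 s') (r2 t'))).

Lemma sub_ok s t s' t' : ok s' t' -> 0 < s -> s <= s' -> s' <= a1 ->
  0 < t -> t <= t' -> t' <= a2 -> causally_related L (r1 s) (r2 t) -> ok s t.
Proof.
move=> k s0 ss sa t0 tt ta c; have U1 := ray_U h1; have U2 := ray_U h2.
have b1 := ray_between h1 (ltW s0) ss sa.
have b2 := ray_between h2 (ltW t0) tt ta; rewrite -E0 in b2.
have b3 : between L (r1 0) (r1 s') (r1 0).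
  by case: (tl_caus (ok_txy k)) => hh; [left|right]; split=> //; exact: caus_refl.
have b4 : between L (r1 0) (r2 t') (r1 0).
  by case: (tl_caus (ok_txz k)) => hh; [left|right]; split=> //; exact: caus_refl.
have d1 := ok_diamond k b1 b4; have d2 := ok_diamond k b3 b2.
have d3 := ok_diamond k b1 b2.
split.
- exact: (U_fin fcU).
- exact: (U_fin fcU).
- exact: (U_fin fcU).
- exact: (U_fin2 fcU).
- exact: (U_fin2 fcU).
- exact: (U_fin2 fcU).
- by case: d1.
- by case: d2.
- by case: d3.
- by apply: (ray_tl h1); rewrite ?lexx // (le_trans ss).
- by rewrite E0; apply: (ray_tl h2); rewrite ?lexx // (le_trans tt).
- exact: c.
Qed.

Lemma rays_timelike s s' t : 0 < s -> s <= s' -> s' <= a1 -> ok s' t ->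
  timelike_related L (r1 s') (r2 t) -> hcmp (S (r1 s) (r2 t)) (hinge_value s t s' t).
Proof.
move=> s0 ss sa k tl; rewrite /hinge_value /(ell L r2) -E0.
by apply: (hinge_cmp_timelike fcU gU HT h1) => //; exact: (ray_U h2 _).
Qed.

Lemma sn_neq0 s t : ok s t -> sn K (ell1 s) * sn K (ell2 t) != 0.
Proof.
move=> k; have [l1 l2 D1 D2] := ok_lengths k.
by rewrite /ell -E0 gt_eqF // mulr_gt0 // sn_gt0.
Qed.

Lemma rays_value s t : ok s t -> hinge_value s t s t = ph K (S (r1 s) (r2 t)).
Proof.
move=> k; have [l1 l2 D1 D2] := ok_lengths k.
by rewrite /hinge_value /ell -E0 hingeBK.
Qed.

Lemma hinge_cmp_refl s t : ok s t -> hcmp (S (r1 s) (r2 t)) (hinge_value s t s t).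
Proof. by move=> k; rewrite rays_value // /hinge_cmp; case: (be). Qed.

Lemma chr_causl s s' z : 0 <= s -> s < s' -> s' <= a1 ->
  (if e1 then caus L (r1 s') z else caus L z (r1 s')) -> timelike_related L (r1 s) z.
Proof.
move=> s0 ss sa; have := ray_rel h1 s0 ss sa; rewrite /directed_chron; case: (e1) => c k.
  by left; exact: chron_le k.
by right; exact: le_chron k _.
Qed.

Lemma left_point s s' (ep : R) : s < s' -> 0 < ep ->
  exists2 v, `|s' - v| < ep & s < v < s'.
Proof.
move=> ss ep0; exists (Num.max ((s + s') / 2) (s' - ep / 2)).
  by case: (leP ((s + s') / 2) (s' - ep / 2)) => hh; rewrite ger0_norm; lra.
by case: (leP ((s + s') / 2) (s' - ep / 2)) => hh; lra.
Qed.

Lemma right_point s s' (ep : R) : s < s' -> 0 < ep ->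
  exists2 v, `|s - v| < ep & s < v < s'.
Proof.
move=> ss ep0; exists (Num.min ((s + s') / 2) (s + ep / 2)).
  by case: (leP ((s + s') / 2) (s + ep / 2)) => hh; rewrite ler0_norm; lra.
by case: (leP ((s + s') / 2) (s + ep / 2)) => hh; lra.
Qed.

Lemma ray_tsep_continuous1 z u : U z -> {for u, continuous (fun v => S (r1 v) z)}.
Proof.
move=> Uz; apply: (tsep_continuous oU fcU (r2 := fun _ => z)) => //.
- exact: (ray_cont h1).
- exact: cvg_cst.
- exact: (ray_U h1).
Qed.

Lemma ray_tsep_continuous2 y u : U y -> {for u, continuous (fun v => S y (r2 v))}.
Proof.
move=> Uy; apply: (tsep_continuous oU fcU (r1 := fun _ => y)) => //.
- exact: cvg_cst.
- exact: (ray_cont h2).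
- exact: (ray_U h2).
Qed.

(* If the end points are null related, one of them is moved towards the vertex: this makes them
   timelike related, and the comparison passes to the limit. *)
Lemma rays_cmp s s' t : 0 < s -> s <= s' -> s' <= a1 -> 0 < t -> t <= a2 -> ok s' t ->
  hcmp (S (r1 s) (r2 t)) (hinge_value s t s' t).
Proof.
move=> s0 ss sa t0 ta k; move: ss; rewrite le_eqVlt => /predU1P[->|ss].
  exact: hinge_cmp_refl.
have U1 := ray_U h1; have U2 := ray_U h2; have c1 := ell_continuous oU fcU h1.
have c2 := ell_continuous oU fcU h2; have nz := sn_neq0 k.
have cst (c u : R) : {for u, continuous (fun _ : R => c)} by exact: ct_cst.
(* [A] says that [r2 t] lies beyond [r1 s'] in the direction of the first ray, so moving [r1 s']
   towards the vertex makes the relation timelike; [B] is the same statement for the second ray. *)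
pose A := if e1 then caus L (r1 s') (r2 t) else caus L (r2 t) (r1 s').
pose B := if e2 then caus L (r2 t) (r1 s') else caus L (r1 s') (r2 t).
have [hA|nA] := pselect A.
  apply: (@hinge_cmp_limit R K be (fun _ => S (r1 s) (r2 t)) (fun v => hinge_value s t v t)).
  - exact: cst.
  - by apply: hinge_continuous => //; exact: ray_tsep_continuous1.
  move=> ep ep0; have [v v1 /andP[v2 v3]] := left_point ss ep0; exists v => //.
  have v0 : 0 < v by exact: lt_trans v2.
  have tl : timelike_related L (r1 v) (r2 t) by apply: (chr_causl (ltW v0) v3 sa).
  apply: rays_timelike => //; first exact: ltW.
    by apply: le_trans sa; exact: ltW.
  by apply: (sub_ok k) => //; [exact: ltW|exact: tl_caus].
have [hB|nB] := pselect B.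
  apply: (@hinge_cmp_limit R K be (fun v => S (r1 s) (r2 v)) (fun v => hinge_value s v s' v)).
  - exact: ray_tsep_continuous2.
  - by apply: hinge_continuous => //; exact: ray_tsep_continuous2.
  move=> ep ep0; have [v v1 /andP[v2 v3]] := left_point t0 ep0; exists v => //.
  have tl : timelike_related L (r1 s') (r2 v).
    have := ray_rel h2 (ltW v2) v3 ta; move: hB; rewrite /B /directed_chron; case: (e2) => c q.
      by right; exact: chron_le q c.
    by left; exact: le_chron c q.
  apply: rays_timelike => //; first exact: ltW.
  by apply: (sub_ok k) => //; [exact: lt_trans ss|exact: ltW|exact: tl_caus].
(* What remains are rays in opposite time directions, whose points are timelike related through the
   vertex. *)
apply: rays_timelike => //; first exact: ltW.
have s'0 : 0 < s' by exact: lt_trans ss.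
have := ray_rel h2 (lexx 0) t0 ta; have := ray_rel h1 (lexx 0) s'0 sa.
rewrite -E0; move: nA nB; rewrite /A /B /directed_chron; case: (ok_cyz k); case: (e1); case: (e2) => // c n1 n2 q1 q2.
- by left; exact: chron_trans q1 q2.
- by right; exact: chron_trans q2 q1.
Qed.

(** [rays_cmp] gives the claim except from below at separation 0, where [hinge_cmp] is vacuous.
    There [r1 s] is moved slightly along its ray, towards the vertex or away from it, to become
    timelike related to [r2 t]; the hinge value is then nonnegative, and this passes to the
    limit. *)
Lemma rays_monotone s s' t : 0 < s -> s <= s' -> s' <= a1 -> 0 < t -> t <= a2 ->
  ok s t -> ok s' t ->
  cmp_real be (hingeB K (ell1 s) (ell2 t) (S (r1 s) (r2 t)))
              (hingeB K (ell1 s') (ell2 t) (S (r1 s') (r2 t))).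
Proof.
move=> s0 ss sa t0 ta k k'; have [l1 l2 D1 D2] := ok_lengths k.
have main := rays_cmp s0 ss sa t0 ta k'.
have FE := rays_value k.
move: l2 D2; rewrite E0 -/(ell L r2 t) => l2 D2.
have LE := hingeF_le l1 l2 D1 D2.
rewrite /cmp_real; move: main; rewrite /hinge_cmp; case EB: be; last first.
  by rewrite -FE LE.
move=> main; rewrite -LE -/(hinge_value s t s t) FE -/(hinge_value s t s' t).
have := tsep_ge0 L (r1 s) (r2 t); rewrite le_eqVlt => /predU1P[z0|]; last exact: main.
rewrite -z0 ph0; move: ss; rewrite le_eqVlt => /predU1P[<-|ss].
  by rewrite FE -z0 ph0.
have U1 := ray_U h1; have U2 := ray_U h2; have c1 := ell_continuous oU fcU h1.
have cst (c u : R) : {for u, continuous (fun _ : R => c)} by exact: ct_cst.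
have tgt v : 0 < v -> v < s' -> timelike_related L (r1 v) (r2 t) -> 0 <= hinge_value v t s' t.
  move=> v0 vs tl; have tp := tsep_gt0 (U_fin2 fcU (U1 v) (U2 t)) tl.
  have := rays_cmp v0 (ltW vs) sa t0 ta k'; rewrite /hinge_cmp EB => /(_ tp).
  apply: le_trans; apply: ph_ge0; first exact: ltW.
  have kv := sub_ok k' v0 (ltW vs) sa t0 (lexx t) ta (tl_caus tl).
  by apply: tsep_below; [exact: ok_yz kv|exact: ok_yy kv|case: (ok_syz kv)|case: (ok_syz kv)].
apply: (@limit_ge0 R (fun v => hinge_value v t s' t)).
  apply: hinge_continuous => //.
  exact: sn_neq0.
move=> ep ep0.
have [hA|nA] := pselect (if e1 then caus L (r1 s) (r2 t) else caus L (r2 t) (r1 s)).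
  have [v v1 /andP[v2 v3]] := left_point s0 ep0; exists v => //.
  apply: tgt => //; first exact: lt_trans ss.
  by apply: (chr_causl (ltW v2) v3) => //; apply: le_trans sa; exact: ltW.
have [v v1 /andP[v2 v3]] := right_point ss ep0; exists v => //.
have va : v <= a1 by apply: le_trans sa; exact: ltW.
apply: tgt => //; first exact: lt_trans v2.
have := ray_rel h1 (ltW s0) v2 va; move: nA; rewrite /directed_chron.
case: (ok_cyz k); case: (e1) => // c n q.
- by left; exact: chron_le q c.
- by right; exact: le_chron c q.
Qed.

End Stages.

End TwoRays.

Lemma curvature_monotonicity (R : realType) (X : metricType R)
    (L : lorentzian_pre_length X) (K : R) (be : bool) :
  curvature_bounded L K (cmp_ereal be) -> monotonicity_comparison L K (cmp_real be).
Proof.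
move=> H p; have [U [oU fcU sU HT]] := H p.
have opU : open U by case: oU.
have gU x y : U x -> U y -> chron L x y -> exists g, Defs.in_set g U /\ realizer L g x y.
  by move=> Ux Uy /(sU _ _ Ux Uy) [].
exists U; split=> //.
  move=> x y Ux Uy c; have [[g [ug rg]] h] := sU _ _ Ux Uy c.
  by exists g; split=> //; exact: h.
move=> al bt la lb ua ub ta tb E.
have [e1 h1] := ray_of_realizer fcU la ua ta; have [e2 h2] := ray_of_realizer fcU lb ub tb.
set r1 := fun t => _ in h1; set r2 := fun t => _ in h2.
have a0 := ray_a h1; have b0 := ray_a h2.
have rE1 s : 0 <= s -> s <= hi al -> al s = r1 s by move=> u v; rewrite /r1 clamp_id.
have rE2 s : 0 <= s -> s <= hi bt -> bt s = r2 s by move=> u v; rewrite /r2 clamp_id.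
have E0 : r1 0 = r2 0 by rewrite -rE1 ?lexx ?(ltW a0) // -rE2 ?lexx ?(ltW b0).
have core s s' t t' : triple_ok L K (r1 0) (r1 s) (r2 t) -> triple_ok L K (r1 0) (r1 s') (r2 t') ->
    0 < s <= hi al -> 0 < s' <= hi al -> 0 < t <= hi bt -> 0 < t' <= hi bt ->
    cmp_real be (hingeB K (ell L r1 s) (ell L r2 t) (tsep L (r1 s) (r2 t)))
              (hingeB K (ell L r1 s') (ell L r2 t') (tsep L (r1 s') (r2 t'))) ->
    cmp_real be (signed_angle L K (r1 0) (r1 s) (r2 t)) (signed_angle L K (r1 0) (r1 s') (r2 t')).
  move=> k k' /andP[s1 s2] /andP[s3 s4] /andP[t1 t2] /andP[t3 t4].
  have sg := ray_sign fcU h1 h2 E0 s1 s2 t1 t2.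
  have sg' := ray_sign fcU h1 h2 E0 s3 s4 t3 t4.
  have LE := signed_angle_le k k' (etrans sg (esym sg')).
  have LE' := signed_angle_le k' k (etrans sg' (esym sg)).
  rewrite /cmp_real; case: (be); rewrite ?LE ?LE' /ell -E0; exact: id.
rewrite /angle_monotone rE1 ?lexx ?(ltW a0) //; split.
- move=> s s' t ss [/andP[s1 s2] /andP[t1 t2] k] [/andP[s3 s4] _ k'].
  rewrite -/(_ s) !rE1 ?rE2 ?(ltW s1) ?(ltW s3) ?(ltW t1) // in k k' *.
  move/angle_definedP: k => k; move/angle_definedP: k' => k'.
  apply: core; rewrite ?s1 ?s2 ?s3 ?s4 ?t1 ?t2 //.
  by apply: (rays_monotone opU fcU gU HT h1 h2 E0).
- move=> s t t' tt [/andP[s1 s2] /andP[t1 t2] k] [_ /andP[t3 t4] k'].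
  rewrite !rE1 ?rE2 ?(ltW s1) ?(ltW t3) ?(ltW t1) // in k k' *.
  move/angle_definedP: k => k; move/angle_definedP: k' => k'.
  apply: core; rewrite ?s1 ?s2 ?t3 ?t4 ?t1 ?t2 //.
  rewrite !(hingeBC K (ell L r1 s)) (tsepC L (r1 s)) (tsepC L (r1 s) (r2 t')).
  apply: (rays_monotone opU fcU gU HT h2 h1) => //.
  + by rewrite -E0; exact: triple_ok_swap.
  + by rewrite -E0; exact: triple_ok_swap.
Qed.

(** * From monotonicity to curvature bounds *)

Section Rigidity.
Variable R : realType.
Implicit Types (F : R -> R) (l h s t u v : R).

(** Near each point [F] is either strictly increasing or constant. If it is constant somewhere, the
    set where it keeps that value has a supremum, and the alternative near the supremum carries the
    constancy past it unless it is [h]. *)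
Lemma locally_rigid_right F l h :
  (forall s t, l <= s -> s <= t -> t <= h -> F s <= F t) ->
  (forall t, l <= t <= h -> exists2 d, 0 < d & forall s s' u v,
     l <= s -> s < s' -> s' <= h -> `|t - s| < d -> `|t - s'| < d -> F s = F s' ->
     l <= u -> u <= v -> v <= h -> `|t - u| < d -> `|t - v| < d -> F u = F v) ->
  forall s t, l <= s -> s < t -> t <= h -> F s = F t -> F s = F h.
Proof.
move=> mono rig s t ls st th e.
pose A := [set u | s <= u <= h /\ F u = F s].
have At : A t by split=> //; rewrite (ltW st).
have supA : has_sup A by split; [exists t|exists h => u [/andP[]]].
have tc : t <= sup A by exact: sup_upper_bound At.
have ch : sup A <= h by apply: ge_sup; [exists t|move=> u [/andP[]]].
have [|d d0 H] := rig (sup A); first by rewrite ch andbT (le_trans ls) // (le_trans (ltW st)).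
have [u Au ul] := sup_adherent (ltac:(by rewrite lt_min d0 subr_gt0) : 0 < Num.min d (t - s)) supA.
have uc : u <= sup A by exact: sup_upper_bound Au.
case: Au => /andP[su uh] eu.
have [m1 m2] : sup A - d < u /\ s < u.
  by move: ul; rewrite ltrBlDr -ltrBlDl lt_min => /andP[a1 a2]; split; lra.
(* [w] and [u] lie before the supremum, where [F] keeps its value, and [v] lies after it unless the
   supremum is [h]; all three are within [d] of it. *)
pose w := Num.max s ((sup A - d + u) / 2).
have ws : s <= w by rewrite le_max lexx.
have wd : sup A - d < w by rewrite lt_max; apply/orP; right; lra.
have wu : w < u by rewrite gt_max m2; lra.
have ew : F w = F u.
  apply/eqP; rewrite eq_le mono ?(le_trans ls ws) ?(ltW wu) //= eu mono //; lra.
pose v := Num.min h (sup A + d / 2).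
have vh : v <= h by rewrite ge_min lexx.
have cv' : sup A <= v by rewrite le_min ch; lra.
have vd : v < sup A + d by rewrite gt_min; apply/orP; right; lra.
have ev : F u = F v.
  apply: (H w u) => //; try lra.
  - by rewrite ger0_norm; lra.
  - by rewrite ger0_norm; lra.
  - by rewrite ger0_norm; lra.
  - by rewrite ler0_norm; lra.
have Av : A v by split; [rewrite vh andbT; lra|rewrite -ev].
have vc : v <= sup A by exact: sup_upper_bound Av.
suff -> : h = v by rewrite -ev.
by move: vc; rewrite /v; case: (leP h (sup A + d / 2)) => //; lra.
Qed.

(** Constancy on a subinterval spreads to the right end, and after the reflection u -> - F (l + h -
    u) to the left end as well, which contradicts [F l < F h]. *)
Lemma locally_rigid F l h :
  (forall s t, l <= s -> s <= t -> t <= h -> F s <= F t) ->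
  (forall t, l <= t <= h -> exists2 d, 0 < d & forall s s' u v,
     l <= s -> s < s' -> s' <= h -> `|t - s| < d -> `|t - s'| < d -> F s = F s' ->
     l <= u -> u <= v -> v <= h -> `|t - u| < d -> `|t - v| < d -> F u = F v) ->
  F l < F h -> forall s t, l <= s -> s < t -> t <= h -> F s < F t.
Proof.
move=> mono rig lth s t ls st th; rewrite lt_neqAle mono // ?(ltW st) // andbT.
apply/eqP => e; have eh := locally_rigid_right mono rig ls st th e.
have el : - F (l + h - (l + h - t)) = - F (l + h - h).
  apply: (@locally_rigid_right (fun u => - F (l + h - u)) l h _ _ (l + h - t) (l + h - s)).
  - by move=> u v lu uv vh; rewrite lerN2; apply: mono; lra.
  - move=> u lu; have [|d d0 H] := rig (l + h - u); first by lra.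
    exists d => // s1 s2 u1 u2 a1 a2 a3 a4 a5 /oppr_inj a6 a7 a8 a9 a10 a11.
    have E v : l + h - u - (l + h - v) = - (u - v) by ring.
    congr (- _); apply/esym; apply: (H (l + h - s2) (l + h - s1)); rewrite ?E ?normrN //; lra.
  - lra.
  - lra.
  - lra.
  - by congr (- _); rewrite !subKr.
move: el; rewrite subKr addrK => /oppr_inj el.
by move: lth; rewrite -eh e el ltxx.
Qed.

End Rigidity.

(** * Realizers between timelike related points are timelike *)

Section Strictness.
Variables (R : realType) (X : metricType R) (L : lorentzian_pre_length X).
Hypothesis hL : locally_strictly_timelike_geodesically_connected L.
Implicit Types (x y : X) (g : curve R X) (s t : R).

Lemma lipschitz_near g t (W : set X) : locally_lipschitz g -> cdom g t -> open W -> W (g t) ->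
  exists2 d, 0 < d & forall s, cdom g s -> `|t - s| < d -> W (g s).
Proof.
move=> lip ht oW Wt; have [d [C [d0 H]]] := lip _ ht.
have /nbhs_ballP[ep /= ep0 hep] : nbhs (g t) W by exact: open_nbhs_nbhs.
exists (Num.min d (ep / (`|C| + 1))); first by rewrite lt_min d0 divr_gt0 // ltr_wpDl.
move=> s hs; rewrite lt_min => /andP[t1 t2]; apply: hep.
rewrite ballEmdist /=; have := H t s ht hs; rewrite subrr normr0 => /(_ d0).
rewrite distrC => /(_ t1) h; apply: le_lt_trans h _.
apply: le_lt_trans (_ : `|C| * `|t - s| < ep).
  by apply: ler_wpM2r => //; exact: ler_norm.
move: t2; rewrite ltr_pdivlMr ?ltr_wpDl // mulrC => t2.
have := normr_ge0 (t - s); nra.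
Qed.

(* On a short parameter interval, a realizer is timelike or null by strictness of a small
   neighbourhood; connectedness makes the same alternative hold globally. *)
Lemma realizer_timelike g x y : realizer L g x y -> (tau L x y < +oo)%E -> chron L x y ->
  future_timelike L g.
Proof.
move=> rg f c; have [fc g0 g1 _] := rg; have lh := realizer_lt rg.
have [nc lip _] := fc.
have tp : 0 < tfin L x y by apply/tfin_gt0.
pose F t := tfin L x (g t).
have add s t : lo g <= s -> s <= t -> t <= hi g -> tau L (g s) (g t) = (F t - F s)%:E.
  exact: (realizer_additive rg f).
have mono s t : lo g <= s -> s <= t -> t <= hi g -> F s <= F t.
  by move=> a1 a2 a3; rewrite -subr_ge0 -lee_fin -add //; exact: tau_ge0.
have fxx : (tau L x x < +oo)%E.
  have := realizer_fin rg f (lexx (lo g)) (lexx _) (ltW lh); by rewrite g0.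
have Fl : F (lo g) = 0 by rewrite /F g0 /tfin tau_xx.
have inc : forall s t, lo g <= s -> s < t -> t <= hi g -> F s < F t.
  apply: locally_rigid => //; last by rewrite Fl /F g1.
  move=> t ht; have [W [[oW Wt] sW]] := hL (g t).
  have [d d0 H] := lipschitz_near lip ht oW Wt.
  exists d => // s s' u v ls ss sh s1 s2 e lu uv vh u1 u2.
  apply/eqP; rewrite eq_le mono //= leNgt; apply/negP => lt.
  (* The hull of both intervals: if [F] increased on [u, v], then [g p] and [g q] would be timelike
     related, and strictness of [W] would make the whole realizer between them timelike, against
     [F s = F s']. *)
  pose p := Num.min s u; pose q := Num.max s' v.
  have pl : lo g <= p by rewrite le_min ls.
  have ps : p <= s by rewrite ge_min lexx.
  have pu : p <= u by rewrite ge_min lexx orbT.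
  have qs : s' <= q by rewrite le_max lexx.
  have qv : v <= q by rewrite le_max lexx orbT.
  have qh : q <= hi g by rewrite ge_max sh.
  have pq : p < q by apply: le_lt_trans ps _; exact: lt_le_trans qs.
  have npt w : p <= w <= q -> `|t - w| < d.
    move: s1 s2 u1 u2; rewrite !ltr_norml /p /q => a1 a2 a3 a4.
    by case: (leP s u); case: (leP s' v) => *; apply/andP; split; lra.
  have lt2 : F p < F q.
    by apply: le_lt_trans (mono _ _ pl pu (le_trans uv vh)) _; apply: lt_le_trans lt _; apply: mono => //; exact: (le_trans lu uv).
  have cpq : chron L (g p) (g q).
    by apply/tau_gt0; rewrite add ?(ltW pq) // lte_fin subr_gt0.
  have a0 (w : R) : affine false 0 w = w by rewrite /affine add0r.
  have rs : realizer L (reparam g false 0 p q) (g p) (g q).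
    have := @sub_realizer _ _ L g x y false 0 p q rg f pq erefl; rewrite !a0; apply=> //.
    move=> eg; have := add p q pl (ltW pq) qh; rewrite eg => h2.
    move: cpq => /tau_gt0; rewrite eg.
    have := tau_xx (realizer_fin rg f (le_trans pl (ltW pq)) (lexx q) qh).
    by move=> ->; rewrite ltxx.
  have inW w : p <= w <= q -> W (g w).
    move=> hw; apply: H; last exact: npt.
    by rewrite /cdom /= in_itv /=; lra.
  have [_ hW] := sW _ _ (inW p ltac:(by rewrite lexx ltW)) (inW q ltac:(by rewrite lexx ltW)) cpq.
  have [|_ _ tl] := hW _ _ rs.
    move=> w; rewrite /cdom /= in_itv /= => hw.
    by rewrite add0r; exact: inW.
  have := tl s s' _ _ ss; rewrite /cdom /= !in_itv /= !add0r => c2.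
  have {}c2 : chron L (g s) (g s') by apply: c2; lra.
  move: c2 => /tau_gt0; rewrite add ?(ltW ss) // e subrr ltxx //.
split=> // s t; rewrite /cdom /= !in_itv /= => /andP[s1 _] /andP[_ t2] st.
by apply/tau_gt0; rewrite add ?(ltW st) // lte_fin subr_gt0; exact: inc.
Qed.

End Strictness.

Section ModelSide.
Variables (R : realType) (K : R).
Local Notation mtau := (model_tau K).
Local Notation mcaus := (model_caus K).
Implicit Types (p q : model R) (c : R -> model R) (u v l : R) (e : bool).

Definition mside e p q (d : R) := if e then mcaus p q /\ mtau p q = d%:E
  else mcaus q p /\ mtau q p = d%:E.

Lemma model_side e c l p q : geodesic_from_to K c l p q ->
  (if e then (0 < mtau p q)%E else (0 < mtau q p)%E) ->
  (mtau p q < model_diameter K)%E -> (mtau q p < model_diameter K)%E ->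
  forall u v, 0 <= u -> u <= v -> v <= l -> mside e (c u) (c v) (v - u).
Proof.
move=> g pos s1 s2 u v u0 uv vl; have [lD _ dir] := geodesic_length g s1 s2.
have vuD : below_diameter K (v - u) by apply: (below_diameter_le _ lD); lra.
have val (p' q' m M : model R) : (mtau m M < model_diameter K)%E -> mcaus m p' -> mcaus q' M ->
    mcaus p' q' -> world K p' q' = ph K (v - u) -> mtau p' q' = (v - u)%:E.
  move=> sM k1 k2 k3 w.
  have [_ d] := mtau_diamond sM k1 (mcaus_trans k3 k2) (mcaus_trans k1 k3) k2.
  have [_ _ [n [-> n0 nD wn]]] := mtau_world k3 d.
  by congr (_%:E); apply: (@ph_inj R K) => //; [lra|rewrite wn].
have [gc l0 c0 cl] := g; rewrite /mside.
have W := world_geodesic _ _ gc.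
case: dir => [[fc cpq]|[fc cqp]].
- move: pos; case: e => [_|]; last by rewrite (mtau_anti cpq) ltxx.
  have k := future_caus fc uv; split=> //.
  apply: (val _ _ p q s1) => //.
  + by rewrite -c0; exact: future_caus.
  + by rewrite -cl; exact: future_caus.
- move: pos; case: e => [|_]; first by rewrite (mtau_anti cqp) ltxx.
  have k a b : a <= b -> mcaus (c b) (c a).
    move=> ab; have := future_caus fc (r := - b) (s := - a) ltac:(lra).
    by rewrite /affine !sub0r !opprK.
  split; first exact: k.
  apply: (val _ _ q p s2) => //.
  + by rewrite -cl; exact: k.
  + by rewrite -c0; exact: k.
  + exact: k.
  + by rewrite worldC W.
Qed.

End ModelSide.

(** * Comparison of time separations along two rays *)

Section HingeRays.
Variables (R : realType) (X : metricType R) (L : lorentzian_pre_length X) (K : R).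
Variables (U : set X) (be : bool).
Hypothesis oU : open U.
Hypothesis fcU : tau_finite_continuous L U.
Local Notation T := (tfin L).
Local Notation S := (tsep L).
Local Notation mtau := (model_tau K).
Local Notation mcaus := (model_caus K).
Implicit Types (s t u v : R).

Lemma ray_caus e a r s t : ray L U e a r -> 0 <= s -> s <= t -> t <= a ->
  if e then caus L (r s) (r t) else caus L (r t) (r s).
Proof.
move=> h s0; rewrite le_eqVlt => /predU1P[-> _|st ta]; first by case: (e); exact: caus_refl.
by have := ray_rel h s0 st ta; rewrite /directed_chron; case: (e) => /chron_caus.
Qed.

Lemma ray_tau e a r s : ray L U e a r -> 0 <= s -> s <= a ->
  if e then tau L (r 0) (r s) = (ell L r s)%:E /\ tau L (r s) (r 0) = 0%E
  else tau L (r s) (r 0) = (ell L r s)%:E /\ tau L (r 0) (r s) = 0%E.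
Proof.
move=> h s0 sa; have hU := ray_U h; have fU := U_fin fcU.
have := tsep_directed fcU h (lexx 0) s0 sa; have := ray_caus h (lexx 0) s0 sa.
rewrite -/(ell L r s) /directed_tfin; case: (e) => c ->.
- by rewrite -tfinE ?fU // (tau0_of_caus _ c) // fU.
- by rewrite -tfinE ?fU // (tau0_of_caus _ c) // fU.
Qed.

Section Pair.
Variables (e1 e2 : bool) (a1 a2 : R) (r1 r2 : R -> X).
Hypotheses (h1 : ray L U e1 a1 r1) (h2 : ray L U e2 a2 r2) (E0 : r1 0 = r2 0).
Local Notation ell1 := (ell L r1).
Local Notation ell2 := (ell L r2).
Variables (c1 c2 : R -> model R).
Hypothesis E0b : c1 0 = c2 0.
Hypothesis M1 : forall u v, 0 <= u -> u <= v -> v <= ell1 a1 -> mside K e1 (c1 u) (c1 v) (v - u).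
Hypothesis M2 : forall u v, 0 <= u -> u <= v -> v <= ell2 a2 -> mside K e2 (c2 u) (c2 v) (v - u).

(** Supplies the time order that the symmetric world function does not give. Distances from the
    vertex agree in X and in the model, so opposite orders contradict the reverse triangle
    inequality or produce a causal loop. *)
Lemma order_exclusion s t : 0 < s -> s <= a1 -> 0 < t -> t <= a2 ->
  chron L (r1 s) (r2 t) -> ~ mcaus (c2 (ell2 t)) (c1 (ell1 s)).
Proof.
move=> s0 sa t0 ta cq cb; have U1 := ray_U h1; have U2 := ray_U h2.
have fU := U_fin fcU.
have l1 : 0 < ell1 s by rewrite -(ell0 fcU h1); exact: (ell_lt fcU h1).
have l2 : 0 < ell2 t by rewrite -(ell0 fcU h2); exact: (ell_lt fcU h2).
have m1 := M1 (lexx 0) (ltW l1) (ell_le fcU h1 (ltW s0) sa (lexx a1)).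
have m2 := M2 (lexx 0) (ltW l2) (ell_le fcU h2 (ltW t0) ta (lexx a2)).
have k1 := ray_rel h1 (lexx 0) s0 sa; have k2 := ray_rel h2 (lexx 0) t0 ta.
have t1 := ray_tau h1 (ltW s0) sa; have t2 := ray_tau h2 (ltW t0) ta.
have Tp : 0 < T (r1 s) (r2 t) by apply/(tfin_gt0 (fU _ _ (U1 s) (U2 t))).
have TE := tfinE (fU _ _ (U1 s) (U2 t)).
rewrite -E0 in k2 t2; rewrite -E0b in m2; rewrite !subr0 in m1 m2.
move: k1 k2 t1 t2 m1 m2; rewrite /directed_chron /mside.
case: (e1); case: (e2) => k1 k2 [t1 _] [t2 _] [b1 n1] [b2 n2].
- have := tau_triangle (chron_caus k1) (chron_caus cq); rewrite t1 TE t2 -EFinD lee_fin => h.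
  have := le_trans (leeDl _ (mtau_ge0 K _ _)) (mtau_triangle b2 cb); rewrite n2 n1 lee_fin.
  lra.
- exact: (chron_irrefl (fU _ _ (U1 s) (U1 s)) (chron_trans cq (chron_trans k2 k1))).
- have := le_trans (leeDl _ (mtau_ge0 K _ _)) (mtau_triangle b1 b2).
  by rewrite n1 (mtau_anti cb) lee_fin leNgt l1.
- have := tau_triangle (chron_caus cq) (chron_caus k2); rewrite t1 TE t2 -EFinD lee_fin => h.
  have := le_trans (leeDr _ (mtau_ge0 K _ _)) (mtau_triangle cb b1); rewrite n2 n1 lee_fin.
  lra.
Qed.

End Pair.

Section Comparison.
Variables (e1 e2 : bool) (a1 a2 : R) (r1 r2 : R -> X).
Hypotheses (h1 : ray L U e1 a1 r1) (h2 : ray L U e2 a2 r2) (E0 : r1 0 = r2 0).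
Local Notation ell1 := (ell L r1).
Local Notation ell2 := (ell L r2).
Local Notation ok s t := (triple_ok L K (r1 0) (r1 s) (r2 t)).
Local Notation B s t := (hingeB K (ell1 s) (ell2 t) (S (r1 s) (r2 t))).
Hypothesis B1 : forall s s' t, 0 < s -> s <= s' -> s' <= a1 -> 0 < t -> t <= a2 ->
  ok s t -> ok s' t -> cmp_real be (B s t) (B s' t).
Hypothesis B2 : forall s t t', 0 < s -> s <= a1 -> 0 < t -> t <= t' -> t' <= a2 ->
  ok s t -> ok s t' -> cmp_real be (B s t) (B s t').
Hypothesis k : ok a1 a2.
Variables (xb yb zb : model R) (c1 c2 : R -> model R) (l1 l2 : R).
Hypothesis h : tri_cmp L K (r1 0) (r1 a1) (r2 a2) xb yb zb.
Hypotheses (g1 : geodesic_from_to K c1 l1 xb yb) (g2 : geodesic_from_to K c2 l2 xb zb).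

(* Monotonicity needs causally related points: one of the corners [(s, a2)], [(a1, t)]
   qualifies. *)
Lemma hinge_chain s t : 0 < s -> s <= a1 -> 0 < t -> t <= a2 ->
  causally_related L (r1 s) (r2 t) -> ok s t /\ cmp_real be (B s t) (B a1 a2).
Proof.
move=> s0 sa t0 ta c; have k' := sub_ok fcU h1 h2 E0 k s0 sa (lexx a1) t0 ta (lexx a2) c.
split=> //; have fU := U_fin fcU; have U1 := ray_U h1; have U2 := ray_U h2.
have tr : transitive (cmp_real (R := R) be).
  by rewrite /cmp_real; case: (be) => p q w; [exact: le_trans|move=> u v; exact: le_trans v u].
have p1 := ray_a h1; have p2 := ray_a h2.
have via1 : causally_related L (r1 s) (r2 a2) -> cmp_real be (B s t) (B a1 a2).
  move=> c'; have k2 := sub_ok fcU h1 h2 E0 k s0 sa (lexx a1) p2 (lexx a2) (lexx a2) c'.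
  by apply: (tr (B s a2)); [exact: B2|exact: B1].
have via2 : causally_related L (r1 a1) (r2 t) -> cmp_real be (B s t) (B a1 a2).
  move=> c'; have k2 := sub_ok fcU h1 h2 E0 k p1 (lexx a1) (lexx a1) t0 ta (lexx a2) c'.
  by apply: (tr (B a1 t)); [exact: B1|exact: B2].
have q1 := ray_caus h1 (ltW s0) sa (lexx a1); have q2 := ray_caus h2 (ltW t0) ta (lexx a2).
have n1 := ray_rel h1 (lexx 0) s0 sa; have n2 := ray_rel h2 (lexx 0) t0 ta; rewrite -E0 in n2.
move: q1 q2 n1 n2; rewrite /directed_chron; case: c; case: (e1); case: (e2) => c q1 q2 n1 n2.
- by apply: via1; left; exact: caus_trans c q2.
- by case: (chron_anti (fU _ _ (U2 t) (U2 t)) (chron_trans n2 n1) c).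
- by apply: via1; left; exact: caus_trans c q2.
- by apply: via2; left; exact: caus_trans q1 c.
- by apply: via2; right; exact: caus_trans c q1.
- by apply: via2; right; exact: caus_trans c q1.
- by case: (chron_anti (fU _ _ (U1 s) (U1 s)) (chron_trans n1 n2) c).
- by apply: via1; right; exact: caus_trans q2 c.
Qed.

Let E0x : c1 0 = c2 0. Proof. by case: g1 => _ _ -> _; case: g2 => _ _ -> _. Qed.

Lemma hinge_model_sides :
  [/\ l1 = ell1 a1, l2 = ell2 a2,
     forall u v, 0 <= u -> u <= v -> v <= ell1 a1 -> mside K e1 (c1 u) (c1 v) (v - u) &
     forall u v, 0 <= u -> u <= v -> v <= ell2 a2 -> mside K e2 (c2 u) (c2 v) (v - u)].
Proof.
have [el1 el2 _] := model_hinge k h g1 g2.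
have E1 : l1 = ell1 a1 by [].
have E2 : l2 = ell2 a2 by rewrite /ell -E0.
have [[b1 b2] [b3 b4] _] := h; have [s1 s2] := ok_sxy k; have [s3 s4] := ok_sxz k.
have n1 := ray_rel h1 (lexx 0) (ray_a h1) (lexx a1).
have n2 := ray_rel h2 (lexx 0) (ray_a h2) (lexx a2); rewrite -E0 in n2.
split=> //.
- rewrite -E1; apply: (model_side g1); rewrite ?b1.2 ?b2.2 //.
  by move: n1; rewrite /directed_chron; case: (e1) => /tau_gt0.
- rewrite -E2; apply: (model_side g2); rewrite ?b3.2 ?b4.2 //.
  by move: n2; rewrite /directed_chron; case: (e2) => /tau_gt0.
Qed.

Lemma hinge_world_cmp s t : 0 < s -> s <= a1 -> 0 < t -> t <= a2 ->
  causally_related L (r1 s) (r2 t) ->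
  below_diameter K (S (r1 s) (r2 t)) /\
  cmp_real be (ph K (S (r1 s) (r2 t))) (world K (c1 (ell1 s)) (c2 (ell2 t))).
Proof.
move=> s0 sa t0 ta c; have [k' m] := hinge_chain s0 sa t0 ta c.
have [el1 el2 HM] := model_hinge k h g1 g2; have [_ el2' _ _] := hinge_model_sides.
have E : ell1 0 = 0 := ell0 fcU h1; have E' : ell2 0 = 0 := ell0 fcU h2.
have [||w _ _ _] := HM (ell1 s) (ell2 t).
- rewrite el1 -[in X in X <= _]E; apply/andP; split; apply: (ell_le fcU h1) => //; exact: ltW.
- rewrite el2' -[in X in X <= _]E'; apply/andP; split; apply: (ell_le fcU h2) => //; exact: ltW.
split.
  by apply: tsep_below; [exact: ok_yz k'|exact: ok_yy k'|case: (ok_syz k')|case: (ok_syz k')].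
rewrite w; have [q1 q2 D1 D2] := ok_lengths k'; have V := rays_value E0 k'.
rewrite -V /hinge_value; rewrite E0 -/(ell L r2 t) in q2 D2.
move: m; rewrite /cmp_real el2' el1; case: (be); rewrite (hingeF_le q1 q2 D1 D2); exact: id.
Qed.

Lemma hinge_points s t : 0 <= s -> s <= a1 -> 0 <= t -> t <= a2 ->
  [/\ rng K (c1 (ell1 s)) (c2 (ell2 t)),
      (mtau (c1 (ell1 s)) (c2 (ell2 t)) < model_diameter K)%E &
      (mtau (c2 (ell2 t)) (c1 (ell1 s)) < model_diameter K)%E].
Proof.
move=> s0 sa t0 ta.
have [el1 _ HM] := model_hinge k h g1 g2; have [_ el2' _ _] := hinge_model_sides.
have E : ell1 0 = 0 := ell0 fcU h1; have E' : ell2 0 = 0 := ell0 fcU h2.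
have [||_ rg d1 d2] := HM (ell1 s) (ell2 t).
- by rewrite el1 -[in X in X <= _]E; apply/andP; split; apply: (ell_le fcU h1).
- by rewrite el2' -[in X in X <= _]E'; apply/andP; split; apply: (ell_le fcU h2).
by split.
Qed.

Lemma hinge_tau_below s t : be -> 0 < s -> s <= a1 -> 0 < t -> t <= a2 ->
  (tau L (r1 s) (r2 t) <= mtau (c1 (ell1 s)) (c2 (ell2 t)))%E.
Proof.
move=> eb s0 sa t0 ta; have U1 := ray_U h1; have U2 := ray_U h2; have fU := U_fin fcU.
have [c|n] := pselect (chron L (r1 s) (r2 t)); last first.
  apply: le_trans (mtau_ge0 K _ _); rewrite leNgt; apply/negP => /tau_gt0; exact: n.
have [D] := hinge_world_cmp s0 sa t0 ta (or_introl (chron_caus c)).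
have [SE S0] := tsep_chron (U_fin2 fcU (U1 s) (U2 t)) (fU _ _ (U1 s) (U1 s)) c.
have [rg d1 d2] := hinge_points (ltW s0) sa (ltW t0) ta.
rewrite /cmp_real eb => w.
have w0 : 0 < world K (c1 (ell1 s)) (c2 (ell2 t)) by apply: lt_le_trans w; exact: ph_gt0.
have [_ _ MS1 MS2] := hinge_model_sides.
have [n|n] := world_order rg w0; last first.
  by case: (order_exclusion h1 h2 E0 E0x MS1 MS2 s0 sa t0 ta c (nlt_caus (rngC rg) n)).
have [_ _ [m [-> m0 mD wm]]] := mtau_world (nlt_caus rg n) d1.
rewrite (tfinE (fU _ _ (U1 s) (U2 t))) lee_fin -SE.
by rewrite -(ph_leE (ltW S0) m0 D mD) wm.
Qed.

Lemma hinge_tau_above_related s t : ~~ be -> 0 < s -> s <= a1 -> 0 < t -> t <= a2 ->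
  causally_related L (r1 s) (r2 t) -> (0 < mtau (c1 (ell1 s)) (c2 (ell2 t)))%E ->
  (mtau (c1 (ell1 s)) (c2 (ell2 t)) <= tau L (r1 s) (r2 t))%E.
Proof.
move=> eb s0 sa t0 ta cr pos; have U1 := ray_U h1; have U2 := ray_U h2; have fU := U_fin fcU.
have [D] := hinge_world_cmp s0 sa t0 ta cr.
have [rg d1 d2] := hinge_points (ltW s0) sa (ltW t0) ta.
have cb := mtau_gt0_caus pos; have [_ _ [m [me m0 mD wm]]] := mtau_world cb d1.
rewrite /cmp_real (negbTE eb) -wm ph_leE ?tsep_ge0 // => mS.
have mp : 0 < m by move: pos; rewrite me lte_fin.
have mE0 : (0 < m%:E)%E by rewrite lte_fin.
have [_ _ MS1 MS2] := hinge_model_sides.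
have nc : ~ chron L (r2 t) (r1 s).
  move=> c.
  exact: (order_exclusion h2 h1 (esym E0) (esym E0x) MS2 MS1 t0 ta s0 sa c cb).
rewrite me (tfinE (fU _ _ (U1 s) (U2 t))) lee_fin; apply: le_trans mS _; rewrite /tsep.
have -> : T (r2 t) (r1 s) = 0; last by rewrite addr0.
apply/eqP; rewrite eq_le tfin_ge0 andbT leNgt; apply/negP => /(tfin_gt0 (fU _ _ (U2 t) (U1 s))).
exact: nc.
Qed.

(* For unrelated points, move the one nearer to the vertex towards the vertex until the time
   separation is half the model value: then the points are related, a contradiction. *)
Lemma hinge_tau_above s t : ~~ be -> 0 < s -> s <= a1 -> 0 < t -> t <= a2 ->
  (mtau (c1 (ell1 s)) (c2 (ell2 t)) <= tau L (r1 s) (r2 t))%E.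
Proof.
move=> eb s0 sa t0 ta; have U1 := ray_U h1; have U2 := ray_U h2; have fU := U_fin fcU.
have [pos|z] := ltP 0%E (mtau (c1 (ell1 s)) (c2 (ell2 t))); last first.
  by apply: le_trans z _; exact: tau_ge0.
have [cr|nr] := pselect (causally_related L (r1 s) (r2 t)).
  exact: hinge_tau_above_related.
have [rg d1 d2] := hinge_points (ltW s0) sa (ltW t0) ta.
have cb := mtau_gt0_caus pos; have [_ _ [m [me m0 mD wm]]] := mtau_world cb d1.
have mp : 0 < m by move: pos; rewrite me lte_fin.
have mE0 : (0 < m%:E)%E by rewrite lte_fin.
have [_ _ MS1 MS2] := hinge_model_sides.
have E : ell1 0 = 0 := ell0 fcU h1; have E' : ell2 0 = 0 := ell0 fcU h2.
have T0 : T (r1 s) (r2 t) = 0.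
  apply/eqP; rewrite eq_le tfin_ge0 andbT leNgt; apply/negP.
  by move=> /(tfin_gt0 (fU _ _ (U1 s) (U2 t))) c; apply: nr; left; exact: chron_caus.
have n1 := ray_rel h1 (lexx 0) s0 sa; have n2 := ray_rel h2 (lexx 0) t0 ta; rewrite -E0 in n2.
have p1 : 0 <= ell1 s by rewrite -E; apply: (ell_le fcU h1) => //; exact: ltW.
have p2 : 0 <= ell2 t by rewrite -E'; apply: (ell_le fcU h2) => //; exact: ltW.
have p1' : ell1 s <= ell1 a1 by apply: (ell_le fcU h1) => //; exact: ltW.
have p2' : ell2 t <= ell2 a2 by apply: (ell_le fcU h2) => //; exact: ltW.
have b1 := MS1 _ _ (lexx 0) p1 p1'; have b2 := MS2 _ _ (lexx 0) p2 p2'.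
have cst (c : X) (u : R) : {for u, continuous (fun _ : R => c)} by exact: cvg_cst.
have r1c := ray_cont h1; have r2c := ray_cont h2.
have t1 := ray_tau h1 (ltW s0) sa; have t2 := ray_tau h2 (ltW t0) ta.
rewrite -E0 in t2; rewrite -E0x in b2.
case EE1: (e1) in MS1 n1 b1 t1; case EE2: (e2) in MS2 n2 b2 t2; exfalso.
- have f0 : T (r1 0) (r2 t) = ell2 t by rewrite /tfin t2.1.
  have big : m <= ell2 t.
    have := le_trans (leeDr _ (mtau_ge0 K _ _)) (mtau_triangle b1.1 cb).
    by rewrite me b2.2 subr0 lee_fin.
  (* The separation from [r1 u] to [r2 t] is at least [m] at the vertex and 0 at [u = s], so it
     takes the value m / 2. In the model it stays at least [m], since [c1 (ell1 u)] precedes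
     [c1 (ell1 s)]. *)
  have [||||u /andP[u0 us] ue] := @IVT_le R (fun u => - T (r1 u) (r2 t)) 0 s (- (m / 2)).
  + exact: ltW.
  + by move=> u _; apply: ct_opp; apply: (tfin_continuous oU fcU (r2 := fun _ => r2 t)).
  + by rewrite f0; lra.
  + by rewrite T0; lra.
  have Tu : T (r1 u) (r2 t) = m / 2 by lra.
  have u0' : 0 < u.
    rewrite lt_neqAle u0 andbT; apply/eqP => e; move: Tu; rewrite -e f0; lra.
  have c : caus L (r1 u) (r2 t).
    by apply: chron_caus; apply/(tfin_gt0 (fU _ _ (U1 u) (U2 t))); rewrite Tu; lra.
  have b3 := MS1 (ell1 u) (ell1 s) ltac:(by rewrite -E; apply: (ell_le fcU h1) => //; exact: (le_trans us sa))
    (ell_le fcU h1 u0 us sa) p1'.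
  have := le_trans (leeDr _ (mtau_ge0 K _ _)) (mtau_triangle b3.1 cb); rewrite me => h3.
  have := hinge_tau_above_related eb u0' (le_trans us sa) t0 ta (or_introl c)
    (lt_le_trans mE0 h3).
  move=> /(le_trans h3); rewrite (tfinE (fU _ _ (U1 u) (U2 t))) Tu lee_fin; lra.
(* For opposite directions the vertex lies between the two points. Here this reverses the order in
   the model; in the next case it relates the points in X. *)
- have := mtau_anti (mcaus_trans b2.1 b1.1).
  by rewrite me => -[m00]; rewrite m00 ltxx in mp.
- by apply: nr; left; apply: chron_caus; exact: chron_trans n1 n2.
- have f0 : T (r1 s) (r2 0) = ell1 s by rewrite -E0 /tfin t1.1.
  have big : m <= ell1 s.
    have := le_trans (leeDl _ (mtau_ge0 K _ _)) (mtau_triangle cb b2.1).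
    by rewrite me b1.2 subr0 lee_fin.
  have [||||u /andP[u0 us] ue] := @IVT_le R (fun u => - T (r1 s) (r2 u)) 0 t (- (m / 2)).
  + exact: ltW.
  + by move=> u _; apply: ct_opp; apply: (tfin_continuous oU fcU (r1 := fun _ => r1 s)).
  + by rewrite f0; lra.
  + by rewrite T0; lra.
  have Tu : T (r1 s) (r2 u) = m / 2 by lra.
  have u0' : 0 < u.
    rewrite lt_neqAle u0 andbT; apply/eqP => e; move: Tu; rewrite -e f0; lra.
  have c : caus L (r1 s) (r2 u).
    by apply: chron_caus; apply/(tfin_gt0 (fU _ _ (U1 s) (U2 u))); rewrite Tu; lra.
  have b3 := MS2 (ell2 u) (ell2 t) ltac:(by rewrite -E'; apply: (ell_le fcU h2) => //; exact: (le_trans us ta))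
    (ell_le fcU h2 u0 us ta) p2'.
  have := le_trans (leeDl _ (mtau_ge0 K _ _)) (mtau_triangle cb b3.1); rewrite me => h3.
  have := hinge_tau_above_related eb s0 sa u0' (le_trans us ta) (or_introl c)
    (lt_le_trans mE0 h3).
  move=> /(le_trans h3); rewrite (tfinE (fU _ _ (U1 s) (U2 u))) Tu lee_fin; lra.
Qed.

Lemma hinge_tau s t : 0 <= s -> s <= a1 -> 0 <= t -> t <= a2 ->
  cmp_ereal be (tau L (r1 s) (r2 t)) (mtau (c1 (ell1 s)) (c2 (ell2 t))).
Proof.
have refl (v w : \bar R) : v = w -> cmp_ereal be v w.
  by move=> ->; rewrite /cmp_ereal; case: (be).
have [_ _ MS1 MS2] := hinge_model_sides.
have E : ell1 0 = 0 := ell0 fcU h1; have E' : ell2 0 = 0 := ell0 fcU h2.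
rewrite le_eqVlt => /predU1P[<- _|s0 sa].
  move=> t0 ta; apply: refl; rewrite E E0 E0x.
  have p2 : 0 <= ell2 t by rewrite -E'; apply: (ell_le fcU h2).
  have := MS2 _ _ (lexx 0) p2 (ell_le fcU h2 t0 ta (lexx a2)); have := ray_tau h2 t0 ta.
  rewrite /mside subr0; case: (e2) => -[v1 v2] [w1 w2]; first by rewrite v1 w2.
  by rewrite v2 (mtau_anti w1).
rewrite le_eqVlt => /predU1P[<- _|t0 ta].
  apply: refl; rewrite E' -E0 -E0x.
  have p1 : 0 <= ell1 s by rewrite -E; apply: (ell_le fcU h1) => //; exact: ltW.
  have := MS1 _ _ (lexx 0) p1 (ell_le fcU h1 (ltW s0) sa (lexx a1)).
  have := ray_tau h1 (ltW s0) sa.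
  rewrite /mside subr0; case: (e1) => -[v1 v2] [w1 w2]; last by rewrite v1 w2.
  by rewrite v2 (mtau_anti w1).
have H1 := @hinge_tau_below s t; have H2 := @hinge_tau_above s t.
by rewrite /cmp_ereal; case: be H1 H2 => H1 H2; [apply: H1|apply: H2].
Qed.

End Comparison.

End HingeRays.

(** * Triangles as pairs of sides with a common vertex *)

Section MonotonicityToCurvature.
Variables (R : realType) (X : metricType R) (L : lorentzian_pre_length X) (K : R).
Variables (U : set X) (be : bool).
Hypothesis oU : open U.
Hypothesis fcU : tau_finite_continuous L U.
Hypothesis mono : forall al bt : curve R X,
  lo al = 0 -> lo bt = 0 -> Defs.in_set al U -> Defs.in_set bt U ->
  timelike_realizer L al -> timelike_realizer L bt ->
  al 0 = bt 0 -> angle_monotone L K (cmp_real be) al bt.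
Local Notation T := (tfin L).
Local Notation S := (tsep L).
Local Notation mtau := (model_tau K).
Local Notation mcaus := (model_caus K).
Implicit Types (v w x y q : X) (vb wb xb yb qb : model R) (g : curve R X).

(** [q] lies on a side parametrized from [v] in either time direction, and [qb] at the same proper
    time from [vb]. This form lets either end of a side serve as the vertex of a hinge. *)
Definition side_at v w vb wb q qb := exists (al : curve R X) (s : R) c l,
  [/\ lo al = 0, Defs.in_set al U, timelike_realizer L al, al 0 = v & al (hi al) = w] /\
  [/\ 0 <= s, s <= hi al, al s = q, geodesic_from_to K c l vb wb & qb = c (S v q)].

Lemma hinge_comparison v w w' vb wb wb' q q' qb qb' : triple_ok L K v w w' ->
  tri_cmp L K v w w' vb wb wb' -> side_at v w vb wb q qb -> side_at v w' vb wb' q' qb' ->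
  cmp_ereal be (tau L q q') (mtau qb qb').
Proof.
move=> k h [al [s [c1 [l1 [[la ua ta al0 ala] [s0 sa <- g1 ->]]]]]].
move=> [bt [t [c2 [l2 [[lb ub tb bt0 btb] [t0 tt <- g2 ->]]]]]].
have [e1 h1] := ray_of_realizer fcU la ua ta; have [e2 h2] := ray_of_realizer fcU lb ub tb.
set r1 := fun t => _ in h1; set r2 := fun t => _ in h2.
have a0 := ray_a h1; have b0 := ray_a h2.
have rE1 (u : R) : 0 <= u -> u <= hi al -> al u = r1 u by move=> p p'; rewrite /r1 clamp_id.
have rE2 (u : R) : 0 <= u -> u <= hi bt -> bt u = r2 u by move=> p p'; rewrite /r2 clamp_id.
have v1 : v = r1 0 by rewrite -rE1 ?lexx ?(ltW a0).
have v2 : v = r2 0 by rewrite -rE2 ?lexx ?(ltW b0).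
have E0 : r1 0 = r2 0 by rewrite -v1.
have wE : w = r1 (hi al) by rewrite -rE1 ?lexx ?(ltW a0).
have wE' : w' = r2 (hi bt) by rewrite -rE2 ?lexx ?(ltW b0).
have M := mono la lb ua ub ta tb (etrans al0 (esym bt0)).
have core s1 s2 t1 t2 : triple_ok L K (r1 0) (r1 s1) (r2 t1) ->
    triple_ok L K (r1 0) (r1 s2) (r2 t2) ->
    0 < s1 <= hi al -> 0 < s2 <= hi al -> 0 < t1 <= hi bt -> 0 < t2 <= hi bt ->
    cmp_real be (signed_angle L K (r1 0) (r1 s1) (r2 t1)) (signed_angle L K (r1 0) (r1 s2) (r2 t2)) ->
    cmp_real be (hingeB K (ell L r1 s1) (ell L r2 t1) (tsep L (r1 s1) (r2 t1)))
              (hingeB K (ell L r1 s2) (ell L r2 t2) (tsep L (r1 s2) (r2 t2))).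
  move=> k1 k2 /andP[p1 p2] /andP[p3 p4] /andP[p5 p6] /andP[p7 p8].
  have sg := ray_sign fcU h1 h2 E0 p1 p2 p5 p6.
  have sg' := ray_sign fcU h1 h2 E0 p3 p4 p7 p8.
  have LE := signed_angle_le k1 k2 (etrans sg (esym sg')).
  have LE' := signed_angle_le k2 k1 (etrans sg' (esym sg)).
  rewrite /cmp_real; case: (be); rewrite ?LE ?LE' /ell -E0; exact: id.
have [M1 M2] := M; rewrite al0 v1 in M1 M2.
have B1 s1 s2 t1 : 0 < s1 -> s1 <= s2 -> s2 <= hi al -> 0 < t1 -> t1 <= hi bt ->
    triple_ok L K (r1 0) (r1 s1) (r2 t1) -> triple_ok L K (r1 0) (r1 s2) (r2 t1) ->
    cmp_real be (hingeB K (ell L r1 s1) (ell L r2 t1) (tsep L (r1 s1) (r2 t1)))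
              (hingeB K (ell L r1 s2) (ell L r2 t1) (tsep L (r1 s2) (r2 t1))).
  move=> p1 p2 p3 p4 p5 k1 k2.
  have s10 : s1 <= hi al by exact: le_trans p3.
  have s20 : 0 < s2 by exact: lt_le_trans p2.
  apply: core => //; rewrite ?p1 ?s10 ?s20 ?p3 ?p4 ?p5 //.
  move: (M1 s1 s2 t1 p2); rewrite !rE1 ?rE2 //; try exact: ltW.
  by apply; split; rewrite ?p1 ?s10 ?s20 ?p3 ?p4 ?p5 //; exact/angle_definedP.
have B2 s1 t1 t2 : 0 < s1 -> s1 <= hi al -> 0 < t1 -> t1 <= t2 -> t2 <= hi bt ->
    triple_ok L K (r1 0) (r1 s1) (r2 t1) -> triple_ok L K (r1 0) (r1 s1) (r2 t2) ->
    cmp_real be (hingeB K (ell L r1 s1) (ell L r2 t1) (tsep L (r1 s1) (r2 t1)))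
              (hingeB K (ell L r1 s1) (ell L r2 t2) (tsep L (r1 s1) (r2 t2))).
  move=> p1 p2 p3 p4 p5 k1 k2.
  have t10 : t1 <= hi bt by exact: le_trans p5.
  have t20 : 0 < t2 by exact: lt_le_trans p4.
  apply: core => //; rewrite ?p1 ?p2 ?t10 ?t20 ?p3 ?p5 //.
  move: (M2 s1 t1 t2 p4); rewrite !rE1 ?rE2 //; try exact: ltW.
  by apply; split; rewrite ?p1 ?p2 ?t10 ?t20 ?p3 ?p5 //; exact/angle_definedP.
rewrite v1 wE wE' in k h.
have := hinge_tau oU fcU h1 h2 E0 B1 B2 k h g1 g2 s0 sa t0 tt.
by rewrite /ell -E0 -v1 -!rE1 // -!rE2.
Qed.

Section Side.
Variables (x y : X) (xb yb : model R) (g : curve R X) (u : R) (qb : model R).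
Hypotheses (Ux : U x) (Uy : U y) (cxy : chron L x y).
Hypotheses (s1 : (tau L x y < model_diameter K)%E) (s2 : (tau L y x < model_diameter K)%E).
Hypotheses (p1 : pair_cmp L K x y xb yb) (p2 : pair_cmp L K y x yb xb).
Hypotheses (rg : realizer L g x y) (tg : future_timelike L g) (ug : Defs.in_set g U).
Hypotheses (du : cdom g u) (cor : corresponds L K x (g u) xb yb qb).
Let a := hi g - lo g.
Let fU := U_fin fcU.

Let du' : lo g <= u <= hi g. Proof. by move: du; rewrite /cdom /= in_itv. Qed.

Lemma forward_realizer : realizer L (reparam g false (lo g) 0 a) x y /\
  future_timelike L (reparam g false (lo g) 0 a).
Proof.
have lh := realizer_lt rg; have [_ g0 g1 _] := rg; have [nc lip tl] := tg.
have e1 : affine false (lo g) 0 = lo g by rewrite /affine addr0.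
have e2 : affine false (lo g) a = hi g by rewrite /affine /a; ring.
have a0 : 0 < a by rewrite subr_gt0.
have ne : x <> y by move=> e; move: cxy; rewrite e; apply: chron_irrefl; exact: fU.
have r : realizer L (reparam g false (lo g) 0 a) x y.
  have := @sub_realizer _ _ L g x y false (lo g) 0 a rg (fU Ux Uy) a0 erefl.
  by rewrite e1 e2 g0 g1 !lexx; apply.
split=> //; have [[nc' lip' _] _ _ _] := r; split=> // s t.
rewrite /cdom /= !in_itv /= => hs ht st; apply: tl; rewrite ?ltrD2l //;
  rewrite /cdom /= in_itv /=; move: hs ht; rewrite /a; lra.
Qed.

Lemma reverse_backward :
  reverse (reparam g true (hi g) 0 a) = reparam g false (lo g) 0 a.
Proof.
rewrite /reverse /reparam /=; congr Curve; apply/funext => t.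
by rewrite /affine /a; congr (g _); ring.
Qed.

Lemma side_geodesic : exists c l s, [/\ geodesic_from_to K c l xb yb, qb = c s,
  T x (g u) = s, S x (g u) = s & S y (g u) = l - s].
Proof.
have [[c [l [s [gc /andP[s0 sl] eq]]]] e] := cor; exists c, l, s.
have d1 : (mtau xb yb < model_diameter K)%E by rewrite p1.2.
have d2 : (mtau yb xb < model_diameter K)%E by rewrite p2.2.
have pos : (0 < mtau xb yb)%E by rewrite p1.2; apply/tau_gt0.
have MS := model_side (e := true) gc pos d1 d2.
have [_ _ c0 cl] := gc.
have [_ m1] := MS _ _ (lexx 0) s0 sl; have [_ m2] := MS _ _ (lexx 0) (le_trans s0 sl) (lexx l).
rewrite subr0 c0 -eq e in m1; rewrite subr0 c0 cl p1.2 in m2.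
have [_ g0 g1 _] := rg; have /andP[lu uh] := du'.
have lh := realizer_lt rg.
have cxq : caus L x (g u) by rewrite -g0; apply: (realizer_caus rg).
have cqy : caus L (g u) y by rewrite -g1; apply: (realizer_caus rg).
have Uq := ug du.
have TE : T x (g u) = s by rewrite /tfin m1.
have := realizer_additive rg (fU Ux Uy) lu uh (lexx _); rewrite g1 => m3.
split=> //.
- by rewrite /tsep TE [X in _ + X]/tfin (tau0_of_caus (fU Ux Ux) cxq) addr0.
- rewrite /tsep [X in X + _]/tfin (tau0_of_caus (fU Uq Uq) cqy) add0r.
  by rewrite /tfin m3 /= /tfin m1 m2.
Qed.

Lemma side_at_lo : side_at x y xb yb (g u) qb.
Proof.
have [r tl] := forward_realizer; have [c [l [s [gc eq _ e _]]]] := side_geodesic.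
have /andP[lu uh] := du'; have [_ g0 g1 _] := rg; have [_ h0 h1 _] := r.
exists (reparam g false (lo g) 0 a), (u - lo g), c, l; split; split.
- by [].
- move=> t; rewrite /cdom /= in_itv /= => ht; apply: ug.
  by rewrite /cdom /= in_itv /=; move: ht; rewrite /a; lra.
- by left; split=> //; rewrite h0 h1.
- by rewrite /= addr0.
- by rewrite /= /a addrC subrK.
- by rewrite subr_ge0.
- by rewrite /= /a lerD2r.
- by rewrite /= addrC subrK.
- by [].
- by rewrite e.
Qed.

Lemma side_at_hi : side_at y x yb xb (g u) qb.
Proof.
have [r tl] := forward_realizer; have [c [l [s [gc eq _ _ e]]]] := side_geodesic.
have /andP[lu uh] := du'; have [_ g0 g1 _] := rg; have [_ h0 h1 _] := r.
exists (reparam g true (hi g) 0 a), (hi g - u), (fun t => c (affine true l t)), l; split; split.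
- by [].
- move=> t; rewrite /cdom /= in_itv /= => ht; apply: ug.
  by rewrite /cdom /= in_itv /=; move: ht; rewrite /a; lra.
- right; rewrite reverse_backward; split=> //.
  by rewrite /= subr0 g1 /a subKr g0.
- by rewrite /= subr0.
- by rewrite /= /a subKr.
- by rewrite subr_ge0.
- by rewrite /= /a; lra.
- by rewrite /= subKr.
- case: gc => q1 q2 q3 q4; split.
  + by have [] := geodesic_affine true l q1.
  + by [].
  + by rewrite /affine subr0.
  + by rewrite /affine subrr.
- by rewrite e /affine subKr.
Qed.

End Side.

Hypothesis strict : forall g x y, U x -> U y -> realizer L g x y -> chron L x y ->
  future_timelike L g.

(* Two sides of a triangle always share a vertex; a side paired with itself is the degenerate
   hinge [(x, y, y)]. *)
Lemma monotone_triangle : triangle_comparison L K (cmp_ereal be) U.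
Proof.
move=> p side pb [ch fin rl] us sz /[dup] ct /comparison_tri hc.
have inS (i j : 'I_3) : (i < j)%N -> U (p i) /\ U (p j).
  move=> ij; have r := rl _ _ ij; have lh := ltW (realizer_lt r); have [_ <- <- _] := r.
  by split; apply: us => //; rewrite /cdom /= in_itv /= ?lexx ?lh.
have [U0 U1] := inS i0 i1 isT; have [_ U2] := inS i1 i2 isT.
have UU : forall i, U (p i) by apply: I3_ind.
have PC i j : pair_cmp L K (p i) (p j) (pb i) (pb j) by exact: ct.
have tl i j : i != j -> timelike_related L (p i) (p j).
  by rewrite neq_ltn => /orP[] /ch; [left|right].
have cr i j : causally_related L (p i) (p j).
  have [->|/tl] := eqVneq i j; first by left; exact: caus_refl.
  exact: tl_caus.
have ok i j j' : i != j -> i != j' -> triple_ok L K (p i) (p j) (p j').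
  by move=> n n'; split; [exact: fin|exact: fin|exact: fin|split; exact: fin|
    split; exact: fin|split; exact: fin|split; exact: sz|split; exact: sz|
    split; exact: sz|exact: tl|exact: tl|exact: cr].
have tc i j j' : tri_cmp L K (p i) (p j) (p j') (pb i) (pb j) (pb j').
  by split; split; exact: PC.
have SL (i j : 'I_3) s qb : (i < j)%N -> cdom (side i j) s ->
    corresponds L K (p i) (side i j s) (pb i) (pb j) qb ->
    side_at (p i) (p j) (pb i) (pb j) (side i j s) qb /\
    side_at (p j) (p i) (pb j) (pb i) (side i j s) qb.
  move=> ij ds cs; have st := strict (UU i) (UU j) (rl _ _ ij) (ch _ _ ij).
  split.
    exact: (side_at_lo (UU i) (UU j) (ch _ _ ij) (sz _ _) (sz _ _) (PC _ _) (PC _ _)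
      (rl _ _ ij) st (us _ _ ij) ds cs).
  exact: (side_at_hi (UU i) (UU j) (ch _ _ ij) (sz _ _) (sz _ _) (PC _ _) (PC _ _)
    (rl _ _ ij) st (us _ _ ij) ds cs).
have HC := hinge_comparison.
move=> i j k l s t q1b q2b ij kl ds dt cs ct'.
have [A1 A2] := SL _ _ _ _ ij ds cs; have [B1 B2] := SL _ _ _ _ kl dt ct'.
have nij : i != j by rewrite neq_ltn ij.
have nkl : k != l by rewrite neq_ltn kl.
have nji : j != i by rewrite eq_sym.
have nlk : l != k by rewrite eq_sym.
have : [|| i == k, j == l, i == l | j == k].
  move: ij kl {ds dt cs ct' A1 A2 B1 B2 nij nkl nji nlk}.
  by move: i j k l; do 4 (apply: I3_ind).
case/or4P => /eqP e; subst.
- by apply: (HC _ _ _ _ _ _ _ _ _ _ (ok _ _ _ nij nkl) (tc _ _ _) A1 B1).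
- by apply: (HC _ _ _ _ _ _ _ _ _ _ (ok _ _ _ nji nlk) (tc _ _ _) A2 B2).
- by apply: (HC _ _ _ _ _ _ _ _ _ _ (ok _ _ _ nij nlk) (tc _ _ _) A1 B2).
- by apply: (HC _ _ _ _ _ _ _ _ _ _ (ok _ _ _ nji nkl) (tc _ _ _) A2 B1).
Qed.

End MonotonicityToCurvature.

Lemma monotonicity_curvature (R : realType) (X : metricType R)
    (L : lorentzian_pre_length X) (K : R) (be : bool) :
  locally_strictly_timelike_geodesically_connected L ->
  monotonicity_comparison L K (cmp_real be) -> curvature_bounded L K (cmp_ereal be).
Proof.
move=> hL H p; have [U [oU fcU gU mono]] := H p.
have opU : open U by case: oU.
have strict g x y : U x -> U y -> realizer L g x y -> chron L x y -> future_timelike L g.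
  by move=> Ux Uy rg; apply: (realizer_timelike hL rg); exact: (U_fin fcU Ux Uy).
exists U; split=> //; last exact: monotone_triangle strict.
move=> x y Ux Uy c; split.
  by have [g [ug rg _]] := gU _ _ Ux Uy c; exists g.
by move=> g _ rg; exact: strict rg c.
Qed.

Theorem theorem4p13 (R : realType) (X : metricType R)
    (L : lorentzian_pre_length X) (K : R)
    (hL : locally_strictly_timelike_geodesically_connected L) :
  (timelike_curvature_bounded_below L K <->
     monotonicity_comparison_below L K) /\
  (timelike_curvature_bounded_above L K <->
     monotonicity_comparison_above L K).
Proof.
split; split.
- exact: (@curvature_monotonicity R X L K true).
- exact: (@monotonicity_curvature R X L K true hL).
- exact: (@curvature_monotonicity R X L K false).
- exact: (@monotonicity_curvature R X L K false hL).
Qed.
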